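(* Let $F$ be a non-trivial finite group and define $H_0(k)=\mathbb{Z}^k$, $H_{n+1}(k)=F\wr H_n(k)$ for integers $k\ge1$, $n\ge0$. Let $n\ge1$ be an integer and let $d,k\ge1$ be integers. For $p>0$, there exists a $((\log^{\circ n})^p,\mathrm{L}^0)$-integrable measure equivalence coupling from $H_n(1)$ to $\mathbb{Z}$ if and only if $p<1$.
   Context: $\log^{\circ n}$ is the $n$-fold composition $\log\circ\cdots\circ\log$; $(\log^{\circ n})^{p}$ is used as a non-decreasing function $\mathbb{R}_+\to\mathbb{R}_+$ agreeing with $t\mapsto(\log^{\circ n}t)^{p}$ for large $t$. Wreath product: $F\wr G=\left(\bigoplus_{g\in G}F\right)\rtimes G$, where $\bigoplus_{g\in G}F$ is the group of finitely supported functions $G\to F$ and $G$ acts by $(g\cdot f)(g')=f(g^{-1}g')$. Measure equivalence coupling between countable groups $\Gamma,\Lambda$: a quadruple $(\Omega,X_\Gamma,X_\Lambda,\mu)$ where $(\Omega,\mu)$ is a standard Borel measure space with commuting, free, measure-preserving actions $\gamma\ast x$, $\lambda\ast x$ of $\Gamma$ and $\Lambda$, and $X_\Gamma$ (resp. $X_\Lambda$) is a Borel fundamental domain of finite measure for the $\Gamma$-action (resp. $\Lambda$-action). For $\gamma\in\Gamma$, $x\in X_\Lambda$, $\gamma\cdot x$ is the unique point of $(\Lambda\ast\gamma\ast x)\cap X_\Lambda$ and the cocycle $c_{\Lambda,\Gamma}\colon\Gamma\times X_\Lambda\to\Lambda$ is defined by $c_{\Lambda,\Gamma}(\gamma,x)\ast\gamma\ast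 x=\gamma\cdot x$. For non-decreasing $\varphi\colon\mathbb{R}_+\to\mathbb{R}_+$, $c_{\Lambda,\Gamma}$ is $\varphi$-integrable if for every $\gamma\in\Gamma$ there is $c_\gamma>0$ with $\int_{X_\Lambda}\varphi(|c_{\Lambda,\Gamma}(\gamma,x)|_{S_\Lambda}/c_\gamma)\,d\mu(x)<+\infty$ ($|\cdot|_{S_\Lambda}$ the word length for a finite generating set of $\Lambda$). A $(\varphi,\mathrm{L}^0)$-integrable coupling from $\Gamma$ to $\Lambda$ is one for which $c_{\Lambda,\Gamma}$ is $\varphi$-integrable (no requirement on the other cocycle). *)

(* Defs.v *)
From HB Require Import structures.
From mathcomp Require Import all_boot all_order all_algebra all_fingroup.
From mathcomp Require Import all_classical all_reals all_analysis.
Set Implicit Arguments. Unset Strict Implicit. Unset Printing Implicit Defensive.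
Import Order.TTheory GRing.Theory Num.Theory.

(* The iterated wreath products H_n(1): H_0 = Z, H_{n+1} = F wr H_n.       *)
(* Elements of H_{n+1} are represented as pairs (f, g) with f : H_n -> F  *)
(* and g : H_n; the group H_{n+1} is the subset [Hmem] of pairs whose g   *)
(* lies in H_n and whose f has finite support contained in H_n.           *)
(* Product: (f,g)(f',g') = (x |-> f x * f' (g^-1 x), g g'),               *)
(* i.e. (f + g.f', g g') with (g.f')(x) = f'(g^-1 x).                      *)

Fixpoint Hc (F : finGroupType) (n : nat) : Type :=
  match n with
  | 0 => int
  | m.+1 => ((Hc F m -> F) * Hc F m)%type
  end.

Record gops (T : Type) := GOps {
  gmul : T -> T -> T;
  ginv : T -> T;
  gone : T;
  gmem : T -> Prop }.

Fixpoint Hops (F : finGroupType) (n : nat) : gops (Hc F n) :=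
  match n return gops (Hc F n) with
  | 0 => @GOps int (fun a b => (a + b)%R) (fun a => (- a)%R) 0%R (fun _ => True)
  | m.+1 =>
      let o := Hops F m in
      @GOps ((Hc F m -> F) * Hc F m)%type
        (fun a b => (fun x => (a.1 x * b.1 (gmul o (ginv o a.2) x))%g,
                     gmul o a.2 b.2))
        (fun a => (fun x => (a.1 (gmul o a.2 x))^-1%g, ginv o a.2))
        (fun _ => 1%g, gone o)
        (fun a => gmem o a.2 /\
                  finite_set [set x | a.1 x <> 1%g] /\
                  (forall x, a.1 x <> 1%g -> gmem o x))
  end.

Definition Hmul F n := gmul (Hops F n).
Definition Hone F n := gone (Hops F n).
Definition Hmem F n := gmem (Hops F n).

Local Open Scope classical_set_scope.
Local Open Scope ring_scope.

(* A measurable space is standard Borel iff it is Borel-isomorphic to a   *)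
(* Borel subset of R (Kuratowski).                                        *)
Definition standard_borel (R : realType) (d : measure_display)
    (T : measurableType d) : Prop :=
  exists f : T -> R,
    [/\ measurable_fun setT f, injective f, measurable (range f) &
        forall A, measurable A -> measurable (f @` A)].

Definition is_action (T Om : Type) (mul : T -> T -> T) (one : T)
    (mem : T -> Prop) (act : T -> Om -> Om) : Prop :=
  (forall x, act one x = x) /\
  (forall a b, mem a -> mem b -> forall x, act (mul a b) x = act a (act b x)).

Definition free_action (T Om : Type) (one : T) (mem : T -> Prop)
    (act : T -> Om -> Om) : Prop :=
  forall a x, mem a -> act a x = x -> a = one.

Definition measure_preserving_action (R : realType) (d : measure_display)
    (Om : measurableType d) (mu : {measure set Om -> \bar R}) (T : Type)
    (mem : T -> Prop) (act : T -> Om -> Om) : Prop :=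
  forall a, mem a ->
    measurable_fun setT (act a) /\
    (forall A, measurable A -> mu (act a @^-1` A) = mu A).

Definition fundamental_domain (d : measure_display) (Om : measurableType d)
    (T : Type) (mem : T -> Prop) (act : T -> Om -> Om) (X : set Om) : Prop :=
  measurable X /\ forall x, exists! a, mem a /\ X (act a x).

(* Existence of a measure equivalence coupling (Omega, X_G, X_Z, mu) from *)
(* Gamma = H_n(1) to Lambda = Z whose cocycle c_{Z,Gamma} is              *)
(* phi-integrable (the (phi, L^0)-integrable couplings).                  *)
(* The word length on Z is taken w.r.t. the generating set {1}, i.e.     *)
(* |l|_S = `|l|.  The cocycle c_{Z,Gamma}(gamma, x) for x in X_Z is the   *)
(* unique l with l * gamma * x in X_Z, rendered relationally via c.       *)
Definition phi_L0_coupling_Hn_to_Z (R : realType) (F : finGroupType)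
    (n : nat) (phi : R -> R) : Prop :=
  exists (d : measure_display) (Om : measurableType d)
         (mu : {measure set Om -> \bar R})
         (actG : Hc F n -> Om -> Om) (actZ : int -> Om -> Om)
         (XG XZ : set Om),
    standard_borel R Om /\
    is_action (Hmul (n:=n)) (Hone F n) (Hmem (n:=n)) actG /\
    is_action (fun a b : int => a + b) 0 (fun _ => True) actZ /\
    free_action (Hone F n) (Hmem (n:=n)) actG /\
    free_action 0 (fun _ : int => True) actZ /\
    measure_preserving_action mu (Hmem (n:=n)) actG /\
    measure_preserving_action mu (fun _ : int => True) actZ /\
    (forall a l x, Hmem a -> actG a (actZ l x) = actZ l (actG a x)) /\
    fundamental_domain (Hmem (n:=n)) actG XG /\
    fundamental_domain (fun _ : int => True) actZ XZ /\
    (mu XG < +oo)%E /\ (mu XZ < +oo)%E /\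
    (0 < mu XZ)%E /\
    (forall gamma, Hmem gamma ->
       exists c : Om -> int,
         (forall x, XZ x -> XZ (actZ (c x) (actG gamma x))) /\
         exists cg : R, 0 < cg /\
           (\int[mu]_(x in XZ) (phi ((Num.norm (c x))%:~R / cg))%:E < +oo)%E).

(* Main.v *)
Require Import Defs.
From HB Require Import structures.
From mathcomp Require Import all_boot all_order all_algebra all_fingroup.
From mathcomp Require Import finmap zify ring lra.
From mathcomp Require Import all_classical all_reals all_analysis.
From mathcomp Require Import measurable_realfun.
Set Implicit Arguments.
Unset Strict Implicit.
Unset Printing Implicit Defensive.
Import Order.TTheory GRing.Theory Num.Theory.
Import numFieldNormedType.Exports.

(** Nonexistence for [p >= 1].  Given a coupling, let [B] be the union of the
    first [N] translates of [XZ] under Z.  By Markov's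
    inequality there is a subset of [B] of mass at least a constant times [N] on
    whose points [w] the set [V = {h | h w \in B}] has fewer than [k = O(N)]
    elements, so that its boundary has at least [|V| / (8 ^ n M)] elements as
    soon as [k <= tow n M], essentially [n] exponentials applied to [M]: a fibrewise
    argument together with the bound [2 ^ m]
    on subgraphs of a hypercube of minimal degree [m] raises the isoperimetric
    profile by one exponential per wreath product.  Integrating over a
    fundamental domain of H_n, the boundary has mass at most
    [N mu(|c| > L) + 2 L mu(XZ)], whence [1 = O(M mu(|c| > L))] with
    [log^n L] of order [M], contradicting the integrability of [log^n |c|]
    because tails of integrable functions are little-o.

    Existence for [p < 1].  H_n has Følner sets [U_k] with boundary ratio
    [O(2 ^ -k)] and [log^n |U_k| = O(2 ^ k)] that tile each other,
    [U_(k+1) = S_k U_k].  Writing [N_k = |U_k|] and identifying the intervals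
    [i / N_k, (i + 1) / N_k) of the circle both with the elements of [U_k] and
    with the integers below [N_k], the group H_n acts on a conull Borel subset of
    the line by piecewise rational translations commuting with Z, and the
    unit interval is a fundamental domain for both.  The cocycle is at most [N_k]
    outside a set of measure [O(2 ^ -k)], so the integral is bounded by
    [\sum_k 2 ^ -k (2 ^ k) ^ p]. *)

(** * Groups *)

(** Nothing bounds the number of points that one orbit of H_n has in the box, so the isoperimetric
    inequality is available only on orbits with few visits. That property is invariant under H_n but
    not under Z; testing it on a window symmetric about height 0 yields one set of positive measure
    all of whose relevant Z-translates are good for the box. With L = N / M ^ 2 the margin 2 L,
    multiplied by the boundary ratio O(M), is negligible against N, while a polynomial factor in M
    is absorbed by one exponential.

    In the tower the new factor stands on the left whereas H_n acts by right multiplication. Indices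
    whose elements differ by a right factor h at one level therefore have descendants related in the
    same way at all later levels, which makes the partial translations of h compatible. They
    conserve the integer part of a point plus the integer attached to its index; this conservation
    law is what makes the unit interval a fundamental domain for H_n. *)

Record group_laws (T : Type) (o : gops T) : Prop := GroupLaws {
  opA : associative (gmul o);
  op1g : left_id (gone o) (gmul o);
  opVg : left_inverse (gone o) (ginv o) (gmul o);
  mem_one : gmem o (gone o);
  mem_mul : forall a b, gmem o a -> gmem o b -> gmem o (gmul o a b);
  mem_inv : forall a, gmem o a -> gmem o (ginv o a) }.

Section GroupTheory.
Variables (T : Type) (o : gops T).
Hypothesis ol : group_laws o.
Local Notation "x ** y" := (gmul o x y) (at level 40, left associativity).
Local Notation "x ^-" := (ginv o x) (at level 3, format "x ^-").
Local Notation e := (gone o).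

Lemma opgV x : x ** x^- = e.
Proof.
rewrite -[LHS](op1g ol) -{1}(opVg ol x^-) -(opA ol) (opA ol x^-).
by rewrite (opVg ol) (op1g ol) (opVg ol).
Qed.

Lemma opg1 x : x ** e = x.
Proof. by rewrite -(opVg ol x) (opA ol) opgV (op1g ol). Qed.

Lemma opKg x y : x^- ** (x ** y) = y.
Proof. by rewrite (opA ol) (opVg ol) (op1g ol). Qed.

Lemma opKVg x y : x ** (x^- ** y) = y.
Proof. by rewrite (opA ol) opgV (op1g ol). Qed.

Lemma opgK x y : y ** x ** x^- = y.
Proof. by rewrite -(opA ol) opgV opg1. Qed.

Lemma opgKV x y : y ** x^- ** x = y.
Proof. by rewrite -(opA ol) (opVg ol) opg1. Qed.

Lemma opgI x : injective (gmul o x).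
Proof. by move=> y z /(congr1 (gmul o x^-)); rewrite !opKg. Qed.

Lemma opIg x : injective (gmul o ^~ x).
Proof. by move=> y z /(congr1 (gmul o ^~ x^-)); rewrite !opgK. Qed.

Lemma inv_uniq x y : x ** y = e -> y = x^-.
Proof. by move=> xy; apply: (opgI (x := x)); rewrite xy opgV. Qed.

Lemma inv_invg x : (x^-)^- = x.
Proof. by symmetry; apply: inv_uniq; rewrite (opVg ol). Qed.

Lemma inv_mul x y : (x ** y)^- = y^- ** x^-.
Proof. by symmetry; apply: inv_uniq; rewrite (opA ol) opgK opgV. Qed.

Lemma inv_one : e^- = e.
Proof. by symmetry; apply: inv_uniq; rewrite (op1g ol). Qed.

End GroupTheory.

(** The successor case of [Hops] over an arbitrary base, to which [Hops F n.+1] is convertible, so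
    that inductions treat one wreath product at a time. The carrier is the unrestricted wreath
    product, where the group laws hold globally; [gmem] cuts out the finitely supported part. *)
Definition wreath (F : finGroupType) (T : Type) (o : gops T) :
    gops ((T -> F) * T) :=
  GOps
    (fun a b => (fun x => (a.1 x * b.1 (gmul o (ginv o a.2) x))%g,
                 gmul o a.2 b.2))
    (fun a => (fun x => (a.1 (gmul o a.2 x))^-1%g, ginv o a.2))
    (fun _ => 1%g, gone o)
    (fun a => gmem o a.2 /\
              finite_set [set x | a.1 x <> 1%g]%classic /\
              (forall x, a.1 x <> 1%g -> gmem o x)).

Lemma wreath_laws (F : finGroupType) (T : Type) (o : gops T) :
  group_laws o -> group_laws (wreath F o).
Proof.
move=> ol; split => /=.
- move=> a b c /=; congr pair; last exact: opA ol _ _ _.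
  by apply/funext => x; rewrite mulgA (inv_mul ol) (opA ol).
- move=> [f g] /=; rewrite (op1g ol); congr pair; apply/funext => x.
  by rewrite mul1g (inv_one ol) (op1g ol).
- move=> [f g] /=; rewrite (opVg ol); congr pair; apply/funext => x.
  by rewrite (inv_invg ol) mulVg.
- split; first exact: mem_one.
  split => //.
  by rewrite (_ : [set _ | _]%classic = set0)//; apply/seteqP; split.
- move=> [f g] [f' g'] /= [mg [ff fm]] [mg' [ff' fm']]; split.
    exact: mem_mul.
  have sub x : (f x * f' (gmul o (ginv o g) x))%g <> 1%g ->
      f x <> 1%g \/ f' (gmul o (ginv o g) x) <> 1%g.
    move=> h; have [fx|] := pselect (f x = 1%g); last by left.
    by right => f'x; apply: h; rewrite fx f'x mulg1.
  split.
    apply: (@sub_finite_set _ _ ([set x | f x <> 1%g] `|`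
       gmul o g @` [set x | f' x <> 1%g])%classic).
      move=> x /= /sub [|] h; [by left|right].
      by exists (gmul o (ginv o g) x) => //; rewrite (opKVg ol).
    by rewrite finite_setU; split => //; exact: finite_image.
  move=> x /sub [|/fm' h]; first exact: fm.
  by rewrite -(opKVg ol g x); apply: mem_mul.
- move=> [f g] /= [mg [ff fm]]; split; first exact: mem_inv.
  have sub x : ((f (gmul o g x))^-1)%g <> 1%g -> f (gmul o g x) <> 1%g.
    by move=> h h'; apply: h; rewrite h' invg1.
  split.
    apply: (@sub_finite_set _ _
       (gmul o (ginv o g) @` [set x | f x <> 1%g])%classic).
      move=> x /= /sub h; exists (gmul o g x) => //.
      by rewrite (opKg ol).
    exact: finite_image.
  move=> x /sub /fm h; rewrite -(opKg ol g x); apply: mem_mul => //.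
  exact: mem_inv.
Qed.

Lemma Hops_laws (F : finGroupType) (n : nat) : group_laws (Hops F n).
Proof.
elim: n => [|n IH]; last exact: wreath_laws IH.
by split => //= [a b c|a|a] /=; lia.
Qed.

(** * Isoperimetry of iterated wreath products *)

Local Open Scope fset_scope.

Lemma card_fset_sum (T : choiceType) (A : {fset T}) (P : pred T) :
  #|` [fset x in A | P x]| = (\sum_(x <- A) P x)%N.
Proof. by rewrite card_fset_sum1 big_fset big_mkcond. Qed.

(** * Subgraphs of the graph of lamp configurations *)

Section Hypercube.
Variables (T : choiceType) (F : finGroupType).

(** The edges of the graph, with one direction for each coordinate [g]. When [a] has order above
    two, a line of the hypercube becomes a cycle, which is why [a] and its inverse count as a single
    direction below. *)
Definition upd (f : T -> F) (g : T) (b : F) : T -> F :=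
  fun x => if x == g then (f x * b)%g else f x.

Lemma updK f g b : upd (upd f g b) g b^-1%g = f.
Proof.
by apply/funext => x; rewrite /upd; case: eqP => // _; rewrite mulgK.
Qed.

Lemma updVK f g b : upd (upd f g b^-1%g) g b = f.
Proof. by rewrite -{2}(invgK b) updK. Qed.

Lemma upd_neq f g b : b != 1%g -> (upd f g b) g != f g.
Proof.
move=> b1; rewrite /upd eqxx; apply: contra b1 => /eqP h.
by apply/eqP/(mulgI (f g)); rewrite mulg1.
Qed.

Variable a : F.
Hypothesis a1 : a != 1%g.

(* Fixing the value at a coordinate that some edge of [W] changes produces two
   disjoint slices, each losing at most that one direction at every vertex. *)
Lemma hypercube_min_degree m (W : {fset T -> F}) (D : {fset T}) :
  W != fset0 ->
  (forall f, f \in W ->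
    m <= #|` [fset g in D | (upd f g a \in W) || (upd f g a^-1%g \in W)]|)%N ->
  (2 ^ m <= #|` W|)%N.
Proof.
elim: m W => [|m IH] W W0 deg; first by rewrite expn0 cardfs_gt0.
have [f0 f0W] : exists f, f \in W by case/fset0Pn: W0 => f; exists f.
have d0 := deg f0 f0W.
have [g0 [f1 f1W f10]] : exists g0, exists2 f1, f1 \in W & f1 g0 != f0 g0.
  have : (0 < #|` [fset g in D | (upd f0 g a \in W) || (upd f0 g a^-1%g \in W)]|)%N.
    exact: leq_trans d0.
  rewrite cardfs_gt0 => /fset0Pn[g]; rewrite !inE /= => /andP[_ /orP[h|h]];
    exists g; eexists; try exact: h; apply: upd_neq => //.
  by rewrite invg_eq1.
pose Wi (v : F) := [fset f in W | f g0 == v].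
have cardWi f' : f' \in W -> (2 ^ m <= #|` Wi (f' g0)|)%N.
  move=> f'W; apply: IH.
    by apply/fset0Pn; exists f'; rewrite !inE /= f'W eqxx.
  move=> f; rewrite !inE /= => /andP[fW /eqP fg0].
  rewrite -ltnS; apply: leq_trans (deg f fW) _.
  set A := [fset g in D | _]; set B := [fset g in D | _].
  have AB : A `<=` g0 |` B.
    apply/fsubsetP => g; rewrite !inE /= => /andP[-> h].
    have [//|gg0] := eqVneq g g0.
    have ug b : upd f g b g0 = f' g0 by rewrite /upd eq_sym (negbTE gg0).
    by rewrite !ug !eqxx !andbT.
  apply: leq_trans (fsubset_leq_card AB) _.
  by rewrite cardfsU1; case: (_ \notin _) => /=; lia.
have sub : Wi (f0 g0) `|` Wi (f1 g0) `<=` W.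
  by apply/fsubsetP => f; rewrite !inE /= => /orP[] /andP[].
apply: leq_trans (fsubset_leq_card sub).
have -> : #|` Wi (f0 g0) `|` Wi (f1 g0)| = (#|` Wi (f0 g0)| + #|` Wi (f1 g0)|)%N.
  rewrite -cardfsUI; suff -> : Wi (f0 g0) `&` Wi (f1 g0) = fset0.
    by rewrite cardfs0 addn0.
  apply/fsetP => f; rewrite !inE /=; apply/negP => /andP[/andP[_ /eqP h0]].
  by move=> /andP[_ /eqP h1]; move: f10; rewrite -h0 -h1 eqxx.
by rewrite expnS mul2n -addnn leq_add // cardWi.
Qed.

(* Repeatedly deleting vertices of degree below [m] keeps the average degree. *)
Lemma hypercube_avg_degree m (W : {fset T -> F}) (D : {fset T}) :
  W != fset0 ->
  (2 * m * #|` W| <= \sum_(f <- W) \sum_(g <- D) (upd f g a \in W))%N ->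
  (2 ^ m <= #|` W|)%N.
Proof.
have [k] := ubnP #|` W|; elim: k => // k IH in W * => Wk W0 E.
have [degW|] := pselect (forall f, f \in W ->
    m <= #|` [fset g in D | (upd f g a \in W) || (upd f g a^-1%g \in W)]|)%N.
  exact: hypercube_min_degree degW.
move=> /existsNP[f] /not_implyP[fW /negP]; rewrite -ltnNge => degf.
pose W1 := W `\ f.
have cW : #|` W| = #|` W1|.+1 by rewrite (cardfsD1 f) fW add1n.
have nf g b : b != 1%g -> upd f g b != f.
  by move=> b1; apply: contra (upd_neq f g b1) => /eqP ->.
(* Edges are oriented along [a]. Deleting [f] loses those that start at [f] and those that end
   there; the latter are found by stepping back along the inverse of [a]. *)
have splitE : (\sum_(f' <- W) \sum_(g <- D) (upd f' g a \in W) =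
  \sum_(g <- D) (upd f g a \in W) + (\sum_(g <- D) (upd f g a^-1%g \in W) +
  \sum_(f' <- W1) \sum_(g <- D) (upd f' g a \in W1)))%N.
  rewrite (big_fsetD1 f fW) /=; congr (_ + _)%N.
  rewrite [in RHS]exchange_big /= -big_split /= exchange_big /=.
  apply: eq_bigr => g _.
  have -> : (upd f g a^-1%g \in W) = (\sum_(f' <- W1) (upd f' g a == f))%N :> nat.
    have mW1 : (upd f g a^-1%g \in W1) = (upd f g a^-1%g \in W).
      by rewrite !inE /= nf // invg_eq1.
    rewrite -mW1; have [h|h] := boolP (_ \in W1).
      rewrite (big_fsetD1 _ h) /= updVK eqxx big_seq big1 // => f'.
      rewrite !inE => /andP[h1 _]; apply/eqP; rewrite eqb0.
      by apply: contra h1 => /eqP <-; rewrite updK.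
    rewrite big_seq big1 // => f' h'; apply/eqP; rewrite eqb0.
    by apply: contra h => /eqP <-; rewrite updK.
  rewrite -big_split /=; apply: eq_bigr => f' _.
  by rewrite !inE; case: eqP => [->|_] //=; rewrite fW.
(* Fewer than [m] edges of each orientation are lost, fewer than [2 * m] in total, so the average
   stays at least [2 * m]. *)
have degs b : b \in [:: a; a^-1%g] -> (\sum_(g <- D) (upd f g b \in W) < m)%N.
  move=> bi; apply: leq_ltn_trans degf; rewrite card_fset_sum.
  apply: leq_sum => g _; move: bi; rewrite !inE => /orP[] /eqP ->.
    by case: (_ \in W).
  by case: (_ \in W); rewrite ?orbT.
have d1 := degs a; have d2 := degs a^-1%g; rewrite !inE eqxx /= in d1.
rewrite !inE eqxx orbT /= in d2; have {}d1 := d1 isT; have {}d2 := d2 isT.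
move: E; rewrite splitE cW mulnS => E.
have [W10|W10] := eqVneq W1 fset0.
  exfalso; move: E; rewrite W10 cardfs0 big_seq_fset0 addn0 muln0.
  have Wf : W = [fset f].
    apply/fsetP => h; have /fsetP/(_ h) := W10; rewrite !inE.
    by case: eqP => [-> _|_ /= ->].
  rewrite !big1 ?addn0; first by lia.
  - by move=> g _; rewrite Wf inE (negbTE (nf _ _ _)) // invg_eq1.
  - by move=> g _; rewrite Wf inE (negbTE (nf _ _ _)).
have leW : (#|` W1| <= #|` W|)%N by rewrite cW.
have h1 : (#|` W1| < k)%N by move: Wk; rewrite cW; lia.
have h2 : (2 * m * #|` W1| <= \sum_(f0 <- W1) \sum_(g <- D) (upd f0 g a \in W1))%N.
  have ar x y A c : (x < m -> y < m -> 2 * m + 2 * m * c <= x + (y + A) -> 2 * m * c <= A)%N by lia.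
  exact: ar d1 d2 E.
have : (2 ^ m <= #|` W1|)%N by exact: IH.
exact: leqW.
Qed.

End Hypercube.

Definition bdry (T : Type) (o : gops T) (V : {fset {classic T}}) (s : T) :=
  [fset v in V | (gmul o v s : {classic T}) \notin V].

(** A lower bound 1 / [D] for the isoperimetric profile at volumes below [M], in the Cayley graph of
    right multiplication by [S]. *)
Definition isoper (T : Type) (o : gops T) (S : seq T) (M D : nat) :=
  forall V : {fset {classic T}}, V != fset0 -> (#|` V| < M)%N ->
    (#|` V| <= D * \sum_(s <- S) #|` bdry o V s|)%N.

Definition lamp (F : finGroupType) (T : Type) (o : gops T) (a : F) :
  (T -> F) * T :=
  (fun x => if (x : {classic T}) == gone o then a else 1%g, gone o).

Definition walk (F : finGroupType) (T : Type) (s : T) : (T -> F) * T :=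
  (fun=> 1%g, s).

(** * One exponential gained by one wreath product *)

Section IsoperWreath.
Variables (F : finGroupType) (T : Type) (o : gops T).
Hypothesis ol : group_laws o.
Local Notation C := {classic T}.
Local Notation TW := {classic ((T -> F) * T)}.
Local Notation wr := (wreath F o).

(** Right multiplication by the lamp generator changes the lamp at the current position only: it is
    an edge in direction [v.2] of the graph of configurations. *)
Lemma wreath_lamp (a : F) (v : (T -> F) * T) :
  gmul wr v (lamp o a) = (upd (T := C) v.1 v.2 a, v.2).
Proof.
rewrite /= (opg1 ol); congr pair; apply/funext => x; rewrite /upd.
have -> : ((gmul o (ginv o v.2) x : C) == gone o) = ((x : C) == v.2).
  apply/eqP/eqP => [h|->]; last exact: opVg.
  by rewrite -(opKVg ol v.2 x) h (opg1 ol).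
by case: eqP => //; rewrite mulg1.
Qed.

Lemma wreath_walk (s : T) (v : (T -> F) * T) :
  gmul wr v (walk F s) = (v.1, gmul o v.2 s).
Proof. by rewrite /=; congr pair; apply/funext => x; rewrite mulg1. Qed.

Let cfg (v : TW) : C -> F := fst v.
Let pos (v : TW) : C := snd v.

Let fibre (V : {fset TW}) (f : C -> F) : {fset C} :=
  [fset pos v | v in [fset v in V | cfg v == f]].

Let in_fibre V f g : (g \in fibre V f) = (((f, g) : TW) \in V).
Proof.
apply/imfsetP/idP => /= [[[f' g']]|h].
  by rewrite !inE /= => /andP[h /eqP <-] ->.
by exists ((f, g) : TW) => //; rewrite !inE h /= /cfg /=.
Qed.

Let sum_fibre (V : {fset TW}) (W : {fset C -> F}) (P : (C -> F) -> C -> bool) :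
  (forall v, v \in V -> cfg v \in W) ->
  (\sum_(f <- W) #|` [fset g in fibre V f | P f g]| =
   #|` [fset v in V | P (cfg v) (pos v)]|)%N.
Proof.
move=> VW; rewrite card_fset_sum.
transitivity (\sum_(v <- V) \sum_(f <- W)
   ((cfg v == f) && P f (pos v)))%N; last first.
  rewrite big_seq [RHS]big_seq; apply: eq_bigr => v vV.
  rewrite (big_fsetD1 _ (VW _ vV)) /= eqxx /= big_seq big1 ?addn0 // => f.
  by rewrite !inE eq_sym => /andP[/negbTE ->].
rewrite exchange_big /=; apply: eq_bigr => f _.
rewrite -card_fset_sum.
have injp : {in [fset v in V | (cfg v == f) && P f (pos v)] &, injective pos}.
  move=> [f1 g1] [f2 g2]; rewrite !inE /=.
  by rewrite /cfg /pos /= => /andP[_ /andP[/eqP -> _]] /andP[_ /andP[/eqP -> _]] ->.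
have /card_in_imfsetP/eqP <- := injp.
congr #|` _|; apply/fsetP => g; rewrite !inE /= in_fibre.
apply/andP/imfsetP => /= [[h1 h2]|[[f' g']]].
  by exists ((f, g) : TW) => //; rewrite !inE /= h1 /cfg /= eqxx.
by rewrite !inE /= /cfg /pos /= => /andP[h1 /andP[/eqP <- h2]] ->.
Qed.

(** Let V have too small a boundary and cut it into fibres over lamp configurations. Fibres with
    fewer than [4 * m] positions obey the isoperimetry of the base, so together they are a small
    part of V. Over the large fibres at least half of the lamp edges stay inside, hence their
    configurations span a graph of average degree at least [4 * m / 2], and there are at least
    [2 ^ m] of them. The factor 8 makes both losses less than an eighth of V. *)
Lemma isoper_wreath (S : seq T) (m D : nat) (a : F) : a != 1%g -> (0 < D)%N ->
  isoper o S (4 * m) D ->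
  isoper wr (lamp o a :: [seq walk F s | s <- S]) (2 ^ m) (8 * D).
Proof.
move=> a1 D0 isoS V V0 Vm; rewrite big_cons big_map.
rewrite leqNgt; apply/negP => small.
pose W0 : {fset C -> F} := [fset cfg v | v in V].
have VW0 v : v \in V -> cfg v \in W0 by move=> vV; apply/imfsetP; exists v.
pose big f := (4 * m <= #|` fibre V f|)%N.
pose Vs := [fset v in V | ~~ big (cfg v)].
pose Vb := [fset v in V | big (cfg v)].
have cV : (#|` V| = #|` Vb| + #|` Vs|)%N.
  rewrite -(cardfsID Vb V); congr (_ + _)%N; congr #|` _|; apply/fsetP => v;
    rewrite !inE; by case: (v \in V); rewrite ?andbT ?andbF //= ?andbT.
(* A walk keeps the configuration, so the boundaries of the fibres add up to at most the boundary of
   V in the walk directions. *)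
have cVs : (#|` Vs| <= D * \sum_(s <- S) #|` bdry wr V (walk F s)|)%N.
  pose W := [fset f in W0 | ~~ big f].
  rewrite -[Vs](_ : [fset v in Vs | true] = _); last first.
    by apply/fsetP => v; rewrite !inE andbT.
  rewrite -(@sum_fibre Vs W (fun _ _ => true)); last first.
    by move=> v; rewrite !inE /= => /andP[vV ->]; rewrite VW0.
  have fibVs f : f \in W -> fibre Vs f = fibre V f.
    rewrite !inE => /andP[_ nb]; apply/fsetP => g.
    by rewrite !in_fibre !inE /= nb andbT.
  apply: (@leq_trans (\sum_(f <- W) D * \sum_(s <- S) #|` bdry o (fibre V f) s|)%N).
    rewrite big_seq [leqRHS]big_seq; apply: leq_sum => f fW.
    rewrite (_ : [fset g in _ | true] = fibre V f); last first.
      by rewrite fibVs //; apply/fsetP => g; rewrite !inE andbT.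
    apply: isoS; last by move: fW; rewrite !inE => /andP[_]; rewrite -ltnNge.
    move: fW; rewrite !inE => /andP[/imfsetP[/= v vV ->] _].
    by apply/fset0Pn; exists (pos v); rewrite in_fibre /cfg /pos -surjective_pairing.
  rewrite -big_distrr leq_mul2l /= exchange_big /=; apply/orP; right.
  apply: leq_sum => s _.
  rewrite /bdry.
  apply: (@leq_trans (\sum_(f <- W0)
     #|` [fset g in fibre V f | (gmul o g s : C) \notin fibre V f]|)%N).
    rewrite /W -big_fset_condE big_mkcond /=; apply: leq_sum => f _.
    by case: ifP.
  rewrite (@sum_fibre V W0 (fun f g => (gmul o g s : C) \notin fibre V f)) //.
  apply/eq_leq; congr #|` _|; apply/fsetP => v; rewrite !inE.
  by rewrite in_fibre wreath_walk.
pose Wb : {fset C -> F} := [fset cfg v | v in Vb].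
have VWb v : v \in Vb -> cfg v \in Wb by move=> vV; apply/imfsetP; exists v.
have fibVb f : f \in Wb -> (4 * m <= #|` fibre Vb f|)%N.
  move=> /imfsetP[/= v]; rewrite !inE => /andP[vV bv] ->.
  rewrite (_ : fibre Vb _ = fibre V (cfg v)) //; apply/fsetP => g.
  by rewrite !in_fibre !inE /= bv andbT.
have cVb : (4 * m * #|` Wb| <= #|` Vb|)%N.
  rewrite -[leqRHS](_ : #|` [fset v in Vb | true]| = _); last first.
    by congr #|` _|; apply/fsetP => v; rewrite !inE andbT.
  rewrite -(@sum_fibre Vb Wb (fun _ _ => true)) //.
  rewrite card_fset_sum1 big_distrr /= big_seq [leqRHS]big_seq.
  apply: leq_sum => f fW; rewrite muln1; apply: leq_trans (fibVb f fW) _.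
  by apply/fsubset_leq_card/fsubsetP => g gV; rewrite !inE gV.
pose E := [fset v in Vb | (gmul wr v (lamp o a) : TW) \in Vb].
have cE : (#|` Vb| <= #|` E| + (#|` bdry wr V (lamp o a)| + #|` Vs|))%N.
  pose B2 := [fset v in Vb | (gmul wr v (lamp o a) : TW) \in Vs].
  have cB2 : (#|` B2| <= #|` Vs|)%N.
    have inj : {in B2 &, injective (fun v : TW => gmul wr v (lamp o a) : TW)}.
      by move=> u v _ _ uv; exact: (opIg (wreath_laws F ol) uv).
    have /card_in_imfsetP/eqP <- := inj.
    apply/fsubset_leq_card/fsubsetP => v /imfsetP[/= u].
    by rewrite !inE => /andP[_ /andP[h1 h2]] ->; apply/andP.
  have sub : Vb `<=` E `|` (bdry wr V (lamp o a) `|` B2).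
    apply/fsubsetP => v vVb; rewrite !inE; move: (vVb); rewrite !inE => -> /=.
    move: vVb; rewrite !inE => /andP[-> _] /=.
    by case: (_ \in V); case: (big _).
  apply: leq_trans (fsubset_leq_card sub) _.
  apply: leq_trans (leq_card_fsetU _ _) _.
  rewrite leq_add2l; apply: leq_trans (leq_card_fsetU _ _) _.
  by rewrite leq_add2l.
pose Dr : {fset C} := [fset pos v | v in V].
(* The position of the walker names the direction of the edge between the two configurations. *)
have cE2 : (#|` E| <= \sum_(f <- Wb) \sum_(g <- Dr) (upd f g a \in Wb))%N.
  rewrite (_ : E = [fset v in Vb | ((upd (T := C) (cfg v) (pos v) a, pos v) : TW) \in Vb]); last first.
    by apply/fsetP => v; rewrite !inE wreath_lamp.
  rewrite -(@sum_fibre Vb Wb (fun f g => ((upd (T := C) f g a, g) : TW) \in Vb)) //.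
  apply: leq_sum => f _; rewrite -card_fset_sum; apply/fsubset_leq_card/fsubsetP => g.
  rewrite !inE => /and3P[h1 h2 h3]; apply/andP; split.
    apply/imfsetP; exists ((f, g) : TW) => //=.
    by move: h1; rewrite in_fibre !inE => /andP[].
  by apply/imfsetP; exists ((upd (T := C) f g a, g) : TW) => //=; rewrite !inE h2.
have [vb0 vb2] : (0 < #|` Vb|)%N /\ (#|` Vb| <= 2 * #|` E|)%N.
  have h1 : (8 * #|` Vs| <= 8 * D * \sum_(s <- S) #|` bdry wr V (walk F s)|)%N.
    by rewrite -mulnA leq_mul2l.
  have h2 : (8 * #|` bdry wr V (lamp o a)| <= 8 * D * #|` bdry wr V (lamp o a)|)%N.
    by rewrite leq_mul2r leq_pmulr // orbT.
  have ar p q X Y v vb vs e : (p + q < v -> v = vb + vs -> vb <= e + (Y + vs) ->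
      8 * vs <= q -> 8 * Y <= p -> 0 < vb /\ vb <= 2 * e)%N by lia.
  by move: small; rewrite mulnDr => small; exact: ar small cV cE h1 h2.
have Wb0 : Wb != fset0.
  move: vb0; rewrite cardfs_gt0 => /fset0Pn[v vV].
  by apply/fset0Pn; exists (cfg v); exact: VWb.
have : (2 ^ m <= #|` Wb|)%N.
  apply: (@hypercube_avg_degree _ _ a a1 m Wb Dr) => //.
  have ar c v e : (4 * m * c <= v -> v <= 2 * e -> 2 * m * c <= e)%N by lia.
  by apply: leq_trans cE2; exact: ar cVb vb2.
have cWb : (#|` Wb| <= #|` Vb|)%N by exact: leq_imfset_card.
by apply/negP; rewrite -ltnNge (leq_ltn_trans cWb) // (leq_ltn_trans _ Vm) // cV leq_addr.
Qed.

End IsoperWreath.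

(** A finite nonempty set cannot be closed under the successor, so it has at least one boundary
    point. *)
Lemma isoper_int (F : finGroupType) (M : nat) :
  isoper (Hops F 0) [:: 1%R : int] M M.
Proof.
move=> V V0 VM; rewrite big_seq1.
apply: leq_trans (ltnW VM) _; rewrite leq_pmulr // lt0n cardfs_eq0.
apply/eqP => b0; have [v0 v0V] : exists v, v \in V by case/fset0Pn: V0 => v; exists v.
have step n : ((v0 : int) + n%:Z : {classic int})%R \in V.
  elim: n => [|n IH]; first by rewrite (_ : _ + _ = v0)%R // addr0.
  apply: contraT => h; have := in_fset0 ((v0 : int) + n%:Z : {classic int})%R.
  rewrite -b0 !inE IH /= => /negbT; rewrite negbK.
  rewrite (_ : ((v0 : int) + n%:Z + 1)%R = (v0 : int) + n.+1%:Z)%R ?(negbTE h) //.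
  by rewrite -addrA -PoszD addn1.
pose U := [fset ((v0 : int) + (nat_of_ord n)%:Z : {classic int})%R | n in 'I_(#|` V|.+1)].
have : (#|` U| <= #|` V|)%N.
  by apply/fsubset_leq_card/fsubsetP => v /imfsetP[/= n _ ->].
rewrite card_imfset /=; last by move=> i j /addrI [] /ord_inj.
by rewrite size_enum_ord ltnn.
Qed.

Lemma isoper_le (T : Type) (o : gops T) (S : seq T) (M M' D : nat) :
  (M' <= M)%N -> isoper o S M D -> isoper o S M' D.
Proof. by move=> MM iso V V0 VM; apply: iso => //; exact: leq_trans MM. Qed.

(** The quotient by 4 pays for the threshold [4 * m] in [isoper_wreath]. *)
Fixpoint tow (n M : nat) : nat :=
  if n is m.+1 then 2 ^ (tow m M %/ 4) else M.

(** A single lamp element per level: isoperimetry in the subgroup that these elements generate is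
    all that the lower bound uses. *)
Fixpoint Hgens (F : finGroupType) (a : F) (n : nat) : seq (Hc F n) :=
  match n with
  | 0 => [:: 1%R : int]
  | m.+1 => lamp (Hops F m) a :: [seq walk F s | s <- Hgens a m]
  end.

Lemma isoper_H (F : finGroupType) (a : F) (n M : nat) : a != 1%g -> (0 < M)%N ->
  isoper (Hops F n) (Hgens a n) (tow n M) (8 ^ n * M).
Proof.
move=> a1 M0; elim: n => [|n IH]; first by rewrite mul1n; exact: isoper_int.
rewrite expnS -mulnA; apply: (isoper_wreath (Hops_laws F n) a1).
  by rewrite muln_gt0 expn_gt0.
by apply: isoper_le IH; rewrite mulnC leq_trunc_div.
Qed.

Lemma Hgens_mem (F : finGroupType) (a : F) (n : nat) (s : Hc F n) :
  List.In s (Hgens a n) -> Hmem s.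
Proof.
elim: n s => [|n IH] //= s [<-|].
  rewrite /Hmem /=; split; first exact: mem_one (Hops_laws F n).
  split; last by move=> x /=; case: eqP => // -> _; exact: mem_one (Hops_laws F n).
  apply: (@sub_finite_set _ _ [set gone (Hops F n)]%classic) => //.
  by move=> x /=; case: eqP.
move=> /List.in_map_iff[t [<- /IH mt]]; rewrite /Hmem /=; split => //.
by split => //; rewrite (_ : [set _ | _]%classic = set0)//; apply/seteqP; split.
Qed.

(** * Følner towers of iterated wreath products *)

Record tower (T : Type) (o : gops T) (U S : nat -> {fset {classic T}}) : Prop := Tower {
  tower_mem : forall k u, u \in U k -> gmem o u;
  tower_cover : forall k v, v \in U k.+1 <->
    exists s u : {classic T}, [/\ s \in S k, u \in U k & v = gmul o s u];
  tower_uniq : forall k (s s' u u' : {classic T}),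
    s \in S k -> s' \in S k -> u \in U k -> u' \in U k ->
    gmul o s u = gmul o s' u' -> s = s' /\ u = u';
  tower_bdry : forall g, gmem o g -> exists c : nat, forall k,
    (2 ^ k * #|` bdry o (U k) g| <= c * #|` U k|)%N;
  tower_size : forall k, (2 ^ k <= #|` U k|)%N }.

Lemma card_fsetM (K K' : choiceType) (A : {fset K}) (B : {fset K'}) :
  #|` A `*` B| = (#|` A| * #|` B|)%N.
Proof.
pose f (u : A * B) : K * K' := (val u.1, val u.2).
have f_inj : injective f by move=> [a b] [a' b'] [/val_inj -> /val_inj ->].
have -> : A `*` B = [fset f u | u in {: A * B}].
  apply/fsetP => -[x y]; rewrite in_fsetM /=; apply/andP/imfsetP => /=.
    by move=> [xA yB]; exists ([` xA], [` yB]).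
  by move=> [[a b] _ [-> ->]]; rewrite !fsvalP.
by rewrite card_imfset //= -cardE card_prod !cardfE.
Qed.

Section Supported.
Variables (F : finGroupType) (C : choiceType).

Definition extend (A : {fset C}) (f : {ffun A -> F}) : C -> F :=
  fun x => if insub x is Some a then f a else 1%g.

Definition supported (A : {fset C}) : {fset C -> F} :=
  [fset extend f | f in {: {ffun A -> F}}].

Lemma extend_inj A : injective (@extend A).
Proof.
move=> f g fg; apply/ffunP => a; have := congr1 (fun h => h (val a)) fg.
by rewrite /extend valK.
Qed.

Lemma in_supported A f : f \in supported A <-> (forall x, x \notin A -> f x = 1%g).
Proof.
split.
  by move=> /imfsetP[/= g _ ->] x xA; rewrite /extend insubN.
move=> h; apply/imfsetP; exists [ffun a : A => f (val a)] => //=.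
apply/funext => x; rewrite /extend; case: insubP => [a xA <-|/h ->//].
by rewrite ffunE.
Qed.

Lemma card_supported A : #|` supported A| = (#|F| ^ #|` A|)%N.
Proof.
rewrite card_imfset; last exact: extend_inj.
by rewrite /= -cardE card_ffun cardfE.
Qed.

End Supported.

(** * Følner towers of a wreath product *)

Section WreathTower.
Variables (F : finGroupType) (T : Type) (o : gops T).
Hypothesis ol : group_laws o.
Local Notation C := {classic T}.
Local Notation TW := {classic ((T -> F) * T)}.
Variables U S : nat -> {fset C}.
Hypothesis tw : tower o U S.

Let pack (v : (C -> F) * C) : TW := v.

Definition wreathU k : {fset TW} := [fset pack v | v in supported F (U k) `*` U k].

(** Left multiplication by (f, s) moves a pattern supported in [U k] to the tile s [U k], and f
    fills in the lamps of [U k.+1] outside it. Requiring f to be trivial on the tile makes the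
    factorisation unique. *)
Definition wreathS k : {fset TW} :=
  [fset pack v | v in [fset w in supported F (U k.+1) `*` S k |
     `[< forall u, u \in U k -> w.1 (gmul o w.2 u) = 1%g >]]].

Let in_wreathU k (f : C -> F) (g : C) : (((f, g) : TW) \in wreathU k) =
  (f \in supported F (U k)) && (g \in U k).
Proof.
apply/imfsetP/andP => /= [[[f' g'] + [-> ->]]|[h1 h2]].
  by rewrite in_fsetM => /andP.
by exists (f, g); rewrite // in_fsetM /= h1.
Qed.

Let in_wreathS k (f : C -> F) (s : C) : ((f, s) : TW) \in wreathS k <->
  [/\ f \in supported F (U k.+1), s \in S k &
     forall u, u \in U k -> f (gmul o s u) = 1%g].
Proof.
split.
  move=> /imfsetP[/= [f' s']]; rewrite !inE /= => /andP[/andP[h1 h2] /asboolP h3].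
  by move=> [-> ->].
move=> [h1 h2 h3]; apply/imfsetP; exists (f, s) => //=.
by rewrite !inE /= h1 h2 /=; apply/asboolP.
Qed.

Lemma card_wreathU k : #|` wreathU k| = (#|F| ^ #|` U k| * #|` U k|)%N.
Proof. by rewrite card_imfset //= card_fsetM card_supported. Qed.

Lemma wreath_tower : tower (wreath F o) wreathU wreathS.
Proof.
split.
- move=> k [f g]; rewrite in_wreathU => /andP[/in_supported fU gU] /=.
  have sub x : f x <> 1%g -> x \in U k.
    by move=> fx; apply: contraT => /fU.
  split; first exact: (tower_mem tw gU).
  split; last by move=> x /sub /(tower_mem tw).
  by apply: (@sub_finite_set _ _ [set` U k]%classic) => // x /= /sub.
- move=> k [f v]; rewrite in_wreathU; split.
    move=> /andP[/in_supported fU /(tower_cover tw)[s [u [sS uU ->]]]].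
    exists (pack (fun x => if (gmul o (ginv o s) x : C) \in U k then 1%g else f x, s)).
    exists (pack (fun x => if (x : C) \in U k then f (gmul o s x) else 1%g, u)).
    split.
    + apply/in_wreathS; split => //.
        by apply/in_supported => x /fU ->; case: ifP.
      by move=> u' u'U; rewrite (opKg ol) u'U.
    + rewrite in_wreathU uU andbT; apply/in_supported => x.
      by case: ifP.
    + congr pair; apply/funext => x /=; case: ifP => _; rewrite ?mulg1 //.
      by rewrite mul1g (opKVg ol).
  move=> [[f2 s] [[f1 u] [/in_wreathS[f2U sS f2s]]]].
  rewrite in_wreathU => /andP[/in_supported f1U uU] [-> ->].
  have suU w : w \in U k -> (gmul o s w : C) \in U k.+1.
    by move=> wU; apply/(tower_cover tw); exists s, w.
  rewrite suU // andbT; apply/in_supported => x xU /=.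
  move/in_supported: f2U => f2U; rewrite f2U // mul1g f1U //; apply: contra xU => /suU.
  by rewrite (opKVg ol).
- move=> k [f2 s] [f2' s'] [f1 u] [f1' u'] /in_wreathS[_ sS f2s] /in_wreathS[_ s'S f2s'].
  rewrite !in_wreathU => /andP[/in_supported f1U uU] /andP[/in_supported f1U' u'U] [ff].
  move=> /(tower_uniq tw sS s'S uU u'U)[ss uu]; subst s' u'.
  have f11 : f1 = f1'.
    apply/funext => x; have [xU|xU] := boolP ((x : C) \in U k).
      have := congr1 (fun h => h (gmul o s x)) ff.
      by rewrite /= f2s // f2s' // !mul1g (opKg ol).
    by rewrite f1U // f1U'.
  subst f1'; split => //; congr pair; apply/funext => x.
  by have := congr1 (fun h => h x) ff; exact: mulIg.
- move=> [f0 s0] /= [ms [ffin fmem]].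
  pose X : {fset C} := fset_set ([set x | f0 x <> 1%g] : set C)%classic.
  have XP x : x \in X <-> f0 x <> 1%g by rewrite /X in_fset_set // inE.
  have ch x : exists c : nat, x \in X -> forall k,
      (2 ^ k * #|` bdry o (U k) x| <= c * #|` U k|)%N.
    have [/XP xX|nX] := boolP (x \in X); last by exists 0%N.
    by have [c hc] := tower_bdry tw (fmem _ xX); exists c.
  have [cx cxP] := choice ch.
  have [cs csP] := tower_bdry tw ms.
  exists (cs + \sum_(x <- X) cx x)%N => k.
  (* Right multiplication by (f0, s0) moves the walker from g to g s0 and changes the lamps at g x
     for x in the support of f0. Leaving [wreathU k] thus depends on g alone, and the boundary ratio
     is that of [Bad] in [U k]. *)
  pose Bad := bdry o (U k) s0 `|` \bigcup_(x <- X) bdry o (U k) x.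
  have cBad : (2 ^ k * #|` Bad| <= (cs + \sum_(x <- X) cx x) * #|` U k|)%N.
    apply: (@leq_trans (2 ^ k * (#|` bdry o (U k) s0| + \sum_(x <- X) #|` bdry o (U k) x|))).
      rewrite leq_mul2l; apply/orP; right; apply: leq_trans (leq_card_fsetU _ _) _.
      rewrite leq_add2l; elim/big_rec2: _ => [|x n A _ h]; first by rewrite cardfs0.
      by apply: leq_trans (leq_card_fsetU _ _) _; rewrite leq_add2l.
    rewrite mulnDr mulnDl leq_add ?csP // big_distrr big_distrl /=.
    by rewrite big_seq [leqRHS]big_seq; apply: leq_sum => x xX; exact: cxP.
  have sub : bdry (wreath F o) (wreathU k) (f0, s0) `<=`
      [fset pack v | v in supported F (U k) `*` Bad].
    apply/fsubsetP => -[f g]; rewrite !inE /= => /andP[].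
    rewrite in_wreathU => /andP[fU gU] nin.
    apply/imfsetP; exists (f, g) => //=; rewrite in_fsetM fU /=.
    apply: contraR nin => gB.
    rewrite [X in is_true X](in_wreathU k (fun x => (f x * f0 (gmul o (ginv o g) x))%g) (gmul o g s0)).
    apply/andP; split.
      move/in_supported: fU => fU; apply/in_supported => x xU; rewrite fU // mul1g.
      apply: contrapT => /XP h; move/negP: gB; apply; rewrite inE; apply/orP; right.
      apply/bigfcupP; exists (gmul o (ginv o g) x); first by rewrite h.
      by rewrite !inE gU /= (opKVg ol).
    apply: contraR gB => h; rewrite inE; apply/orP; left.
    by rewrite !inE gU.
  apply: (@leq_trans (2 ^ k * (#|F| ^ #|` U k| * #|` Bad|))).
    rewrite leq_mul2l; apply/orP; right; apply: leq_trans (fsubset_leq_card sub) _.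
    by rewrite card_imfset //= card_fsetM card_supported.
  by rewrite card_wreathU mulnCA [leqRHS]mulnCA leq_mul2l cBad orbT.
- move=> k; rewrite card_wreathU; apply: leq_trans (tower_size tw k) _.
  by rewrite leq_pmull // expn_gt0 (cardD1 1%g).
Qed.

End WreathTower.

Section IntTower.
Variable F : finGroupType.
Local Notation Z := {classic int}.

Definition intU k : {fset Z} := [fset (Posz (nat_of_ord i) : Z) | i in 'I_(2 ^ k)].
Definition intS k : {fset Z} := [fset (0%R : Z); (Posz (2 ^ k) : Z)].

Let in_intU k (v : int) : ((v : Z) \in intU k) = ((0 <= v) && (v < (2 ^ k)%N%:Z))%R.
Proof.
apply/imfsetP/idP => /= [[i _ ->]|/andP[v0 vk]]; first by rewrite ltz_nat ltn_ord.
have vk' : (`|v| < 2 ^ k)%N by rewrite -ltz_nat gez0_abs.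
by exists (Ordinal vk') => //=; rewrite gez0_abs.
Qed.

Lemma card_intU k : #|` intU k| = (2 ^ k)%N.
Proof.
rewrite card_imfset /=; last by move=> i j [] /ord_inj.
by rewrite size_enum_ord.
Qed.

Lemma int_tower : tower (Hops F 0) intU intS.
Proof.
split => //.
- move=> k v; rewrite in_intU; split => [vU|].
    have [vk|kv] := ltP (v : int) (Posz (2 ^ k)%N).
      exists 0%R, v; rewrite in_intU !inE eqxx /=; split => //=.
        by case/andP: vU => -> _.
      by rewrite add0r.
    exists (Posz (2 ^ k)), ((v : int) - (2 ^ k)%N%:Z)%R; rewrite in_intU !inE eqxx orbT /=.
    split => //; last by rewrite addrC subrK.
    move: vU; rewrite expnS; lia.
  move=> [s [u [sS]]]; rewrite in_intU => uU ->.
  by move: sS; rewrite !inE expnS => /orP[] /eqP ->; move: uU; rewrite /=; lia.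
- move=> k s s' u u'; rewrite !in_intU !inE.
  have pk : (0 < 2 ^ k)%N by rewrite expn_gt0.
  move=> /orP[]/eqP -> /orP[]/eqP -> uU u'U /= uu; split => //; move: uU u'U uu; lia.
- move=> g _; exists `|g|%N => k; rewrite card_intU mulnC leq_mul2r; apply/orP; right.
  pose f (i : 'I_`|g|) : Z := if (0 <= g)%R then ((2 ^ k)%N%:Z - 1 - i%:Z)%R else (Posz i).
  have sub : bdry (Hops F 0) (intU k) g `<=` [fset f i | i in 'I_`|g|].
    apply/fsubsetP => v; rewrite !inE /= in_intU => /andP[vU].
    rewrite in_intU => vg; apply/imfsetP => /=.
    have [g0|g0] := boolP (0 <= g)%R.
      have hi : (absz ((2 ^ k)%N%:Z - 1 - (v : int))%R < absz g)%N by move: vU vg g0; lia.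
      exists (Ordinal hi) => //=; rewrite /f g0 /=; move: vU; lia.
    have hi : (`|(v : int)|%N < `|g|)%N by move: vU vg g0; lia.
    exists (Ordinal hi) => //=; rewrite /f (negbTE g0) /=; move: vU; lia.
  apply: leq_trans (fsubset_leq_card sub) _; apply: leq_trans (leq_imfset_card _ _ _) _.
  by rewrite /= size_enum_ord.
- by move=> k; rewrite card_intU.
Qed.

End IntTower.

(** An arbitrary factor [K] is carried along so that the bound survives the next wreath product,
    where it is used with a larger factor. *)
Definition tower_growth (R : realType) (n : nat) (N : nat -> nat) := forall K : R,
  (0 <= K)%R -> exists2 c : R, (0 <= c)%R & forall k,
    (K * (N k)%:R <= iter n expR (c * (2 ^ k)%N%:R))%R.

Lemma wreath_growth (R : realType) (n q : nat) (N : nat -> nat) :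
  (forall k, (0 < N k)%N) -> tower_growth R n N ->
  tower_growth R n.+1 (fun k => q ^ N k * N k)%N.
Proof.
move=> N0 gr K K0.
have [|c c0 hc] := gr (K + 1 + q%:R)%R; first by rewrite !addr_ge0.
exists c => // k; rewrite iterS.
(* Each of K, N and q ^ N is at most the exponential of K N, N and q N respectively. *)
apply: (@le_trans _ _ (expR ((K + 1 + q%:R) * (N k)%:R))%R); last by rewrite ler_expR.
rewrite 2!mulrDl !expRD mul1r natrM mulrA mulrAC.
have le_exp (x : R) : (x <= expR x)%R.
  by apply: le_trans (expR_ge1Dx _); rewrite lerDr.
have N1 : (1 <= (N k)%:R :> R)%R by rewrite ler1n.
apply: ler_pM; rewrite ?mulr_ge0 ?ler0n //.
  apply: ler_pM => //; rewrite ?ler0n //.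
  by apply: le_trans (le_exp K) _; rewrite ler_expR ler_peMr.
by rewrite natrX mulrC expRM_natl lerXn2r ?nnegrE ?expR_ge0 // le_exp.
Qed.

Lemma Htower (R : realType) (F : finGroupType) (n : nat) :
  exists U S : nat -> {fset {classic (Hc F n)}}, tower (Hops F n) U S /\
    tower_growth R n (fun k => #|` U k|).
Proof.
elim: n => [|n [U [S [tw gr]]]].
  exists intU, intS; split; first exact: int_tower.
  by move=> K K0; exists K => // k; rewrite card_intU.
exists (wreathU F U), (wreathS F (Hops F n) U S); split.
  exact: wreath_tower (Hops_laws F n) _ _ tw.
have -> : (fun k => #|` wreathU F U k|) = (fun k => #|F| ^ #|` U k| * #|` U k|)%N.
  by apply/funext => k; exact: card_wreathU.
apply: wreath_growth gr => k; apply: leq_trans (tower_size tw k).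
by rewrite expn_gt0.
Qed.

(** * Mixed radix enumerations of a tower *)

Section Enumeration.
Variables (T : Type) (o : gops T) (U S : nat -> {fset {classic T}}).
Hypothesis ol : group_laws o.
Hypothesis tw : tower o U S.
Local Notation C := {classic T}.
Local Notation N k := (#|` U k|).
Local Notation q k := (#|` S k|).

Lemma card_towerS k : N k.+1 = (N k * q k)%N.
Proof.
pose f (w : C * C) : C := gmul o w.1 w.2.
have f_inj : {in S k `*` U k &, injective f}.
  move=> [s u] [s' u']; rewrite !in_fsetM /= => /andP[sS uU] /andP[s'S u'U].
  by move=> /(tower_uniq tw sS s'S uU u'U)[-> ->].
rewrite (_ : U k.+1 = f @` (S k `*` U k)); last first.
  apply/fsetP => v; apply/idP/imfsetP => /=.
    move=> /(tower_cover tw)[s [u [sS uU ->]]]; exists (s, u) => //.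
    by rewrite in_fsetM /= sS.
  move=> [[s u]]; rewrite in_fsetM /= => /andP[sS uU] ->.
  by apply/(tower_cover tw); exists s, u.
by have /card_in_imfsetP/eqP -> := f_inj; rewrite card_fsetM mulnC.
Qed.

Lemma card_tower_gt0 k : (0 < N k)%N.
Proof. by apply: leq_trans (tower_size tw k); rewrite expn_gt0. Qed.

Lemma card_factor_gt0 k : (0 < q k)%N.
Proof. by have := card_tower_gt0 k.+1; rewrite card_towerS muln_gt0 => /andP[]. Qed.

(** Index i at level k splits into the [q k] indices i * [q k] + r at level k + 1, just as the
    interval [i / N_k, (i + 1) / N_k) splits into equal parts; the new digit r chooses the tile. *)
Fixpoint enumU k i : C :=
  if k is k'.+1 then gmul o (nth (gone o : C) (S k') (i %% q k')) (enumU k' (i %/ q k'))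
  else nth (gone o : C) (U 0) i.

Lemma enumU_in k i : (i < N k)%N -> enumU k i \in U k.
Proof.
elim: k i => [|k IH] i ik /=; first exact: mem_nth.
apply/(tower_cover tw); exists (nth (gone o : C) (S k) (i %% q k)), (enumU k (i %/ q k)).
split => //; first by apply: mem_nth; rewrite ltn_mod card_factor_gt0.
by apply: IH; rewrite ltn_divLR ?card_factor_gt0 // -card_towerS.
Qed.

Lemma enumU_inj k i j : (i < N k)%N -> (j < N k)%N -> enumU k i = enumU k j -> i = j.
Proof.
elim: k i j => [|k IH] i j ik jk /=.
  by move=> /eqP; rewrite nth_uniq ?fset_uniq // => /eqP.
have q0 := card_factor_gt0 k.
have lti x : (x < N k.+1)%N -> (x %/ q k < N k)%N.
  by rewrite card_towerS => xk; rewrite ltn_divLR.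
have sin x : nth (gone o : C) (S k) (x %% q k) \in S k.
  by apply: mem_nth; rewrite ltn_mod.
move=> /(tower_uniq tw (sin i) (sin j) (enumU_in (lti _ ik)) (enumU_in (lti _ jk)))[].
move=> /eqP; rewrite nth_uniq ?ltn_mod ?fset_uniq // => /eqP mm.
move=> /(IH _ _ (lti _ ik) (lti _ jk)) dd.
by rewrite (divn_eq i (q k)) (divn_eq j (q k)) mm dd.
Qed.

Lemma enumU_surj k v : v \in U k -> exists2 i, (i < N k)%N & enumU k i = v.
Proof.
move=> vU; pose E := [fset enumU k (nat_of_ord i) | i in 'I_(N k)].
have cE : #|` E| = N k.
  rewrite card_imfset /=; first by rewrite size_enum_ord.
  by move=> i j /enumU_inj => /(_ (ltn_ord i) (ltn_ord j)) /ord_inj.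
have EU : E `<=` U k by apply/fsubsetP => w /imfsetP[/= i _ ->]; exact: enumU_in.
have : v \in E by have /eqP -> : E == U k by rewrite eqEfcard EU cE /=.
by move=> /imfsetP[/= i _ ->]; exists i.
Qed.

(** Turns the Følner condition into a count of the indices at which right multiplication by [g] has
    no partner yet. *)
Lemma enumU_bdry k g :
  (\sum_(i < N k) `[< ~ exists2 j, (j < N k)%N & enumU k j = gmul o (enumU k i) g >]
   = #|` bdry o (U k) g|)%N.
Proof.
rewrite -big_mkcond /=.
pose P (i : 'I_(N k)) := `[< ~ exists2 j, (j < N k)%N & enumU k j = gmul o (enumU k i) g >].
have -> : bdry o (U k) g = [fset enumU k (nat_of_ord i) | i in 'I_(N k) & P i].
  apply/fsetP => v; rewrite !inE; apply/andP/imfsetP => /=.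
    move=> [/enumU_surj[i ik <-] nU]; exists (Ordinal ik) => //.
    rewrite inE /= => -[j jk h]; move/negP: nU; apply.
    by rewrite -h; exact: enumU_in.
  move=> [i]; rewrite inE /= => nj ->; split; first exact: enumU_in.
  by apply/negP => /enumU_surj[j jk h]; apply: nj; exists j.
rewrite card_imfset /=; last first.
  by move=> i j /enumU_inj => /(_ (ltn_ord i) (ltn_ord j)) /ord_inj.
by rewrite size_filter -sum1_count big_enum_cond.
Qed.

(* The last digit [i %% q k] of an index is the finest one on the circle but the
   most significant one for the position in Z: [zpos] is the digit reversal
   behind the odometer. *)
Fixpoint zpos k i : nat :=
  if k is k'.+1 then (zpos k' (i %/ q k') + N k' * (i %% q k'))%N else i.

Lemma zpos_lt k i : (i < N k)%N -> (zpos k i < N k)%N.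
Proof.
elim: k i => [|k IH] i ik //=.
have q0 := card_factor_gt0 k.
have /IH h : (i %/ q k < N k)%N by rewrite ltn_divLR // -card_towerS.
rewrite card_towerS; apply: (@leq_trans (N k * (i %% q k).+1)).
  by rewrite mulnS ltn_add2r.
by rewrite leq_mul2l ltn_mod q0 orbT.
Qed.

Lemma zpos_inj k i j : (i < N k)%N -> (j < N k)%N -> zpos k i = zpos k j -> i = j.
Proof.
elim: k i j => [|k IH] i j ik jk //= zz.
have q0 := card_factor_gt0 k; have N0 := card_tower_gt0 k.
have lti x : (x < N k.+1)%N -> (x %/ q k < N k)%N.
  by rewrite card_towerS => xk; rewrite ltn_divLR.
have hi := zpos_lt (lti _ ik); have hj := zpos_lt (lti _ jk).
have mm : (i %% q k = j %% q k)%N.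
  have := congr1 (fun x => x %/ N k)%N zz.
  have zdiv x y : (y < N k -> (y + N k * x) %/ N k = x)%N.
    by move=> yN; rewrite addnC mulnC divnMDl // divn_small // addn0.
  by rewrite !zdiv.
rewrite (divn_eq i (q k)) (divn_eq j (q k)) mm; congr (_ * _ + _)%N.
by apply: IH; [exact: lti..|]; move: zz; rewrite mm => /addIn.
Qed.

Lemma zpos_surj k l : (l < N k)%N -> exists2 i, (i < N k)%N & zpos k i = l.
Proof.
move=> lk.
have inj : injective (fun i : 'I_(N k) => Ordinal (zpos_lt (ltn_ord i))).
  by move=> i j [] /zpos_inj => /(_ (ltn_ord i) (ltn_ord j)) /ord_inj.
have [g _ gK] := injF_bij inj.
by exists (g (Ordinal lk)) => //; have := congr1 val (gK (Ordinal lk)).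
Qed.

Lemma zpos_bad k (a : int) :
  (\sum_(i < N k) `[< ~ exists2 j, (j < N k)%N & (Posz (zpos k j) = Posz (zpos k i) + a)%R >]
   <= `|a|)%N.
Proof.
rewrite -big_mkcond /= sum1_card.
(* As [zpos k] is a bijection of the integers below [N k], a shift by [a] fails only by crossing an
   end of that range. The distance to that end is injective and less than the absolute value of
   [a]. *)
pose f (i : 'I_(N k)) : nat := if (0 <= a)%R then (N k - 1 - zpos k i)%N else zpos k i.
set P := (X in #|X|); rewrite -[leqRHS](size_iota 0) -(size_image f P).
apply: uniq_leq_size.
  rewrite map_inj_in_uniq ?enum_uniq // => i j _ _; rewrite /f.
  have hi := zpos_lt (ltn_ord i); have hj := zpos_lt (ltn_ord j).
  case: ifP => _ h; apply/ord_inj/(zpos_inj (ltn_ord i) (ltn_ord j)) => //.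
  by move: h hi hj; lia.
move=> l /mapP[i iP ->]; rewrite mem_enum in iP.
have nj : ~ exists2 j, (j < N k)%N & (Posz (zpos k j) = Posz (zpos k i) + a)%R.
  exact: asboolW iP.
rewrite mem_iota /= add0n /f; have hi := zpos_lt (ltn_ord i).
rewrite ltnNge; apply/negP => hf; apply: nj.
have [l' hl' hl2] : exists2 l', (l' < N k)%N & (Posz l' = Posz (zpos k i) + a)%R.
  exists `|(Posz (zpos k i) + a)%R|%N; move: hf hi; case: (boolP (0 <= a)%R); lia.
by have [j jk zj] := zpos_surj hl'; exists j => //; rewrite zj.
Qed.

End Enumeration.

(** * Growth of iterated exponentials *)

Local Open Scope ring_scope.

Section Growth.
Variable R : realType.

Lemma le_iter_expR n (t : R) : t <= iter n expR t.
Proof.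
elim: n => //= n IH; apply: le_trans IH _.
by apply: le_trans (expR_ge1Dx _); rewrite lerDr.
Qed.

Lemma iter_expR_le n (s t : R) : s <= t -> iter n expR s <= iter n expR t.
Proof. by move=> st; elim: n => //= n IH; rewrite ler_expR. Qed.

Lemma iter_expRK n : cancel (iter n (@expR R)) (iter n (@ln R)).
Proof. by elim: n => // n IH t; rewrite iterSr [iter n.+1 expR t]iterS expRK IH. Qed.

(** From 1 / 2 <= exp (- 1 / 2): base 2 replaces base e at the cost of halving the exponent. *)
Lemma expR_half_le (k : nat) : expR (k%:R / 2) <= ((2 ^ k)%N%:R : R).
Proof.
have h : expR (2^-1) <= 2 :> R.
  rewrite -[2^-1]opprK expRN -[leRHS]invrK lef_pV2 ?posrE ?expR_gt0 ?invr_gt0 //.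
  by apply: le_trans (expR_ge1Dx _); lra.
rewrite natrX -mulr_natl mulr1 expRM_natl.
by rewrite lerXn2r ?nnegrE ?expR_ge0.
Qed.

(** Applying the previous level with the factor 64 puts an exponent of at least 4 E, after the
    quotient by 4, its rounding and the passage to base e. One factor exp E is the claimed iterate;
    the other three exceed (c M) ^ 3, which dominates K M ^ 2. The square is reserved for the choice
    L = N / M ^ 2 and is affordable only after at least one exponential. *)
Lemma tow_step n (K : R) : 0 < K ->
  (forall K : R, 0 < K -> exists2 c : R, 0 < c & exists M0 : nat, forall M : nat,
    (M0 <= M)%N -> K * iter n expR (c * M%:R) <= (tow n M)%:R) ->
  exists2 c : R, 0 < c & exists M0 : nat, forall M : nat,
    (M0 <= M)%N -> K * M%:R ^+ 2 * iter n.+1 expR (c * M%:R) <= (tow n.+1 M)%:R.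
Proof.
move=> K0 /(_ 64 (ltr0n _ 64)) [c c0 [M0 hM0]]; exists c => //.
exists (maxn M0 (maxn (Num.truncn (c^-1)).+1 (Num.truncn (K / c ^+ 3)).+1)) => M.
rewrite !geq_max => /and3P[/hM0 h1 h2 h3].
set E := iter n expR (c * M%:R) in h1.
have cM1 : 1 <= c * M%:R.
  rewrite -ler_pdivrMl // mulr1; apply: le_trans (ltW (truncnS_gt _)) _.
  by rewrite ler_nat.
have KM : K <= c ^+ 3 * M%:R.
  rewrite -ler_pdivrMl ?exprn_gt0 // mulrC; apply: le_trans (ltW (truncnS_gt _)) _.
  by rewrite ler_nat.
have cME : c * M%:R <= E by exact: le_iter_expR.
rewrite iterS -/E /=; apply: le_trans (expR_half_le _).
have t4 : 4 * E <= ((tow n M) %/ 4)%N%:R / 2.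
  have : (tow n M)%:R <= 4 * ((tow n M) %/ 4)%N%:R + 4 :> R.
    by rewrite -natrM -natrD ler_nat {1}(divn_eq (tow n M) 4) mulnC leq_add2l ltnW ?ltn_mod.
  lra.
apply: (@le_trans _ _ (expR (4 * E))); last by rewrite ler_expR.
rewrite -[4]/(4%:R) expRM_natl [_ ^+ 4]exprSr ler_wpM2r ?expR_ge0 //.
apply: (@le_trans _ _ ((c * M%:R) ^+ 3)).
  by rewrite exprMn [M%:R ^+ 3]exprS mulrA ler_wpM2r ?exprn_ge0.
rewrite lerXn2r ?nnegrE ?expR_ge0 //; first by apply: le_trans cM1.
by apply: le_trans cME _; apply: le_trans (expR_ge1Dx _); lra.
Qed.

Lemma tow_ge n (K : R) : 0 < K ->
  exists2 c : R, 0 < c & exists M0 : nat, forall M : nat,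
    (M0 <= M)%N -> K * iter n expR (c * M%:R) <= (tow n M)%:R.
Proof.
elim: n K => [|n IH] K K0.
  exists K^-1; first by rewrite invr_gt0.
  by exists 0%N => M _ /=; rewrite mulVKf // gt_eqF.
have [c c0 [M0 h]] := tow_step K0 IH; exists c => //; exists (maxn M0 1) => M.
rewrite geq_max => /andP[/h hM M1]; apply: le_trans hM.
rewrite ler_wpM2r ?expR_ge0 // ler_peMr ?(ltW K0) // -natrX.
by rewrite ler1n expn_gt0 M1.
Qed.

Lemma towS_ge n (K : R) : 0 < K ->
  exists2 c : R, 0 < c & exists M0 : nat, forall M : nat,
    (M0 <= M)%N -> K * M%:R ^+ 2 * iter n.+1 expR (c * M%:R) <= (tow n.+1 M)%:R.
Proof. by move=> K0; apply: tow_step => // K' K'0; exact: tow_ge. Qed.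

End Growth.

(** * Counting orbit points in a coupling *)

Local Open Scope classical_set_scope.
Local Open Scope ring_scope.

Section Counting.
Variables (R : realType) (d : measure_display) (Om : measurableType d).
Variables (mu : {measure set Om -> \bar R}) (T : Type) (o : gops T).
Variable act : T -> Om -> Om.
Hypothesis ol : group_laws o.
Hypothesis actA : Defs.is_action (gmul o) (gone o) (gmem o) act.
Hypothesis mp : measure_preserving_action mu (gmem o) act.
Variables (J : set nat) (e : nat -> T).
Hypothesis eJ : forall i, J i -> gmem o (e i).
Hypothesis e_inj : forall i j, J i -> J j -> e i = e j -> i = j.
Hypothesis e_surj : forall h, gmem o h -> exists2 i, J i & e i = h.
Local Notation C := {classic T}.

Definition hits (A : set Om) (i : nat) : set Om :=
  [set y | J i /\ A (act (e i) y)].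

(** The number of group elements that carry y into A, as a series so that it can be measured and
    integrated term by term. By [visits_ge] and [visits_le] it is the supremum of the cardinalities
    of finite sets of such elements. *)
Definition visits (A : set Om) (y : Om) : \bar R :=
  (\sum_(0 <= i <oo) (\1_(hits A i) y)%:E)%E.

Let hitb A y i : bool := `[< hits A i y >].

Let indic_hits A y i : (\1_(hits A i) y)%:E = (hitb A y i)%:R%:E :> \bar R.
Proof.
by rewrite /hitb indicE; congr (_%:R%:E); apply/idP/asboolP; rewrite inE.
Qed.

Let sum_hits A y n :
  (\sum_(0 <= i < n) (\1_(hits A i) y)%:E = (count (hitb A y) (iota 0 n))%:R%:E :> \bar R)%E.
Proof.
under eq_bigr do rewrite indic_hits.
by rewrite sumEFin -natr_sum /index_iota subn0 -sumn_count sumnE big_map.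
Qed.

Lemma visits_ge0 A y : (0 <= visits A y)%E.
Proof. by apply: nneseries_ge0 => i _ _; rewrite lee_fin indicE. Qed.

Lemma visits_ge A y (W : {fset C}) :
  (forall h : C, h \in W -> gmem o h /\ A (act h y)) ->
  ((#|` W|)%:R%:E <= visits A y)%E.
Proof.
move=> hW.
have idx (h : C) : exists i, h \in W -> J i /\ e i = h.
  have [hin|//] := boolP (h \in W); last by exists 0%N.
  by have [i Ji ei] := e_surj (hW h hin).1; exists i.
have {idx}[idx idxP] := choice idx.
pose n := (\max_(h <- W) idx h).+1.
apply: (@le_trans _ _ (\sum_(0 <= i < n) (\1_(hits A i) y)%:E)%E); last first.
  by apply: nneseries_lim_ge => i _ _; rewrite lee_fin indicE.
rewrite sum_hits lee_fin ler_nat -size_filter -(size_map idx).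
apply: uniq_leq_size.
  rewrite map_inj_in_uniq ?fset_uniq // => h h' hin h'in ii.
  by have [_ <-] := idxP _ hin; have [_ <-] := idxP _ h'in; rewrite ii.
move=> i /mapP[h hin ->]; rewrite mem_filter mem_iota /= add0n ltnS.
have [Jh eh] := idxP _ hin.
apply/andP; split; last exact: (@leq_bigmax_seq _ _ xpredT idx h hin).
by apply/asboolP; split => //; rewrite eh; exact: (hW _ hin).2.
Qed.

Lemma visits_le A y (r : \bar R) :
  (forall W : {fset C}, (forall h : C, h \in W -> gmem o h /\ A (act h y)) ->
    ((#|` W|)%:R%:E <= r)%E) -> (visits A y <= r)%E.
Proof.
move=> hr; apply: lime_le.
  by apply: is_cvg_nneseries => i _ _; rewrite lee_fin indicE.
apply: nearW => n; rewrite sum_hits.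
pose W : {fset C} := [fset (e i : C) | i in [seq i <- iota 0 n | hitb A y i]]%fset.
have hitJ i : hitb A y i -> J i by move=> /asboolP[].
suff <- : #|` W| = count (hitb A y) (iota 0 n).
  apply: hr => h /imfsetP[/= i]; rewrite mem_filter => /andP[/asboolP[Ji Ai] _] ->.
  by split => //; exact: eJ.
rewrite /W -size_filter card_in_imfset /=; last first.
  move=> i j; rewrite /= !mem_filter => /andP[/hitJ Ji _] /andP[/hitJ Jj _].
  exact: e_inj.
by rewrite undup_id // filter_uniq ?iota_uniq.
Qed.

(** Phrased with finite sets so that invariance under the action is a translation of [W]; [atleastE]
    supplies measurability. *)
Definition atleast (k : nat) (A : set Om) : set Om :=
  [set y | exists2 W : {fset C}, (k <= #|` W|)%N &
    forall h : C, h \in W -> gmem o h /\ A (act h y)].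

Lemma atleastE k A : atleast k A = [set y | (k%:R%:E <= visits A y)%E].
Proof.
apply/seteqP; split => y /=.
  move=> [W kW hW]; apply: le_trans (visits_ge hW); by rewrite lee_fin ler_nat.
move=> hk; apply: contrapT => nW; case: k hk nW => [|k] hk nW.
  by apply: nW; exists fset0%fset.
have : (visits A y <= k%:R%:E)%E.
  apply: visits_le => W hW; rewrite lee_fin ler_nat leqNgt; apply/negP => kW.
  by apply: nW; exists W.
by move=> /(le_trans hk); rewrite lee_fin ler_nat ltnn.
Qed.

Lemma measurable_hits A i : measurable A -> measurable (hits A i).
Proof.
move=> mA; have [Ji|nJ] := pselect (J i); last first.
  by rewrite (_ : hits A i = set0)//; apply/seteqP; split => // y [].
rewrite (_ : hits A i = act (e i) @^-1` A); last first.
  by apply/seteqP; split => // y [].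
by rewrite -[X in measurable X]setTI; apply: (mp (eJ Ji)).1.
Qed.

Lemma measurable_visits A : measurable A -> measurable_fun setT (visits A : _ -> \bar R).
Proof.
move=> mA; apply: ge0_emeasurable_sum.
  by move=> i y _ _; rewrite lee_fin indicE.
move=> i _; apply/measurable_EFinP; apply: measurable_indic.
exact: measurable_hits.
Qed.

Lemma measurable_atleast k A : measurable A -> measurable (atleast k A).
Proof.
move=> mA; rewrite atleastE -[X in measurable X]setTI.
by apply: emeasurable_fun_c_infty => //; exact: measurable_visits.
Qed.

Lemma act_inv h x : gmem o h -> act (ginv o h) (act h x) = x.
Proof.
by move=> mh; rewrite -actA.2 ?(opVg ol) ?actA.1 //; exact: mem_inv ol _ mh.
Qed.

Lemma act_invV h x : gmem o h -> act h (act (ginv o h) x) = x.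
Proof.
by move=> mh; rewrite -actA.2 ?(opgV ol) ?actA.1 //; exact: mem_inv ol _ mh.
Qed.

(** Replacing [W] by its right translate under the inverse of h passes from y to h y. *)
Lemma atleast_act k A h y : gmem o h -> atleast k A (act h y) <-> atleast k A y.
Proof.
move=> mh; have half g z : gmem o g -> atleast k A z -> atleast k A (act g z).
  move=> mg [W kW hW].
  pose tr (w : C) : C := gmul o w (ginv o g).
  exists [fset tr w | w in W]%fset.
    rewrite card_imfset //=; exact: (opIg ol).
  move=> _ /imfsetP[/= w /hW [mw Aw] ->].
  have mg' := mem_inv ol mg.
  split; first exact: (mem_mul ol).
  by rewrite actA.2 // act_inv.
split; last exact: half.
by move=> /(half _ _ (mem_inv ol mh)); rewrite act_inv.
Qed.

(* Unfolding over a fundamental domain: each orbit point is counted once. *)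
Lemma integral_visits (X A : set Om) : fundamental_domain (gmem o) act X ->
  measurable A -> (\int[mu]_(y in X) visits A y = mu A)%E.
Proof.
move=> [mX fX] mA; rewrite integral_nneseries //; last first.
  by move=> i; apply/measurable_EFinP/measurable_indic/measurable_hits.
pose P i := [set w | J i /\ A w /\ X (act (ginv o (e i)) w)].
have PE i : J i -> P i = act (ginv o (e i)) @^-1` (hits A i `&` X).
  move=> Ji; apply/seteqP; split => w /=.
    by move=> [_ [Aw Xw]]; split => //; split => //; rewrite act_invV //; exact: eJ.
  by rewrite /hits /= act_invV; [move=> [[_ Aw] Xw]|exact: eJ].
have mP i : measurable (P i).
  have [Ji|nJ] := pselect (J i); last first.
    by rewrite (_ : P i = set0)//; apply/seteqP; split => // y [].
  rewrite PE // -[X in measurable X]setTI.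
  apply: (mp (mem_inv ol (eJ Ji))).1 => //.
  by apply: measurableI => //; exact: measurable_hits.
have AE : A = \bigcup_i P i.
  apply/seteqP; split => w; last by move=> [i _ [_ [Aw _]]].
  move=> Aw; have [h [[mh Xh] _]] := fX w.
  have [i Ji ei] := e_surj (mem_inv ol mh); exists i => //.
  by split => //; split => //; rewrite ei (inv_invg ol).
rewrite [in RHS]AE measure_bigcup //; last first.
  move=> i j _ _ [w [[Ji [_ Xi]] [Jj [_ Xj]]]].
  apply: e_inj => //; rewrite -(inv_invg ol (e i)) -(inv_invg ol (e j)); congr ginv.
  have [h [_ uh]] := fX w.
  have mi := mem_inv ol (eJ Ji); have mj := mem_inv ol (eJ Jj).
  by rewrite -(uh _ (conj mi Xi)) -(uh _ (conj mj Xj)).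
rewrite [RHS]eseries_mkcond; apply: eq_eseriesr => i _.
rewrite in_setT (integral_indic mu mX (measurable_hits i mA)).
have [Ji|nJ] := pselect (J i); last first.
  rewrite (_ : P i = set0); last by apply/seteqP; split => // y [].
  by rewrite (_ : hits A i = set0) ?set0I//; apply/seteqP; split => // y [].
rewrite PE // (mp (mem_inv ol (eJ Ji))).2 //.
by apply: measurableI => //; exact: measurable_hits.
Qed.

End Counting.

Lemma le_measureT (R : realType) (d : measure_display) (Om : measurableType d)
    (mu : {measure set Om -> \bar R}) (A B : set Om) :
  measurable A -> measurable B -> A `<=` B -> (mu A <= mu B)%E.
Proof. by move=> mA mB AB; apply: le_measure => //; rewrite inE. Qed.

(** * The isoperimetric inequality integrated over a coupling *)

Section CouplingInequality.
Variables (R : realType) (d : measure_display) (Om : measurableType d).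
Variables (mu : {measure set Om -> \bar R}) (T : Type) (o : gops T).
Variables (act : T -> Om -> Om) (actZ : int -> Om -> Om) (XG XZ : set Om).
Hypothesis ol : group_laws o.
Hypothesis actA : Defs.is_action (gmul o) (gone o) (gmem o) act.
Hypothesis mp : measure_preserving_action mu (gmem o) act.
Hypothesis cG : countable (gmem o).
Hypothesis actZA : Defs.is_action (fun a b : int => a + b) 0 (fun _ => True) actZ.
Hypothesis mpZ : measure_preserving_action mu (fun _ : int => True) actZ.
Hypothesis comm : forall a l x, gmem o a -> act a (actZ l x) = actZ l (act a x).
Hypothesis fG : fundamental_domain (gmem o) act XG.
Hypothesis fZ : fundamental_domain (fun _ : int => True) actZ XZ.
Hypotheses (XGfin : (mu XG < +oo)%E) (XZfin : (mu XZ < +oo)%E).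
Hypothesis XZ0 : (0 < mu XZ)%E.
Local Notation C := {classic T}.

Let mXG : measurable XG. Proof. exact: fG.1. Qed.
Let mXZ : measurable XZ. Proof. exact: fZ.1. Qed.

Let actZD a b x : actZ a (actZ b x) = actZ (a + b) x.
Proof. by rewrite actZA.2. Qed.

Let mactZ a A : measurable A -> measurable (actZ a @^-1` A).
Proof. by move=> mA; rewrite -[X in measurable X]setTI; apply: (mpZ (a := a) I).1. Qed.

Let mact h A : gmem o h -> measurable A -> measurable (act h @^-1` A).
Proof. by move=> mh mA; rewrite -[X in measurable X]setTI; apply: (mp mh).1. Qed.

Definition slab (a : int) : set Om := actZ a @^-1` XZ.

Let mslab a : measurable (slab a). Proof. exact: mactZ. Qed.

Let mu_slab a : mu (slab a) = mu XZ. Proof. by rewrite (mpZ (a := a) I).2. Qed.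

Let slab_uniq a b w : slab a w -> slab b w -> a = b.
Proof.
by move=> ha hb; have [l [_ ul]] := fZ.2 w; rewrite -(ul a) // -(ul b).
Qed.

(** The heights are given by a sequence because boxes of nonnegative and of nonpositive heights are
    both used. *)
Definition box (f : nat -> int) (N : nat) : set Om :=
  [set w | exists2 a : nat, (a < N)%N & slab (f a) w].

Let boxS f N : box f N.+1 = box f N `|` slab (f N).
Proof.
apply/seteqP; split => w /=.
  move=> [a]; rewrite ltnS leq_eqVlt => /orP[/eqP ->|aN] h; [by right|left].
  by exists a.
move=> [[a aN h]|h]; first by exists a => //; exact: ltnW.
by exists N.
Qed.

Let box0 f : box f 0 = set0.
Proof. by apply/seteqP; split => w // []. Qed.

Let mbox f N : measurable (box f N).
Proof.
elim: N => [|N IH]; first by rewrite box0.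
by rewrite boxS; exact: measurableU.
Qed.

Let mu_box f N A : injective f -> measurable A ->
  (mu (box f N `&` A) = \sum_(a < N) mu (slab (f a) `&` A))%E.
Proof.
move=> inj mA; elim: N => [|N IH]; first by rewrite box0 set0I measure0 big_ord0.
rewrite boxS setIUl measureU; [|exact: measurableI..|].
  by rewrite big_ord_recr /= -IH.
apply/seteqP; split => // w [[[a aN h] _] [h' _]].
by have := inj _ _ (slab_uniq h h') => aN'; move: aN; rewrite aN' ltnn.
Qed.

(** The part of [XZ] where the cocycle of the inverse of [s] exceeds L in absolute value, written
    without choosing a cocycle function. *)
Definition escape (L : nat) (s : T) : set Om :=
  [set x | gmem o s /\ XZ x /\
    forall l : int, (`|l| <= L)%N -> ~ XZ (actZ l (act (ginv o s) x))].

Let mescape L s : measurable (escape L s).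
Proof.
have [ms|ns] := pselect (gmem o s); last first.
  by rewrite (_ : escape L s = set0)//; apply/seteqP; split => // x [].
rewrite (_ : escape L s = XZ `&` ~` \bigcup_(l in [set: int])
    [set x | (`|l| <= L)%N /\ (act (ginv o s) @^-1` (actZ l @^-1` XZ)) x]).
  apply: measurableI => //; apply: measurableC.
  apply: countable_bigcupT_measurable; first exact: countableP.
  move=> l; have [lL|lL] := boolP (`|l| <= L)%N.
    rewrite (_ : [set x | _ /\ _] = act (ginv o s) @^-1` (actZ l @^-1` XZ)).
      exact/mact/mactZ/mXZ/(mem_inv ol).
    by apply/seteqP; split => x //= [].
  by rewrite (_ : [set x | _ /\ _] = set0)//; apply/seteqP; split => x //= [].
apply/seteqP; split => x /=.
  by move=> [_ [Xx h]]; split => // -[l _ [lL hl]]; exact: h lL hl.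
by move=> [Xx h]; split => //; split => // l lL hl; apply: h; exists l.
Qed.

(** The inverse of [s] appears because orbit points h y compose on the left while [bdry] multiplies
    on the right: isoperimetry is applied to the inverses of the elements h. *)
Definition edge (N : nat) (s : T) : set Om :=
  [set w | gmem o s /\ box Posz N w /\ ~ box Posz N (act (ginv o s) w)].

Let edgeE N s : gmem o s ->
  edge N s = box Posz N `&` ~` (act (ginv o s) @^-1` box Posz N).
Proof. by move=> ms; apply/seteqP; split => w /= [] // ? []. Qed.

Let medge N s : measurable (edge N s).
Proof.
have [ms|ns] := pselect (gmem o s); last first.
  by rewrite (_ : edge N s = set0)//; apply/seteqP; split => // x [].
rewrite edgeE //; apply: measurableI => //; apply: measurableC.
exact/mact/mbox/(mem_inv ol).
Qed.

Let sum_margin N L : (\sum_(a < N) ((a < L) || (N <= a + L)) <= 2 * L)%N.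
Proof.
have h1 k : (\sum_(a < k) (a < L) <= L)%N.
  have -> : (\sum_(a < k) (a < L) = minn k L)%N.
    elim: k => [|k IH]; first by rewrite big_ord0 min0n.
    by rewrite big_ord_recr /= IH; case: ltnP; lia.
  exact: geq_minr.
rewrite mul2n -addnn; apply: (@leq_trans
  (\sum_(a < N) (a < L) + \sum_(a < N) (N <= a + L))%N).
  by rewrite -big_split /=; apply: leq_sum => a _; case: (a < L)%N; case: (N <= a + L)%N.
apply: leq_add; first exact: h1.
rewrite (reindex_inj rev_ord_inj) /=; apply: leq_trans (h1 N); apply: leq_sum => a _.
by have := ltn_ord a; case: ltnP; case: ltnP => //; lia.
Qed.

Let m := fine (mu XZ).
Let mE : mu XZ = m%:E. Proof. by rewrite fineK // ge0_fin_numE. Qed.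
Let m_gt0 : 0 < m. Proof. by rewrite -lte_fin -mE. Qed.

Let escape_fin L s : mu (escape L s) = (fine (mu (escape L s)))%:E.
Proof.
rewrite fineK // ge0_fin_numE //; apply: le_lt_trans XZfin.
by apply: le_measureT => // x [_ []].
Qed.

(** A point at height a with L <= a < N - L stays in the box unless its cocycle exceeds L. The at
    most 2 L remaining slabs are bounded by their full mass. *)
Lemma mu_edge_le N L s : gmem o s ->
  (mu (edge N s) <= (N%:R * fine (mu (escape L s)) + (2 * L)%:R * m)%:E)%E.
Proof.
move=> ms; have mi := mem_inv ol ms.
have mB : measurable (~` (act (ginv o s) @^-1` box Posz N)).
  exact/measurableC/mact/mbox.
rewrite edgeE // mu_box //; last by move=> i j [].
set e := fine (mu (escape L s)).
pose b (a : nat) : R := ((a < L) || (N <= a + L))%N%:R.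
apply: (@le_trans _ _ (\sum_(a < N) (e + b a * m)%:E)%E).
  rewrite /b; apply: lee_sum => a _.
  have [_|] := boolP ((a < L) || (N <= a + L))%N; rewrite ?mul1r ?mul0r.
    apply: (@le_trans _ _ (mu (slab a))).
      by apply: le_measureT => //; exact: measurableI.
    by rewrite mu_slab mE lee_fin lerDr fine_ge0.
  rewrite negb_or -leqNgt -ltnNge => /andP[La aL].
  rewrite addr0 /e -escape_fin -((mpZ (a := a) I).2 (escape L s)) //.
  apply: le_measureT; [exact: measurableI|exact: mactZ|].
  move=> w [Xw /= nb]; split => //; split => // l lL.
  rewrite comm // actZD => h; apply: nb.
  exists (absz (l + a%:Z)); first by move: lL La aL; clear; lia.
  by rewrite /slab /= gez0_abs //; move: lL La aL; clear; lia.
rewrite sumEFin lee_fin big_split /= sumr_const card_ord -[e *+ N]mulr_natl lerD2l.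
by rewrite -mulr_suml ler_wpM2r ?(ltW m_gt0) // -natr_sum ler_nat sum_margin.
Qed.

Let enum : exists J : set nat, exists e : nat -> T,
  [/\ forall i, J i -> gmem o (e i),
      forall i j, J i -> J j -> e i = e j -> i = j &
      forall h, gmem o h -> exists2 i, J i & e i = h].
Proof.
have [f finj] := countable_injP _ cG.
have ch i : exists h : T, (exists2 g, gmem o g & f g = i) -> gmem o h /\ f h = i.
  have [[g mg fg]|n] := pselect (exists2 g, gmem o g & f g = i); first by exists g.
  by exists (gone o).
have [e eP] := choice ch.
exists [set i | exists2 g, gmem o g & f g = i], e; split.
- by move=> i /eP[].
- by move=> i j /eP[_ fi] /eP[_ fj] ij; rewrite -fi ij fj.
- move=> h mh; exists (f h); first by exists h.
  have [] := eP (f h); first by exists h.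
  by move=> mh'; apply: finj; rewrite inE.
Qed.

Lemma atleast1E (A : set Om) : atleast o act 1 A = [set y | exists2 h, gmem o h & A (act h y)].
Proof.
apply/seteqP; split => y /=.
  move=> [W]; rewrite cardfs_gt0 => /fset0Pn[h hW] /(_ h hW)[mh Ah].
  by exists h.
move=> [h mh Ah]; exists [fset (h : C)]%fset; first by rewrite cardfs1.
by move=> g; rewrite inE => /eqP ->.
Qed.

(** The mass of the box on orbits with fewer than k visits is bounded above by isoperimetry along
    orbits and below by Markov's inequality. The constant [m0] is the mass of the part of [XG] whose
    orbits meet [XZ]; without ergodicity this may be less than [mu XG]. *)
Lemma coupling_inequality : exists2 m0 : R, 0 < m0 &
  forall (N k L D : nat) (S : seq T), (forall s, List.In s S -> gmem o s) ->
    (0 < k)%N -> isoper o S k D -> 4 * (N%:R * m) <= m0 * k%:R ->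
    N%:R * (m0 / 2) <= D%:R *
      \sum_(s <- S) (N%:R * fine (mu (escape L s)) + (2 * L)%:R * m).
Proof.
have [J [e [eJ e_inj e_surj]]] := enum.
pose vis := visits R act J e.
have vis_ge0 A y : (0 <= vis A y)%E by exact: visits_ge0.
have vis_ge A y (W : {fset C}) :
    (forall h : C, h \in W -> gmem o h /\ A (act h y)) ->
    ((#|` W|)%:R%:E <= vis A y)%E by exact: visits_ge.
have vis_le A y r : (forall W : {fset C},
    (forall h : C, h \in W -> gmem o h /\ A (act h y)) ->
    ((#|` W|)%:R%:E <= r)%E) -> (vis A y <= r)%E by exact: visits_le.
have mvis A : measurable A -> measurable_fun setT (vis A).
  exact: measurable_visits mp _ _ eJ _.
have mvisX A : measurable A -> measurable_fun XG (vis A).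
  by move=> mA; apply: measurable_funTS; exact: mvis.
have mal k A : measurable A -> measurable (atleast o act k A).
  exact: (measurable_atleast mp eJ e_inj e_surj).
have unf A : measurable A -> (\int[mu]_(y in XG) vis A y = mu A)%E.
  exact: (integral_visits ol actA mp eJ e_inj e_surj fG).
pose M0 := mu (XG `&` atleast o act 1 XZ).
have mM0 : measurable (XG `&` atleast o act 1 XZ) by apply: measurableI => //; exact: mal.
have M0fin : (M0 < +oo)%E.
  by apply: le_lt_trans XGfin; apply: le_measureT => //; exact: subIsetl.
(* The translates of this part under the group cover [XZ], so it cannot be null. *)
have M0gt : (0 < M0)%E.
  rewrite lt0e measure_ge0 andbT; apply/eqP => M00.
  suff : mu XZ = 0 by move=> h; move: XZ0; rewrite h ltxx.
  apply: (measure_negligible mXZ).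
  apply: (@negligibleS _ _ _ _ (\bigcup_i hits act J e (XG `&` atleast o act 1 XZ) i)).
    move=> x Xx; have [h [[mh Xh] _]] := fG.2 x.
    have [i Ji ei] := e_surj _ mh; exists i => //; split; rewrite ?ei //.
    split => //; rewrite atleast1E; exists (ginv o h); first exact: (mem_inv ol).
    by rewrite (act_inv ol actA).
  apply: negligible_bigcup => i; have [Ji|nJ] := pselect (J i); last first.
    rewrite (_ : hits _ _ _ _ _ = set0); first exact: negligible_set0.
    by apply/seteqP; split => // y [].
  exists (act (e i) @^-1` (XG `&` atleast o act 1 XZ)); split.
  - exact: (mact (eJ _ Ji)).
  - by rewrite (mp (eJ _ Ji)).2.
  - by move=> y [].
pose m0 := fine M0.
have M0E : M0 = m0%:E by rewrite fineK // ge0_fin_numE // ltW.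
have m0_gt0 : 0 < m0 by rewrite -lte_fin -M0E; exact: M0gt.
exists m0 => //.
move=> N k L D S memS k0 isoS Nk.
pose B := box Posz N.
have mB : measurable B by exact: mbox.
pose good := ~` atleast o act k B.
have mgood : measurable good by apply/measurableC/mal.
(* Moving a slab of the box to height 0 brings the other heights strictly between -N and N. Few
   visits to this window at height 0 hence give few visits to [B] from every slab. *)
pose B' := box Posz N `|` box (fun a => - a%:Z) N.
have mB' : measurable B' by apply: measurableU.
pose good' := ~` atleast o act k B'.
have mgood' : measurable good' by apply/measurableC/mal.
have upper : (mu (B `&` good) <= D%:R%:E * \sum_(s <- S) mu (edge N s))%E.
  have mBg : measurable (B `&` good) by exact: measurableI.
  rewrite -unf //; under eq_bigr do rewrite -unf //.
  rewrite -ge0_integral_sum //; last by move=> s; exact: mvisX.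
  rewrite -ge0_integralZl_EFin //; last 2 first.
  - by move=> y _; exact: sume_ge0.
  - by apply: emeasurable_sum => s; exact: mvisX.
  apply: ge0_le_integral => //; first exact: mvisX.
    by apply: measurable_funeM; apply: emeasurable_sum => s; exact: mvisX.
  move=> y _; apply: vis_le => W hW.
  have [->|[h0 h0W]] : W = fset0 \/ exists h, h \in W.
  - by have [->|/fset0Pn] := eqVneq W fset0; [left|right].
  - by rewrite cardfs0 mule_ge0 ?lee_fin // sume_ge0.
  have gy : ~ atleast o act k B y.
    have [mh0 [_ gh0]] := hW _ h0W.
    by move=> /(atleast_act ol actA k B y mh0).2.
  pose V : set C := [set h : C | gmem o h /\ B (act h y)].
  (* An infinite set of visits would contain k of them. *)
  have Vfin : finite_set V.
    apply: contrapT => /(infinite_set_fset k)[V' V'V kV']; apply: gy.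
    by exists V' => // h /V'V.
  pose V1 := fset_set V.
  have V1P (h : C) : h \in V1 <-> gmem o h /\ B (act h y).
    by rewrite /V1 in_fset_set // inE.
  have WV1 : (#|` W| <= #|` V1|)%N.
    by apply/fsubset_leq_card/fsubsetP => h /hW [mh [Bh _]]; apply/V1P.
  pose inv (h : C) : C := ginv o h.
  have inv_inj : injective inv.
    by move=> g h /(congr1 inv); rewrite /inv !(inv_invg ol).
  pose U := (inv @` V1)%fset.
  have cU : #|` U| = #|` V1| by rewrite card_imfset.
  have iso : (#|` U| <= D * \sum_(s <- S) #|` bdry o U s|)%N.
    apply: isoS.
      rewrite -cardfs_gt0 cU; apply: leq_trans WV1; rewrite cardfs_gt0.
      by apply/fset0Pn; exists h0.
    by rewrite cU ltnNge; apply/negP => kV; apply: gy; exists V1 => // h /V1P.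
  apply: (@le_trans _ _ ((D * \sum_(s <- S) #|` bdry o U s|)%N%:R%:E)).
    by rewrite lee_fin ler_nat -cU in WV1 *; exact: leq_trans WV1 iso.
  rewrite natrM EFinM lee_wpmul2l ?lee_fin //.
  have : forall s, List.In s S -> ((#|` bdry o U s|)%:R%:E <= vis (edge N s) y)%E.
    move=> s /memS ms.
    pose W' := [fset h in V1 | `[< ~ B (act (ginv o s) (act h y)) >]]%fset.
    apply: (@le_trans _ _ (#|` W'|%:R%:E)).
      rewrite lee_fin ler_nat; apply: (@leq_trans #|` (inv @` W')%fset|); last first.
        by rewrite card_imfset.
      apply/fsubset_leq_card/fsubsetP => u.
      rewrite !inE /= => /andP[/imfsetP[/= h hV ->] nU].
      apply/imfsetP; exists h => //=; rewrite !inE hV /=; apply/asboolP => Bs.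
      have [mh _] := (V1P h).1 hV.
      move/negP: nU; apply; apply/imfsetP.
      exists (gmul o (ginv o s) h : C) => /=; last first.
        by rewrite /inv (inv_mul ol) (inv_invg ol).
      apply/V1P; split; first exact/(mem_mul ol)/mh/(mem_inv ol).
      by rewrite actA.2 //; exact: (mem_inv ol).
    apply: vis_ge => h; rewrite !inE /= => /andP[/V1P[mh Bh] /asboolP nB].
    by split.
  elim: (S) => [|s S' IH] hS; first by rewrite !big_nil.
  rewrite !big_cons natrD EFinD; apply: leeD; first by apply: hS; left.
  by apply: IH => s' s'S; apply: hS; right.
have lower1 : (N%:R%:E * mu (XZ `&` good') <= mu (B `&` good))%E.
  rewrite mu_box //; last by move=> i j [].
  have mXg : measurable (XZ `&` good') by exact: measurableI.
  have -> : (N%:R%:E * mu (XZ `&` good') = \sum_(a < N) mu (XZ `&` good'))%E.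
    have : mu (XZ `&` good') \is a fin_num.
      rewrite ge0_fin_numE //; apply: le_lt_trans XZfin.
      by apply: le_measureT => //; exact: subIsetl.
    by move=> /fineK <-; rewrite sumEFin sumr_const card_ord -EFinM mulr_natl.
  apply: lee_sum => a _.
  rewrite -((mpZ (a := a) I).2 _ mXg); apply: le_measureT; first exact: mactZ.
    exact: measurableI.
  move=> w [Xw gw]; split => // -[W kW hW]; apply: gw; exists W => // h hh.
  have [mh [b bN Bb]] := hW h hh; split => //.
  rewrite comm //.
  have sl : slab (b%:Z - a%:Z) (actZ a (act h w)).
    by rewrite /slab /= actZD subrK.
  have [ab|ba] := leqP a b.
    left; exists (b - a)%N; first exact: leq_ltn_trans (leq_subr _ _) bN.
    by rewrite -subzn.
  right; exists (a - b)%N; first exact: leq_ltn_trans (leq_subr _ _) (ltn_ord a).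
  by rewrite -subzn ?opprB // ltnW.
(* The window has mass at most 2 N m, so the orbits with k visits to it occupy at most 2 N m / k <=
   m0 / 2 of [XG]; the other orbits that meet [XZ] each contribute at least one point of [XZ]. *)
have lower2 : ((m0 / 2)%:E <= mu (XZ `&` good'))%E.
  have mXg : measurable (XZ `&` good') by exact: measurableI.
  pose Q := atleast o act 1 XZ `&` good'.
  have mQ : measurable Q by apply: measurableI => //; exact: mal.
  have mBad : measurable (atleast o act k B') by exact: mal.
  have h1 : (mu (Q `&` XG) <= mu (XZ `&` good'))%E.
    rewrite -(unf (XZ `&` good')) // -(integral_indic mu mXG mQ); apply: ge0_le_integral => //.
    - by apply/measurable_EFinP; exact: measurable_indic.
    - exact: mvisX.
    - move=> y _; rewrite indicE; have [yQ|_] := boolP (y \in Q); last exact: vis_ge0.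
      move: yQ; rewrite inE => -[+ gy]; rewrite atleast1E => -[h mh Xh].
      have := vis_ge (XZ `&` good') y [fset (h : C)]%fset; rewrite cardfs1; apply.
      move=> g; rewrite inE => /eqP ->; split => //; split => //.
      by move=> /(atleast_act ol actA k B' y mh).1.
  have h2 : (k%:R%:E * mu (atleast o act k B' `&` XG) <= mu B')%E.
    rewrite -(unf B') // -(integral_indic mu mXG mBad) -ge0_integralZl_EFin //; last first.
      by apply/measurable_EFinP; exact: measurable_indic.
    apply: ge0_le_integral => //.
    - by apply: measurable_funeM; apply/measurable_EFinP; exact: measurable_indic.
    - exact: mvisX.
    - move=> y _; rewrite indicE; have [yQ|_] := boolP (y \in _); last first.
        by rewrite mule0; exact: vis_ge0.
      move: yQ; rewrite inE mule1 (atleastE R _ eJ e_inj e_surj) /=; exact.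
  have h3 : (mu B' <= (2 * (N%:R * m))%:E)%E.
    have bb f : injective f -> mu (box f N) = (N%:R * m)%:E.
      move=> inj; rewrite -[box f N]setIT mu_box //.
      under eq_bigr do rewrite setIT mu_slab mE.
      by rewrite sumEFin sumr_const card_ord mulr_natl.
    have : (mu B' <= mu (box Posz N) + mu (box (fun a => (- a%:Z)%R) N))%E by exact: measureU2.
    move=> /le_trans; apply; rewrite bb; last by move=> i j [].
    rewrite bb; last by move=> i j /oppr_inj [].
    by rewrite -EFinD lee_fin; lra.
  have h4 : (M0 <= mu (Q `&` XG) + mu (atleast o act k B' `&` XG))%E.
    apply: le_trans (measureU2 _ _ _); [|exact: measurableI..].
    apply: le_measureT => //; first by apply: measurableU; exact: measurableI.
    move=> y [Xy ay]; have [by_|ny] := pselect (atleast o act k B' y); [right|left]; by [].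
  have kE : mu (atleast o act k B' `&` XG) = (fine (mu (atleast o act k B' `&` XG)))%:E.
    rewrite fineK // ge0_fin_numE //; apply: le_lt_trans XGfin.
    by apply: le_measureT => //; exact: measurableI.
  have h5 : (mu (atleast o act k B' `&` XG) <= (m0 / 2)%:E)%E.
    move: (le_trans h2 h3); rewrite kE -EFinM !lee_fin => h.
    have k0' : 0 < k%:R :> R by rewrite ltr0n.
    rewrite -(ler_pM2l k0'); apply: le_trans h _; lra.
  apply: le_trans h1; move: (le_trans h4 (leeD2l _ h5)); rewrite M0E.
  case: (mu (Q `&` XG)) => [r| |] //=; rewrite ?leey // -EFinD !lee_fin; lra.
rewrite -lee_fin; apply: (@le_trans _ _ (mu (B `&` good))).
  by rewrite EFinM; apply: le_trans lower1; rewrite lee_wpmul2l ?lee_fin.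
apply: le_trans upper _; rewrite EFinM lee_wpmul2l ?lee_fin //.
rewrite -sumEFin; move: memS; elim: (S) => [|s S' IH] hS; first by rewrite !big_nil.
rewrite !big_cons leeD //; first by apply: mu_edge_le; apply: hS; left.
by apply: IH => s' s'S; apply: hS; right.
Qed.

End CouplingInequality.

(** * Nonexistence for large exponents *)

(** The integers are countable, so every preimage is a countable union of level sets of [c]. *)
Lemma measurable_fun_levels (R : realType) (d : measure_display)
    (Om : measurableType d) (A : set Om) (c : Om -> int) (g : int -> R) :
  (forall l, measurable (A `&` c @^-1` [set l])) -> measurable_fun A (g \o c).
Proof.
move=> mc _ Y _.
rewrite (_ : A `&` _ = \bigcup_(l in [set: int])
    [set x | Y (g l) /\ (A `&` c @^-1` [set l]) x]).
  apply: countable_bigcupT_measurable; first exact: countableP.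
  move=> l; have [Yl|nY] := pselect (Y (g l)).
    rewrite (_ : [set x | _] = A `&` c @^-1` [set l]) //.
    by apply/seteqP; split => x [].
  by rewrite (_ : [set x | _] = set0)//; apply/seteqP; split => x [].
apply/seteqP; split => x /=.
  by move=> [Ax Yx]; exists (c x).
by move=> [l _ [Yl [Ax cx]]]; split => //; rewrite cx.
Qed.

Section Tail.
Variables (R : realType) (d : measure_display) (Om : measurableType d).
Variables (mu : {measure set Om -> \bar R}) (X : set Om) (c : Om -> int).
Variables (phi : R -> R) (cg : R).
Hypotheses (mX : measurable X) (Xfin : (mu X < +oo)%E).
Hypothesis mc : forall l, measurable (X `&` c @^-1` [set l]).
Hypothesis phi_ge0 : forall t, 0 <= t -> 0 <= phi t.
Hypothesis phi_nd : forall s t, 0 <= s -> s <= t -> phi s <= phi t.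
Hypothesis cg_gt0 : 0 < cg.
Hypothesis phic :
  (\int[mu]_(x in X) (phi ((Num.norm (c x))%:~R / cg))%:E < +oo)%E.

Let tail (L : nat) : set Om := [set x | X x /\ (L < `|c x|)%N].

Lemma measurable_tail L : measurable (tail L).
Proof.
rewrite (_ : tail L = \bigcup_(l in [set: int])
    [set x | (L < `|l|)%N /\ (X `&` c @^-1` [set l]) x]).
  apply: countable_bigcupT_measurable; first exact: countableP.
  move=> l; have [Yl|nY] := boolP (L < `|l|)%N.
    rewrite (_ : [set x | _] = X `&` c @^-1` [set l]) //.
    by apply/seteqP; split => x [].
  by rewrite (_ : [set x | _] = set0)//; apply/seteqP; split => x [].
apply/seteqP; split => x /=.
  by move=> [Xx h]; exists (c x).
by move=> [l _ [h [Ax cx]]]; split => //; rewrite cx.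
Qed.

(* Absolute continuity of the integral gives more than Markov's inequality:
   the tails are little-o of [phi]. *)
Lemma tail_small (Ls : nat -> nat) (kappa eps : R) : 0 < kappa -> 0 < eps ->
  (forall L0, exists M0, forall M, (M0 <= M)%N -> (L0 <= Ls M)%N) ->
  (exists M0, forall M, (M0 <= M)%N -> kappa * M%:R <= phi ((Ls M)%:R / cg)) ->
  exists M0, forall M, (M0 <= M)%N -> M%:R * fine (mu (tail (Ls M))) <= eps.
Proof.
move=> k0 e0 Ls_oo [M1 hM1].
pose g (l : int) : R := phi ((Num.norm l)%:~R / cg).
have g_ge0 l : 0 <= g l by rewrite phi_ge0 // divr_ge0 ?ler0z ?normr_ge0 // ltW.
have mgc : measurable_fun X (g \o c) by exact: measurable_fun_levels.
pose f := (g \o c) \_ X.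
have intf : mu.-integrable setT (EFin \o f).
  rewrite /f -restrict_EFin; apply: (integrable_mkcond (EFin \o (g \o c)) mX).1.
  apply/integrableP; split; first exact/measurable_EFinP.
  rewrite (eq_integral (fun x => (phi ((Num.norm (c x))%:~R / cg))%:E)) //.
  by move=> x _ /=; rewrite ger0_norm //; exact: g_ge0.
have [del [del0 hdel]] := integral_normr_continuous intf (mulr_gt0 k0 e0).
(* The tails decrease to the empty set inside [X], which has finite measure. *)
have cvt : (mu \o tail) n @[n --> \oo] --> 0%E.
  have -> : 0%E = mu (\bigcap_n tail n).
    rewrite (_ : \bigcap_n tail n = set0) ?measure0 //.
    apply/seteqP; split => x // /(_ `|c x|%N I) [_].
    by rewrite ltnn.
  apply: nonincreasing_cvg_mu.
  - apply: le_lt_trans Xfin; apply: le_measureT => //; first exact: measurable_tail.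
    by move=> x [].
  - exact: measurable_tail.
  - by apply: bigcap_measurable => // i _; exact: measurable_tail.
  - move=> i j ij; apply/subsetPset => x [Xx h]; split => //.
    exact: leq_ltn_trans h.
have [L0 hL0] : exists L0, forall L, (L0 <= L)%N -> (mu (tail L) < del%:E)%E.
  have /cvt : nbhs (0%E : \bar R) (fun u => (u < del%:E)%E).
    by apply: open_ereal_lt'; rewrite lte_fin.
  by move=> [L0 _ h]; exists L0 => L /h.
have [M2 hM2] := Ls_oo L0.
exists (maxn M1 M2) => M; rewrite geq_max => /andP[/hM1 h1 /hM2 /hL0 h2].
have mt := measurable_tail (Ls M).
have tfin : mu (tail (Ls M)) \is a fin_num.
  by rewrite ge0_fin_numE //; apply: lt_trans h2 _; rewrite ltry.
have := hdel _ mt h2; rewrite /Rintegral => h3.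
rewrite -(ler_pM2l k0); apply: le_trans (ltW h3).
have mabs : measurable_fun setT (fun x => (`|f x|)%:E).
  apply/measurable_EFinP; apply: measurableT_comp => //.
  exact/measurable_EFinP/(measurable_int mu intf).
rewrite -lee_fin fineK; last first.
  rewrite ge0_fin_numE; last by apply: integral_ge0 => x _; rewrite lee_fin.
  move/integrableP : (intf) => [_]; apply: le_lt_trans.
  exact: ge0_subset_integral.
rewrite mulrA EFinM fineK // -integral_cst //.
apply: ge0_le_integral => //.
- by move=> x _; rewrite lee_fin mulr_ge0 // ltW.
- exact: measurable_funTS.
- move=> x [Xx h]; rewrite lee_fin /f patchE mem_set //= ger0_norm //.
  apply: le_trans h1 _; apply: phi_nd; first by rewrite divr_ge0 // ltW.
  rewrite ler_pM2r ?invr_gt0 // ?pmulrn ler_int.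
  by rewrite -abszE lez_nat ltnW.
Qed.

End Tail.

Lemma eventually_all (T : Type) (S : seq T) (P : T -> nat -> Prop) :
  (forall s, List.In s S -> exists M0, forall M, (M0 <= M)%N -> P s M) ->
  exists M0, forall M, (M0 <= M)%N -> forall s, List.In s S -> P s M.
Proof.
elim: S => [|s S IH] h; first by exists 0%N.
have [M1 h1] := h s (or_introl erefl).
have [M2 h2] := IH (fun s' s'S => h s' (or_intror s'S)).
exists (maxn M1 M2) => M; rewrite geq_max => /andP[/h1 Ps /h2 PS] s' [<-//|].
exact: PS.
Qed.

Lemma sum_le_In (R : realType) (T : Type) (S : seq T) (f : T -> R) (b : R) :
  (forall s, List.In s S -> f s <= b) -> \sum_(s <- S) f s <= (size S)%:R * b.
Proof.
elim: S => [|s S IH] h; first by rewrite big_nil mul0r.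
rewrite big_cons /= -natr1 mulrDl mul1r addrC lerD //.
  by apply: IH => s' s'S; apply: h; right.
by apply: h; left.
Qed.

Section NoCoupling.
Variables (R : realType) (d : measure_display) (Om : measurableType d).
Variables (mu : {measure set Om -> \bar R}) (T : Type) (o : gops T).
Variables (act : T -> Om -> Om) (actZ : int -> Om -> Om) (XG XZ : set Om).
Hypothesis ol : group_laws o.
Hypothesis actA : Defs.is_action (gmul o) (gone o) (gmem o) act.
Hypothesis mp : measure_preserving_action mu (gmem o) act.
Hypothesis cG : countable (gmem o).
Hypothesis actZA : Defs.is_action (fun a b : int => a + b) 0 (fun _ => True) actZ.
Hypothesis mpZ : measure_preserving_action mu (fun _ : int => True) actZ.
Hypothesis comm : forall a l x, gmem o a -> act a (actZ l x) = actZ l (act a x).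
Hypothesis fG : fundamental_domain (gmem o) act XG.
Hypothesis fZ : fundamental_domain (fun _ : int => True) actZ XZ.
Hypotheses (XGfin : (mu XG < +oo)%E) (XZfin : (mu XZ < +oo)%E).
Hypothesis XZ0 : (0 < mu XZ)%E.
Variables (n : nat) (p : R) (phi : R -> R).
Hypothesis p1 : 1 <= p.
Hypothesis phi_ge0 : forall t, 0 <= t -> 0 <= phi t.
Hypothesis phi_nd : forall s t, 0 <= s -> s <= t -> phi s <= phi t.
Hypothesis phiE : exists t0 : R, forall t, t0 <= t ->
  phi t = powR (iter n.+1 (@ln R) t) p.
Hypothesis phic : forall gamma, gmem o gamma ->
  exists c : Om -> int,
    (forall x, XZ x -> XZ (actZ (c x) (act gamma x))) /\
    exists cg : R, 0 < cg /\
      (\int[mu]_(x in XZ) (phi ((Num.norm (c x))%:~R / cg))%:E < +oo)%E.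

(** The set [escape] is a tail of the given cocycle, whose level sets are measurable because the
    fundamental domain determines its values. The common bound [G] on the constants [cg] lets one
    sequence [Ls] serve every element of [S]. *)
Lemma escape_small (s : T) (G : R) (Ls : nat -> nat) (kappa eps : R) :
  gmem o s ->
  0 < kappa -> 0 < eps ->
  (forall L0, exists M0, forall M, (M0 <= M)%N -> (L0 <= Ls M)%N) ->
  (exists2 cg : R, 0 < cg <= G & exists2 c : Om -> int,
    (forall x, XZ x -> XZ (actZ (c x) (act (ginv o s) x))) &
    (\int[mu]_(x in XZ) (phi ((Num.norm (c x))%:~R / cg))%:E < +oo)%E) ->
  (exists M0, forall M, (M0 <= M)%N -> kappa * M%:R <= phi ((Ls M)%:R / G)) ->
  exists M0, forall M, (M0 <= M)%N ->
    M%:R * fine (mu (escape o act actZ XZ (Ls M) s)) <= eps.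
Proof.
move=> ms k0 e0 Loo [cg /andP[cg0 cgG] [c cX cint]] [M1 hM1].
have mXZ := fZ.1.
have mi := mem_inv ol ms.
have cE l : XZ `&` c @^-1` [set l] = XZ `&` act (ginv o s) @^-1` (actZ l @^-1` XZ).
  apply/seteqP; split => x [Xx /= h]; split => //; first by rewrite -h; exact: cX.
  have [k [_ uk]] := fZ.2 (act (ginv o s) x).
  by rewrite -(uk l) // -(uk (c x)) //; split => //; exact: cX.
have mc l : measurable (XZ `&` c @^-1` [set l]).
  rewrite cE; apply: measurableI => //; rewrite -[X in measurable X]setTI.
  apply: (mp mi).1 => //; rewrite -[X in measurable X]setTI.
  exact: (mpZ (a := l) I).1.
have hM M : (M1 <= M)%N -> kappa * M%:R <= phi ((Ls M)%:R / cg).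
  move=> /hM1 /le_trans; apply; apply: phi_nd.
    by rewrite divr_ge0 // ltW // (lt_le_trans cg0).
  by rewrite ler_wpM2l // lef_pV2 ?posrE // (lt_le_trans cg0).
have [M0 h] := tail_small mXZ XZfin mc phi_ge0 phi_nd cg0 cint k0 e0 Loo
  (ex_intro _ M1 hM).
exists M0 => M /h; suff -> : escape o act actZ XZ (Ls M) s =
    [set x | XZ x /\ (Ls M < `|c x|)%N] by [].
apply/seteqP; split => x /=.
  move=> [_ [Xx h1]]; split => //; rewrite ltnNge; apply/negP => /h1; apply.
  exact: cX.
move=> [Xx cL]; split => //; split => // l lL Xl.
have [k [_ uk]] := fZ.2 (act (ginv o s) x).
have : l = c x by rewrite -(uk l) // -(uk (c x)) //; split => //; exact: cX.
by move=> lc; move: cL; rewrite -lc ltnNge lL.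
Qed.

Lemma no_coupling (S : seq T) : (forall s, List.In s S -> gmem o s) ->
  (forall M : nat, (0 < M)%N -> isoper o S (tow n.+1 M) (8 ^ n.+1 * M)) -> False.
Proof.
move=> memS isoS.
have [m0 m0_gt0 ineq] := coupling_inequality ol actA mp cG actZA mpZ comm fG fZ
  XGfin XZfin XZ0.
set m := fine (mu XZ) in ineq.
have m_ge0 : 0 <= m by rewrite fine_ge0.
have [G G1 hG] : exists2 G : R, 1 <= G & forall s, List.In s S ->
    exists2 cg : R, 0 < cg <= G & exists2 c : Om -> int,
    (forall x, XZ x -> XZ (actZ (c x) (act (ginv o s) x))) &
    (\int[mu]_(x in XZ) (phi ((Num.norm (c x))%:~R / cg))%:E < +oo)%E.
  elim: (S) memS => [|s S' IH] memS'; first by exists 1.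
  have [G' G'1 hG'] := IH (fun t tS => memS' t (or_intror tS)).
  have ms := memS' s (or_introl erefl).
  have [c [cX [cg [cg0 cint]]]] := phic (mem_inv ol ms).
  exists (Num.max G' cg); first by rewrite le_max G'1.
  move=> t [<-|/hG'[cg' /andP[h1 h2] h3]].
    by exists cg; [rewrite cg0 le_max lexx orbT|exists c].
  by exists cg' => //; rewrite h1 le_max h2.
(* With N = k / C, the condition 4 N m <= m0 k of the coupling inequality holds. *)
pose C := (Num.truncn (4 * m / m0)).+1.
have C0 : 0 < C%:R :> R by rewrite ltr0n.
have hC : 4 * m <= m0 * C%:R.
  by rewrite -ler_pdivrMl // mulrC; exact/ltW/truncnS_gt.
have G0 : 0 < G by apply: lt_le_trans G1.
(* Of the 3 in G + 3, one unit is lost to each of the two Euclidean divisions below and one is kept: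
   [Ls M] is at least (G + 1) E. *)
have [c c0 [M1 hM1]] := @towS_ge R n (C%:R * (G + 3)) (mulr_gt0 C0 (addr_gt0 G0 (ltr0n _ 3))).
pose Nn M := (tow n.+1 M %/ C)%N.
pose Ls M := (Nn M %/ M ^ 2)%N.
pose E M : R := iter n.+1 expR (c * M%:R).
have Ecm M : c * M%:R <= E M by exact: le_iter_expR.
have E1 M : 1 <= E M.
  rewrite /E iterS; apply: le_trans (expR_ge1Dx _); rewrite lerDl.
  by apply: le_trans (le_iter_expR _ _); rewrite mulr_ge0 // ltW.
have LsE M : (maxn M1 1 <= M)%N -> (G + 1) * E M <= (Ls M)%:R.
  rewrite geq_max => /andP[/hM1 h1 M0].
  have M2 : 1 <= M%:R ^+ 2 :> R by rewrite -natrX ler1n expn_gt0 M0.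
  have h2 : (tow n.+1 M)%:R < C%:R * ((Nn M)%:R + 1) :> R.
    by rewrite natr1 -natrM ltr_nat mulnC /Nn -ltn_divLR.
  have h3 : (Nn M)%:R < M%:R ^+ 2 * ((Ls M)%:R + 1) :> R.
    by rewrite natr1 -natrX -natrM ltr_nat mulnC /Ls -ltn_divLR // expn_gt0 M0.
  have h4 : (G + 3) * M%:R ^+ 2 * E M <= (Nn M)%:R + 1.
    rewrite -(ler_pM2l C0); apply: le_trans (ltW h2); apply: le_trans h1.
    by rewrite !mulrA.
  have h5 : (G + 2) * E M <= (Ls M)%:R + 1.
    have M2' : 0 < M%:R ^+ 2 :> R by apply: lt_le_trans M2.
    rewrite -(ler_pM2l M2'); apply: le_trans (ltW h3).
    have : 1 <= M%:R ^+ 2 * E M by exact: mulr_ege1.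
    by move: h4; set x := M%:R ^+ 2; set y := E M; lra.
  by have := E1 M; move: h5; set y := E M; lra.
have Loo L0 : exists M0, forall M, (M0 <= M)%N -> (L0 <= Ls M)%N.
  exists (maxn (maxn M1 1) (Num.truncn (L0%:R / c)).+1) => M.
  rewrite geq_max => /andP[/LsE h1 h2]; rewrite -(ler_nat R).
  apply: le_trans h1; apply: (@le_trans _ _ (E M)).
    apply: le_trans (Ecm M); rewrite -ler_pdivrMl // mulrC.
    by apply: le_trans (ltW (truncnS_gt _)) _; rewrite ler_nat.
  by rewrite ler_peMl //; [exact: le_trans (E1 M)|lra].
have [t0 ht0] := phiE.
have phiL : exists M0, forall M, (M0 <= M)%N -> c * M%:R <= phi ((Ls M)%:R / G).
  exists (maxn (maxn M1 1) (Num.truncn ((Num.max 1 t0) / c)).+1) => M.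
  rewrite geq_max => /andP[/LsE h1 h2].
  have cM : Num.max 1 t0 <= c * M%:R.
    rewrite -ler_pdivrMl // mulrC.
    by apply: le_trans (ltW (truncnS_gt _)) _; rewrite ler_nat.
  move: cM; rewrite ge_max => /andP[cM1 cMt].
  apply: (@le_trans _ _ (phi (E M))).
    rewrite ht0; last exact: le_trans cMt (Ecm M).
    rewrite /E iter_expRK; apply: (le_trans _ (ler_powR cM1 p1)).
    by rewrite powRr1 // (le_trans _ cM1).
  apply: phi_nd; first exact: le_trans (E1 M).
  rewrite ler_pdivlMr // mulrC; apply: le_trans h1.
  by rewrite ler_wpM2r //; [exact: le_trans (E1 M)|lra].
pose W : R := 8 ^+ n.+1.
have W0 : 0 < W by rewrite exprn_gt0.
pose q := (size S)%:R : R.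
have q0 : 0 <= q by rewrite /q.
(* The escape term is then at most m0 N / 8; the choice of [M] below bounds the margin term in the
   same way, and m0 N / 4 < m0 N / 2 is the contradiction. *)
pose eps := m0 / (8 * W * (q + 1)).
have q1 : 0 < q + 1 by rewrite ltr_wpDl.
have eps0 : 0 < eps by rewrite divr_gt0 // !mulr_gt0.
have [M2 hM2] : exists M0, forall M, (M0 <= M)%N -> forall s, List.In s S ->
    M%:R * fine (mu (escape o act actZ XZ (Ls M) s)) <= eps.
  apply: eventually_all => s sS.
  exact: (escape_small (memS s sS) c0 eps0 Loo (hG s sS) phiL).
pose M := (maxn (maxn M1 M2) (Num.truncn (16 * W * q * m / m0)).+1).
have M1M : (maxn M1 1 <= M)%N.
  rewrite geq_max; apply/andP; split; first by rewrite /M -maxnA leq_maxl.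
  by rewrite /M leq_max orbT.
have M2M : (M2 <= M)%N by rewrite /M [maxn M1 M2]maxnC -maxnA leq_maxl.
have M0' : (0 < M)%N by move: M1M; rewrite geq_max => /andP[].
have M0 : 0 < M%:R :> R by rewrite ltr0n.
have hM : 16 * W * q * m <= m0 * M%:R.
  rewrite -ler_pdivrMl // mulrC; apply: le_trans (ltW (truncnS_gt _)) _.
  by rewrite ler_nat leq_maxr.
have Ls0 : 0 < (Ls M)%:R :> R.
  by apply: lt_le_trans (LsE M M1M); rewrite mulr_gt0 ?(lt_le_trans _ (E1 M)) // addr_gt0.
have LsN : (Ls M)%:R * M%:R ^+ 2 <= (Nn M)%:R :> R.
  by rewrite -natrX -natrM ler_nat leq_trunc_div.
have N0 : 0 < (Nn M)%:R :> R by apply: lt_le_trans LsN; rewrite mulr_gt0 // exprn_gt0.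
have := ineq (Nn M) (tow n.+1 M) (Ls M) (8 ^ n.+1 * M)%N S memS _ (isoS M M0') _.
have tow0 : (0 < tow n.+1 M)%N by rewrite expn_gt0.
have Nk : 4 * ((Nn M)%:R * m) <= m0 * (tow n.+1 M)%:R.
  have : (Nn M)%:R * C%:R <= (tow n.+1 M)%:R :> R by rewrite -natrM ler_nat leq_trunc_div.
  move=> /(ler_wpM2l (ltW m0_gt0)) h; apply: le_trans h.
  by rewrite mulrCA [leRHS]mulrCA ler_wpM2l.
move=> /(_ tow0 Nk); apply/negP; rewrite -ltNge.
have hsum : \sum_(s <- S) ((Nn M)%:R * fine (mu (escape o act actZ XZ (Ls M) s)) +
    (2 * Ls M)%:R * m) <= q * ((Nn M)%:R * (eps / M%:R) + 2 * (Ls M)%:R * m).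
  apply: sum_le_In => s sS; rewrite natrM lerD2r ler_wpM2l //.
  by rewrite ler_pdivlMr // mulrC; exact: hM2.
have WM : 0 <= W * M%:R by rewrite mulr_ge0 // ltW.
rewrite natrM natrX -/W; apply: le_lt_trans (ler_wpM2l WM hsum) _.
set N := (Nn M)%:R in N0 LsN *; set L := (Ls M)%:R in Ls0 LsN *.
set x := M%:R in M0 hM LsN *.
have -> : W * x * (q * (N * (eps / x) + 2 * L * m)) = W * q * eps * N + 2 * W * q * m * (L * x).
  by field; rewrite gt_eqF.
have b1 : W * q * eps * N <= m0 / 8 * N.
  rewrite ler_wpM2r ?(ltW N0) //.
  have -> : W * q * eps = m0 / 8 * (q / (q + 1)).
    by rewrite /eps; field; rewrite !gt_eqF.
  by rewrite ler_piMr ?divr_ge0 ?(ltW m0_gt0) // ler_pdivrMr // mul1r lerDl.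
have b2 : 2 * W * q * m * (L * x) <= m0 / 8 * N.
  apply: (@le_trans _ _ (m0 / 8 * (L * x ^+ 2))); last by rewrite ler_wpM2l ?divr_ge0 ?(ltW m0_gt0).
  have : 16 * W * q * m * (L * x) <= m0 * x * (L * x).
    by rewrite ler_wpM2r // mulr_ge0 // ltW.
  have -> : m0 * x * (L * x) = m0 * (L * x ^+ 2) by ring.
  by set y := L * x; set z := L * x ^+ 2; lra.
have : 0 < m0 * N by rewrite mulr_gt0.
lra.
Qed.

End NoCoupling.

(** * Piecewise translations of the real line *)

Section Translate.
Variables (R : realType) (t : R).

Let shift (x : measurableTypeR R) : measurableTypeR R := x + t.

Let mshift : measurable_fun setT shift.
Proof. exact: measurable_funD. Qed.

Definition shifted (A : set (measurableTypeR R)) : \bar R :=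
  lebesgue_measure (shift @^-1` A).

Let mpre A : measurable A -> measurable (shift @^-1` A).
Proof. by move=> mA; rewrite -[X in measurable X]setTI; exact: mshift. Qed.

Let shifted0 : shifted set0 = 0%E.
Proof. by rewrite /shifted preimage_set0 measure0. Qed.

Let shifted_ge0 A : (0 <= shifted A)%E.
Proof. exact: measure_ge0. Qed.

Let shifted_additive : semi_sigma_additive shifted.
Proof.
move=> B mB tB mUB; rewrite /shifted preimage_bigcup.
apply: measure_semi_sigma_additive.
- by move=> n; exact: mpre.
- apply/trivIsetP => /= i j _ _ ij; rewrite -preimage_setI.
  by move/trivIsetP : tB => /(_ _ _ _ _ ij) ->//; rewrite preimage_set0.
- by rewrite -preimage_bigcup; exact: mpre.
Qed.

HB.instance Definition _ := isMeasure.Build _ _ _ shifted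
  shifted0 shifted_ge0 shifted_additive.

(** The translated measure agrees with Lebesgue measure on half-open intervals, which determine
    it. *)
Lemma lebesgue_measure_translate (A : set (measurableTypeR R)) : measurable A ->
  lebesgue_measure [set x | A (x + t)] = lebesgue_measure A.
Proof.
move=> mA; rewrite [RHS](@lebesgue_measure_unique R shifted) //.
move=> X [[a b] _ <-] /=; rewrite /shifted.
rewrite (_ : _ @^-1` _ = `]a - t, b - t]%classic); last first.
  by apply/seteqP; split => x; rewrite /= !in_itv /= /shift ltrBlDr lerBrDr.
rewrite !lebesgue_measure_itv /= !lte_fin ltrD2r.
by case: ifP => // _; rewrite -!EFinB opprB addrA subrK.
Qed.

End Translate.

Lemma measurable_translate (R : realType) (t : R) (A : set (measurableTypeR R)) :
  measurable A -> measurable ([set x | A (x + t)] : set (measurableTypeR R)).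
Proof.
move=> mA; have mt : measurable_fun setT
    (fun x : measurableTypeR R => x + t : measurableTypeR R) by exact: measurable_funD.
by rewrite -[X in measurable X]setTI; exact: mt.
Qed.

Section Subtype.
Variables (R : realType) (A : set (measurableTypeR R)).

(* The parameter [x0] makes the type pointed, as measurable types must be. *)
Definition subreal (x0 : {x : R | x \in A}) : Type := {x : R | x \in A}.

Variable x0 : {x : R | x \in A}.

HB.instance Definition _ := Choice.on (subreal x0).
HB.instance Definition _ := isPointed.Build (subreal x0) x0.

Let emb (w : subreal x0) : measurableTypeR R := val w.

Definition submeas := g_sigma_algebra_preimageType emb.

Definition embed (w : submeas) : measurableTypeR R := emb w.

Lemma embed_inj : injective embed.
Proof. by move=> w w' h; exact: (@val_inj _ _ {x : R | x \in A}). Qed.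

Lemma embedP w : A (embed w).
Proof. by have := valP (w : {x : R | x \in A}); rewrite inE. Qed.

Lemma embed_surj x : A x -> exists w, embed w = x.
Proof. by move=> Ax; exists (exist (fun x => x \in A) x (mem_set Ax)). Qed.

Lemma image_embed (B : set R) : embed @` (embed @^-1` B) = A `&` B.
Proof.
apply/seteqP; split => x; first by move=> [w Bw <-]; split => //; exact: embedP.
by move=> [/embed_surj[w <-] Bx]; exists w.
Qed.

Lemma measurable_embed : measurable_fun setT embed.
Proof. by move=> _ B mB; rewrite setTI; exists B => //; rewrite setTI. Qed.

Hypothesis mA : measurable A.

Lemma measurable_image (B : set submeas) : measurable B -> measurable (embed @` B).
Proof.
by move=> [B' mB' <-]; rewrite setTI image_embed; exact: measurableI.
Qed.

(** The proof that [A] is measurable is an argument so that the measure structure, which depends on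
    it, can be attached to the term. *)
Definition submeasure (_ : measurable A) (B : set submeas) : \bar R :=
  lebesgue_measure (embed @` B).

Let submeasure0 : submeasure mA set0 = 0%E.
Proof. by rewrite /submeasure image_set0 measure0. Qed.

Let submeasure_ge0 B : (0 <= submeasure mA B)%E.
Proof. exact: measure_ge0. Qed.

Let submeasure_additive : semi_sigma_additive (submeasure mA).
Proof.
move=> B mB tB mUB; rewrite /submeasure image_bigcup.
apply: measure_semi_sigma_additive.
- by move=> n; exact: measurable_image.
- apply/trivIsetP => /= i j _ _ ij; apply/seteqP; split => // x [[w Bw <-]].
  move=> [w' Bw' /embed_inj ww']; subst w'.
  by move/trivIsetP : tB => /(_ _ _ I I ij) h; have : (B i `&` B j) w by []; rewrite h.
- by rewrite -image_bigcup; exact: measurable_image.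
Qed.

HB.instance Definition _ := isMeasure.Build _ _ _ (submeasure mA)
  submeasure0 submeasure_ge0 submeasure_additive.

End Subtype.

(** The partial translations are total only on a conull set, whereas a coupling asks for actions at
    every point; hence the space is this set itself, known only through its embedding [v]. *)
Lemma subtype_measure_space (R : realType) (A : set (measurableTypeR R)) :
  measurable A -> A !=set0 ->
  exists (d : measure_display) (Om : measurableType d)
    (mu : {measure set Om -> \bar R}) (v : Om -> measurableTypeR R),
    [/\ injective v, forall x, A x <-> exists w, v w = x,
        measurable_fun setT v,
        forall B, measurable B -> measurable (v @` B) &
        forall B, mu B = lebesgue_measure (v @` B)].
Proof.
move=> mA [x Ax]; pose x0 := exist (fun x => x \in A) x (mem_set Ax).
exists _, (submeas x0), (submeasure mA), (@embed R A x0); split.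
- exact: embed_inj.
- by move=> y; split; [exact: embed_surj|move=> [w <-]; exact: embedP].
- exact: measurable_embed.
- by move=> B; exact: measurable_image.
- by [].
Qed.

Section PiecewiseTranslation.
Variables (R : realType) (d : measure_display) (Om : measurableType d).
Variables (mu : {measure set Om -> \bar R}) (v : Om -> measurableTypeR R).
Hypothesis v_inj : injective v.
Hypothesis mv : measurable_fun setT v.
Hypothesis mimv : forall B, measurable B -> measurable (v @` B).
Hypothesis muE : forall B, mu B = lebesgue_measure (v @` B).
Variables (f g : Om -> Om).
Hypotheses (fK : cancel f g) (gK : cancel g f).
Hypothesis levels : forall r : rat, measurable [set w | v (f w) = v w + ratr r].
Hypothesis pieces : forall w, exists r : rat, v (f w) = v w + ratr r.

Let measurable_of_image B : measurable (v @` B) -> measurable B.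
Proof.
move=> mB; rewrite (_ : B = setT `&` v @^-1` (v @` B)); first exact: mv.
apply/seteqP; split => w /=; first by move=> Bw; split => //; exists w.
by move=> [_ [w' Bw' /v_inj <-]].
Qed.

Let src (A : set Om) r : set Om := [set w | v (f w) = v w + ratr r /\ A (f w)].
Let tgt (A : set Om) r : set Om := [set w | v w = v (g w) + ratr r /\ A w].

Let src_tgt A r : v @` src A r = [set x | (v @` tgt A r) (x + ratr r)].
Proof.
apply/seteqP; split => x /=.
  by move=> [w [fw Aw] <-]; exists (f w) => //; split => //; rewrite fK.
move=> [w [gw Aw] wx]; exists (g w); last by apply: (addIr (ratr r)); rewrite -gw.
by split; rewrite gK.
Qed.

Let msrc A r : measurable A -> measurable (src A r).
Proof.
move=> mA; apply: measurable_of_image.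
rewrite (_ : v @` _ = v @` [set w | v (f w) = v w + ratr r] `&`
   [set x | (v @` A) (x + ratr r)]); last first.
  apply/seteqP; split => x /=.
    move=> [w [fw Aw] <-]; split; first by exists w.
    by exists (f w).
  move=> [[w fw <-] [w' Aw' h]]; exists w => //; split => //.
  by rewrite (_ : f w = w') //; apply: v_inj; rewrite h fw.
apply: measurableI; first exact: mimv.
by apply: measurable_translate; exact: mimv.
Qed.

Let mtgt A r : measurable A -> measurable (tgt A r).
Proof.
move=> mA; apply: measurable_of_image.
rewrite (_ : v @` _ = [set x | (v @` src A r) (x + - ratr r)]).
  by apply: measurable_translate; apply: mimv; exact: msrc.
rewrite src_tgt; apply/seteqP; split => x /=; by rewrite subrK.
Qed.

Let mu_src_tgt A r : measurable A -> mu (src A r) = mu (tgt A r).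
Proof.
by move=> mA; rewrite !muE src_tgt lebesgue_measure_translate //; apply: mimv; exact: mtgt.
Qed.

(** Reindexes a family of pieces from the rationals to the naturals, as countable additivity
    requires. *)
Let part (E : rat -> set Om) n : set Om :=
  [set w | (exists2 r : rat, choice.pickle r = n & (E r) w)].

Let partE E r : part E (choice.pickle r) = E r.
Proof.
apply/seteqP; split => w /=; last by exists r.
by move=> [r' /(pcan_inj choice.pickleK) ->].
Qed.

Let part0 E n : (forall r : rat, choice.pickle r <> n) -> part E n = set0.
Proof. by move=> h; apply/seteqP; split => // w [r /h]. Qed.

Let mpart E n : (forall r, measurable (E r)) -> measurable (part E n).
Proof.
move=> mE; have [[r <-]|h] := pselect (exists r : rat, choice.pickle r = n).
  by rewrite partE.
by rewrite part0 // => r rn; apply: h; exists r.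
Qed.

Lemma piecewise_translation_measurable : measurable_fun setT f.
Proof.
move=> _ A mA; rewrite setTI (_ : f @^-1` A = \bigcup_n part (src A) n).
  by apply: bigcup_measurable => n _; apply: mpart => r; exact: msrc.
apply/seteqP; split => w /=; last by move=> [n _ [r _ []]].
by move=> Aw; have [r hr] := pieces w; exists (choice.pickle r) => //; rewrite partE.
Qed.

(** The sets [src A r] partition the preimage, the sets [tgt A r] partition A, and translation by r
    takes one to the other. *)
Lemma piecewise_translation_preserves A : measurable A -> mu (f @^-1` A) = mu A.
Proof.
move=> mA.
have -> : f @^-1` A = \bigcup_n part (src A) n.
  apply/seteqP; split => w /=; last by move=> [n _ [r _ []]].
  by move=> Aw; have [r hr] := pieces w; exists (choice.pickle r) => //; rewrite partE.
have {2}-> : A = \bigcup_n part (tgt A) n.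
  apply/seteqP; split => w /=; last by move=> [n _ [r _ []]].
  move=> Aw; have [r hr] := pieces (g w); exists (choice.pickle r) => //; rewrite partE.
  by split => //; rewrite -hr gK.
rewrite !measure_bigcup //; last 4 first.
- by move=> n _; apply: mpart => r; exact: mtgt.
- move=> i j _ _ [w [[r <- [h _]] [r' <- [h' _]]]].
  move: h; rewrite h' => /addrI /fmorph_inj -> //.
- by move=> n _; apply: mpart => r; exact: msrc.
- move=> i j _ _ [w [[r <- [h _]] [r' <- [h' _]]]].
  move: h; rewrite h' => /addrI /fmorph_inj -> //.
apply: eq_eseriesr => n _.
have [[r <-]|h] := pselect (exists r : rat, choice.pickle r = n).
  by rewrite !partE mu_src_tgt.
by rewrite !part0 // => r rn; apply: h; exists r.
Qed.

End PiecewiseTranslation.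

(** * Couplings from partial translations *)

(** The coupling predicate of the theorem over an abstract group; at [Hops F n] the two are
    convertible. *)
Definition coupling_to_Z (R : realType) (T : Type) (o : gops T) (phi : R -> R) : Prop :=
  exists (d : measure_display) (Om : measurableType d)
         (mu : {measure set Om -> \bar R})
         (act : T -> Om -> Om) (actZ : int -> Om -> Om)
         (XG XZ : set Om),
    standard_borel R Om /\
    Defs.is_action (gmul o) (gone o) (gmem o) act /\
    Defs.is_action (fun a b : int => a + b) 0 (fun _ => True) actZ /\
    free_action (gone o) (gmem o) act /\
    free_action 0 (fun _ : int => True) actZ /\
    measure_preserving_action mu (gmem o) act /\
    measure_preserving_action mu (fun _ : int => True) actZ /\
    (forall a l x, gmem o a -> act a (actZ l x) = actZ l (act a x)) /\
    fundamental_domain (gmem o) act XG /\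
    fundamental_domain (fun _ : int => True) actZ XZ /\
    (mu XG < +oo)%E /\ (mu XZ < +oo)%E /\
    (0 < mu XZ)%E /\
    (forall gamma, gmem o gamma ->
       exists c : Om -> int,
         (forall x, XZ x -> XZ (actZ (c x) (act gamma x))) /\
         exists cg : R, 0 < cg /\
           (\int[mu]_(x in XZ) (phi ((Num.norm (c x))%:~R / cg))%:E < +oo)%E).

(** If a fixes x and b brings x into X, then so does b a, and uniqueness gives b = b a. *)
Lemma fundamental_domain_free (d : measure_display) (Om : measurableType d)
    (T : Type) (o : gops T) (act : T -> Om -> Om) (X : set Om) :
  group_laws o -> Defs.is_action (gmul o) (gone o) (gmem o) act ->
  fundamental_domain (gmem o) act X -> free_action (gone o) (gmem o) act.
Proof.
move=> ol [act1 actM] [_ fX] a x ma ax; have [b [[mb Xb] ub]] := fX x.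
apply: (opgI ol (x := b)); rewrite (opg1 ol).
symmetry; apply: ub; split; first exact: (mem_mul ol).
by rewrite actM // ax.
Qed.

Section MovesCoupling.
Variables (R : realType) (T : Type) (o : gops T).
Hypothesis ol : group_laws o.
Variables (moves : T -> R -> R -> Prop) (G : set (measurableTypeR R)).
Variables (E : T -> nat -> set (measurableTypeR R)) (M : nat -> nat).
Hypothesis mG : measurable G.
Hypothesis G1 : lebesgue_measure (G `&` `[0%R, 1%R[) = 1%E.
Hypothesis G_shift : forall y (l : int), G y -> G (y + l%:~R).
Hypothesis G_ex : forall h y, G y -> gmem o h -> exists2 y', moves h y y' & G y'.
Hypothesis moves_uniq : forall h y y1 y2, moves h y y1 -> moves h y y2 -> y1 = y2.
Hypothesis moves_one : forall y, moves (gone o) y y.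
Hypothesis moves_mul : forall a b y y' y'',
  moves b y y' -> moves a y' y'' -> moves (gmul o a b) y y''.
Hypothesis moves_shift : forall h y y' (l : int),
  moves h y y' -> moves h (y + l%:~R) (y' + l%:~R).
Hypothesis moves_rat : forall h y y', moves h y y' -> exists r : rat, y' = y + ratr r.
Hypothesis moves_domain : forall y, G y -> exists! h, gmem o h /\
  exists2 y', moves h y y' & 0 <= y' < 1.
Hypothesis mmoves : forall h (r : rat),
  measurable ([set y | moves h y (y + ratr r)] : set (measurableTypeR R)).
Hypothesis mE : forall h k, measurable (E h k).
Hypothesis EM : forall h k y y', 0 <= y < 1 -> ~ E h k y -> moves h y y' ->
  (`|Num.floor y'| < M k)%N.
Hypothesis E_lim : forall h y, gmem o h -> G y -> exists k, ~ E h k y.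
Hypothesis E_le : forall h, gmem o h -> exists c : R, forall k,
  (lebesgue_measure (E h k) <= (c / 2 ^+ k)%:E)%E.
Variable phi : R -> R.
Hypothesis phi_ge0 : forall t, 0 <= t -> 0 <= phi t.
Hypothesis phi_nd : forall s t, 0 <= s -> s <= t -> phi s <= phi t.
Hypothesis phi_sum : forall c : R,
  (\sum_(0 <= k <oo) (`|c| / 2 ^+ k * phi (M k.+1)%:R)%:E < +oo)%E.

(** The unit interval within [G] serves as fundamental domain for both groups, so the cocycle is
    minus the integer part of the image point. *)
Lemma moves_coupling : coupling_to_Z o phi.
Proof.
have [y0 Gy0] : G !=set0.
  apply: contrapT => G0; move: G1; rewrite (_ : G `&` _ = set0).
    by rewrite measure0 => /eqP; rewrite eq_sym onee_eq0.
  by apply/seteqP; split => // y [Gy _]; apply: G0; exists y.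
have [d [Om [mu [v [v_inj vG mv mimv muE]]]]] := subtype_measure_space mG (ex_intro _ y0 Gy0).
have Gv w : G (v w) by apply/vG; exists w.
have exZ (l : int) : exists f : Om -> Om, forall w, v (f w) = v w + l%:~R.
  have ex w : exists w', v w' = v w + l%:~R by apply: (vG _).1; exact: G_shift.
  by have [f hf] := choice ex; exists f.
have [actZ vactZ] := choice exZ.
have exG h : exists f : Om -> Om, gmem o h -> forall w, moves h (v w) (v (f w)).
  have [mh|nh] := pselect (gmem o h); last by exists id.
  have ex w : exists w', moves h (v w) (v w').
    have [y' my' /vG[w' vw']] := G_ex (Gv w) mh.
    by exists w'; rewrite vw'.
  by have [f hf] := choice ex; exists f.
have [act vact] := choice exG.
pose X : set Om := [set w | 0 <= v w < 1].
have mX : measurable X.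
  rewrite (_ : X = setT `&` v @^-1` `[0%R, 1%R[); first exact: mv.
  by apply/seteqP; split => w; rewrite /X /= in_itv /= => // -[].
have muX : mu X = 1%E.
  rewrite muE -G1; congr lebesgue_measure; apply/seteqP; split => y /=.
    by move=> [w Xw <-]; rewrite in_itv; split.
  by rewrite in_itv => -[/vG[w <-] y01]; exists w.
have actA : Defs.is_action (gmul o) (gone o) (gmem o) act.
  split=> [w|a b ma mb w]; apply: v_inj.
    exact: moves_uniq (vact _ (mem_one ol) w) (moves_one _).
  apply: (moves_uniq (vact _ (mem_mul ol ma mb) w)).
  exact: moves_mul (vact _ mb w) (vact _ ma _).
have actZA : Defs.is_action (fun a b : int => a + b) 0 (fun _ => True) actZ.
  split=> [w|a b _ _ w]; apply: v_inj; first by rewrite vactZ addr0.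
  by rewrite !vactZ intrD -addrA [b%:~R + _]addrC.
have fG : fundamental_domain (gmem o) act X.
  split=> // w; have [h [[mh [y' my' y'01]] uh]] := moves_domain (Gv w).
  exists h; split; first by split => //; rewrite /X /= (moves_uniq (vact _ mh w) my').
  by move=> h' [mh' Xh']; apply: uh; split => //; exists (v (act h' w)) => //; exact: vact.
have fZ : fundamental_domain (fun _ : int => True) actZ X.
  split=> // w; exists (- Num.floor (v w)); split.
    split=> //; rewrite /X /= vactZ rmorphN /= subr_ge0.
    by have /andP[-> h2] := floor_itv (v w); rewrite ltrBlDl -intrD1.
  move=> l [_]; rewrite /X /= vactZ => h.
  have -> : Num.floor (v w) = - l; last by rewrite opprK.
  by apply: floor_def; rewrite intrD1 rmorphN /=; lra.
have mpZ : measure_preserving_action mu (fun _ : int => True) actZ.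
  move=> l _.
  have lK m : cancel (actZ m) (actZ (- m)).
    by move=> w; apply: v_inj; rewrite !vactZ rmorphN addrK.
  have lKV : cancel (actZ (- l)) (actZ l) by move=> w; rewrite -{1}[l]opprK lK.
  have lev (r : rat) : measurable [set w | v (actZ l w) = v w + ratr r].
    have [lr|lr] := eqVneq (l%:~R : R) (ratr r).
      rewrite (_ : [set w | _] = setT) //; apply/seteqP; split => w //= _.
      by rewrite vactZ lr.
    rewrite (_ : [set w | _] = set0) //; apply/seteqP; split => w //=.
    by rewrite vactZ => /addrI /eqP; rewrite (negbTE lr).
  have pc w : exists r : rat, v (actZ l w) = v w + ratr r.
    by exists l%:~R; rewrite vactZ ratr_int.
  split; first exact: (piecewise_translation_measurable v_inj mv mimv lev pc).
  move=> A mA.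
  exact: (piecewise_translation_preserves v_inj mv mimv muE (lK l) lKV lev pc).
have mp : measure_preserving_action mu (gmem o) act.
  move=> h mh.
  have hK : cancel (act h) (act (ginv o h)).
    by move=> w; rewrite -actA.2 ?(opVg ol) ?actA.1 //; exact: (mem_inv ol).
  have hKV : cancel (act (ginv o h)) (act h).
    by move=> w; rewrite -actA.2 ?(opgV ol) ?actA.1 //; exact: (mem_inv ol).
  have lev (r : rat) : measurable [set w | v (act h w) = v w + ratr r].
    rewrite (_ : [set w | _] = setT `&` v @^-1` [set y | moves h y (y + ratr r)]).
      exact: mv.
    apply/seteqP; split => w /=; first by move=> <-; split => //; exact: vact.
    by move=> [_ my]; exact: moves_uniq (vact _ mh w) my.
  have pc w : exists r : rat, v (act h w) = v w + ratr r.
    exact: moves_rat (vact _ mh w).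
  split; first exact: (piecewise_translation_measurable v_inj mv mimv lev pc).
  move=> A mA.
  exact: (piecewise_translation_preserves v_inj mv mimv muE hK hKV lev pc).
exists d, Om, mu, act, actZ, X, X.
split.
  exists v; split => //.
  rewrite (_ : range v = G) //; apply/seteqP; split => y; first by move=> [w _ <-].
  by move=> /vG[w <-]; exists w.
do 2 (split => //).
split; first exact: fundamental_domain_free ol actA fG.
split.
  move=> a w _ aw; have : v (actZ a w) = v w by rewrite aw.
  rewrite vactZ => /eqP; rewrite -subr_eq0 addrC addrA addNr add0r.
  by rewrite intr_eq0 => /eqP.
do 2 (split => //).
split.
  move=> a l w ma; apply: v_inj; rewrite vactZ.
  apply: (moves_uniq (vact _ ma (actZ l w))); rewrite vactZ.
  exact/moves_shift/vact.
do 2 (split => //).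
rewrite muX; do 3 (split; first by rewrite ?ltry ?lte01).
move=> gamma mg; pose c w := - Num.floor (v (act gamma w)).
have cX w : X (actZ (c w) (act gamma w)).
  rewrite /X /= vactZ /c rmorphN /= subr_ge0.
  by have /andP[-> h2] := floor_itv (v (act gamma w)); rewrite ltrBlDl -intrD1.
exists c; split; first by move=> w _; exact: cX.
exists 1; split => //.
pose Ek k : set Om := v @^-1` E gamma k `&` X.
have mEk k : measurable (Ek k).
  by apply: measurableI => //; rewrite -[X in measurable X]setTI; exact: mv.
have [c0 hc0] := E_le mg.
have muEk k : (mu (Ek k `&` X) <= (c0 / 2 ^+ k)%:E)%E.
  rewrite muE; apply: le_trans (hc0 k); apply: le_measure; rewrite ?inE //.
    by apply: mimv; exact: measurableI.
  by move=> y [w [[Ew _] _] <-].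
have M_ge0 k : 0 <= phi (M k)%:R by rewrite phi_ge0.
(* Take the least level k at which w is not exceptional. If k = 0 the first term bounds the cocycle;
   otherwise w is exceptional at level k - 1, whose term in the series is phi (M k). *)
have bnd w : X w -> ((phi (Num.norm (c w))%:~R)%:E <= (phi (M 0)%:R)%:E +
    \sum_(0 <= k <oo) ((phi (M k.+1)%:R)%:E * (\1_(Ek k) w)%:E))%E.
  move=> Xw; have term_ge0 k : (0 <= (phi (M k.+1)%:R)%:E * (\1_(Ek k) w)%:E :> \bar R)%E.
    by rewrite -EFinM lee_fin mulr_ge0 // indicE.
  have cM k : ~ E gamma k (v w) -> phi (Num.norm (c w))%:~R <= phi (M k)%:R.
    move=> /(EM Xw)/(_ (vact _ mg w)) fl; apply: phi_nd; first by rewrite ler0z.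
    by rewrite /c normrN pmulrn ler_int -abszE lez_nat ltnW.
  have [[|k] nE kmin] : exists2 k, ~ E gamma k (v w) &
      forall j, (j < k)%N -> E gamma j (v w).
    have [k0 nE0] := E_lim mg (Gv w).
    have ex : exists k, `[< ~ E gamma k (v w) >] by exists k0; exact/asboolP.
    case: (ex_minnP ex) => k /asboolP nE kmin; exists k => // j jk.
    by apply: contrapT => /asboolP /kmin; rewrite leqNgt jk.
  - by apply: (@le_trans _ _ (phi (M 0)%:R)%:E); [rewrite lee_fin cM|rewrite leeDl // nneseries_ge0].
  - apply: (@le_trans _ _ (\sum_(0 <= k <oo) ((phi (M k.+1)%:R)%:E * (\1_(Ek k) w)%:E))%E).
      apply: (@le_trans _ _ (\sum_(0 <= j < k.+1) ((phi (M j.+1)%:R)%:E * (\1_(Ek j) w)%:E))%E).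
        rewrite big_nat_recr //=.
        rewrite -[leLHS]add0e; apply: leeD; first by apply: sume_ge0.
        rewrite indicE mem_set ?mule1 ?lee_fin; first exact: cM.
        by split => //; exact: kmin.
      by apply: nneseries_lim_ge.
    by rewrite leeDr // lee_fin.
have mc l : measurable (X `&` c @^-1` [set l]).
  rewrite (_ : _ `&` _ = X `&` act gamma @^-1` (actZ l @^-1` X)).
    apply: measurableI => //; rewrite -[X in measurable X]setTI.
    apply: (mp _ mg).1 => //; rewrite -[X in measurable X]setTI.
    exact: (mpZ l I).1.
  apply/seteqP; split => w [Xw /= h]; split => //; first by rewrite -h; exact: cX.
  by have [k [_ uk]] := fZ.2 (act gamma w); rewrite -(uk l) // -(uk (c w)) //; split => //; exact: cX.
have mterm k : measurable_fun X
    (fun w => (phi (M k.+1)%:R)%:E * (\1_(Ek k) w)%:E : \bar R)%E.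
  by apply: measurable_funeM; apply/measurable_EFinP; exact: measurable_indic.
have term0 k w : (0 <= (phi (M k.+1)%:R)%:E * (\1_(Ek k) w)%:E :> \bar R)%E.
  by rewrite -EFinM lee_fin mulr_ge0 // indicE.
have ms : measurable_fun X (fun w => \sum_(0 <= k <oo)
    ((phi (M k.+1)%:R)%:E * (\1_(Ek k) w)%:E) : \bar R)%E.
  apply: ge0_emeasurable_sum => k; last by move=> _; exact: mterm.
  by move=> w _ _; exact: term0.
apply: (@le_lt_trans _ _ (\int[mu]_(w in X) ((phi (M 0)%:R)%:E +
    \sum_(0 <= k <oo) ((phi (M k.+1)%:R)%:E * (\1_(Ek k) w)%:E)))%E).
  apply: ge0_le_integral => //.
  - by move=> w Xw; rewrite lee_fin phi_ge0 // divr1 ler0z.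
  - apply/measurable_EFinP.
    exact: (@measurable_fun_levels _ _ _ X c (fun l => phi ((Num.norm l)%:~R / 1))).
  - exact: emeasurable_funD.
  - by move=> w Xw; rewrite divr1; exact: bnd.
rewrite ge0_integralD //; last by move=> w _; exact: nneseries_ge0.
  2: by move=> w _; rewrite lee_fin.
rewrite integral_cst // muX mule1 integral_nneseries //.
apply: lte_add_pinfty; first exact: ltry.
apply: le_lt_trans (phi_sum c0); apply: lee_nneseries => k _.
  by move=> _; apply: integral_ge0 => w _; exact: term0.
rewrite ge0_integralZl_EFin //; last by apply/measurable_EFinP; exact: measurable_indic.
rewrite (integral_indic mu mX (mEk k)) mulrC EFinM lee_wpmul2l ?lee_fin //.
apply: le_trans (muEk k) _; rewrite lee_fin ler_pM2r ?invr_gt0 ?exprn_gt0 //.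
exact: ler_norm.
Qed.

End MovesCoupling.

Local Open Scope ring_scope.

(** * The odometer action on the line *)

Section Odometer.
Variables (R : realType) (T : Type) (o : gops T).
Hypothesis ol : group_laws o.
Variables (N q : nat -> nat) (s u : nat -> nat -> T) (z : nat -> nat -> nat).
Hypothesis N_gt0 : forall k, (0 < N k)%N.
Hypothesis NS : forall k, N k.+1 = (N k * q k)%N.
Hypothesis uS : forall k i, u k.+1 i = gmul o (s k (i %% q k)) (u k (i %/ q k)).
Hypothesis zS : forall k i, z k.+1 i = (z k (i %/ q k) + N k * (i %% q k))%N.
Hypothesis u_mem : forall k i, (i < N k)%N -> gmem o (u k i).
Hypothesis u_inj : forall k i j, (i < N k)%N -> (j < N k)%N -> u k i = u k j -> i = j.
Hypothesis z_lt : forall k i, (i < N k)%N -> (z k i < N k)%N.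
Hypothesis z_inj : forall k i j, (i < N k)%N -> (j < N k)%N -> z k i = z k j -> i = j.
Implicit Types (y : R) (k i j : nat).

Let q_gt0 k : (0 < q k)%N.
Proof. by have := N_gt0 k.+1; rewrite NS muln_gt0 => /andP[]. Qed.

Let N_gt0R k : 0 < (N k)%:R :> R. Proof. by rewrite ltr0n. Qed.

Definition frac y : R := y - (Num.floor y)%:~R.

Lemma frac_itv y : 0 <= frac y < 1.
Proof.
have /andP[h1 h2] := floor_itv y; rewrite /frac subr_ge0 h1 /=.
by rewrite ltrBlDl -intrD1.
Qed.

Lemma floor_frac y f (l : int) : 0 <= f < 1 -> y = f + l%:~R -> Num.floor y = l.
Proof.
move=> /andP[f0 f1] ->; apply: floor_def.
by rewrite lerDr f0 intrD1 addrC ltrD2l.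
Qed.

Lemma frac_floor y f (l : int) : 0 <= f < 1 -> y = f + l%:~R -> frac y = f.
Proof. by move=> f01 yE; rewrite /frac (floor_frac f01 yE) yE addrK. Qed.

Lemma fracK y : y = frac y + (Num.floor y)%:~R.
Proof. by rewrite subrK. Qed.

Lemma frac_shift y (l : int) : frac (y + l%:~R) = frac y.
Proof.
apply: (@frac_floor _ _ (Num.floor y + l)); first exact: frac_itv.
by rewrite intrD addrA -fracK.
Qed.

Definition idx k y : nat := Num.truncn (frac y * (N k)%:R).

Let fracN_ge0 k y : 0 <= frac y * (N k)%:R.
Proof. by rewrite mulr_ge0 //; case/andP: (frac_itv y). Qed.

Lemma idx_itv k y : (idx k y)%:R <= frac y * (N k)%:R < (idx k y).+1%:R.
Proof. exact: truncn_itv. Qed.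

Lemma idxP k y i : i%:R <= frac y * (N k)%:R < i.+1%:R -> idx k y = i.
Proof. exact: truncn_def. Qed.

Lemma idx_lt k y : (idx k y < N k)%N.
Proof.
rewrite truncn_lt_nat // -[ltRHS]mul1r ltr_pM2r //.
by case/andP: (frac_itv y).
Qed.

Lemma idx_shift k y (l : int) : idx k (y + l%:~R) = idx k y.
Proof. by rewrite /idx frac_shift. Qed.

Lemma idx_up k y : (idx k.+1 y %/ q k)%N = idx k y.
Proof.
symmetry; apply: idxP; have := idx_itv k.+1 y; rewrite NS natrM mulrA.
set f := frac y * _; set i := idx _ _ => /andP[h1 h2].
have q0 : 0 < (q k)%:R :> R by rewrite ltr0n.
apply/andP; split.
  rewrite -(ler_pM2r q0); apply: le_trans h1; rewrite -natrM ler_nat.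
  exact: leq_trunc_div.
rewrite -(ltr_pM2r q0); apply: lt_le_trans h2 _; rewrite -natrM ler_nat.
by rewrite -ltn_divLR.
Qed.

(** Translation from the i-th to the j-th interval of the circle, with the integer part adjusted so
    that the floor plus the position [z k] is conserved, as [floor_target] shows. *)
Definition disp k i j : R := (j%:R - i%:R) / (N k)%:R - (z k j)%:R + (z k i)%:R.

Definition target k y j : R := y + disp k (idx k y) j.

Let target_frac k y j : (j < N k)%N ->
  let f := frac y + (j%:R - (idx k y)%:R) / (N k)%:R in
  0 <= f < 1 /\ j%:R <= f * (N k)%:R < j.+1%:R.
Proof.
move=> jN f; have N0 := N_gt0R k; have Nn0 : (N k)%:R != 0 :> R by rewrite gt_eqF.
have fN : f * (N k)%:R = frac y * (N k)%:R + j%:R - (idx k y)%:R.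
  by rewrite /f; field.
have := idx_itv k y; rewrite -natr1 => /andP[h1 h2].
have hj : j%:R <= f * (N k)%:R < j.+1%:R by rewrite fN -natr1; lra.
split=> //; case/andP: hj => j1 j2; apply/andP; split.
  by rewrite -(pmulr_lge0 _ N0) (le_trans _ j1).
by rewrite -(ltr_pM2r N0) mul1r; apply: lt_le_trans j2 _; rewrite ler_nat.
Qed.

Let targetE k y j : target k y j = frac y + (j%:R - (idx k y)%:R) / (N k)%:R +
  (Num.floor y - (z k j)%:Z + (z k (idx k y))%:Z)%:~R.
Proof.
rewrite /target /disp intrD intrB -!pmulrn.
by have := fracK y; set f := frac y; set X := (_ / _); lra.
Qed.

Lemma idx_target k y j : (j < N k)%N -> idx k (target k y j) = j.
Proof.
move=> /(@target_frac k y)[f01 fj]; apply: idxP.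
by rewrite (frac_floor f01 (targetE k y j)).
Qed.

Lemma floor_target k y j : (j < N k)%N ->
  Num.floor (target k y j) = Num.floor y - (z k j)%:Z + (z k (idx k y))%:Z.
Proof.
by move=> /(@target_frac k y)[f01 _]; exact: floor_frac f01 (targetE k y j).
Qed.

Lemma target_shift k y j (l : int) : target k (y + l%:~R) j = target k y j + l%:~R.
Proof. by rewrite /target idx_shift addrAC. Qed.

Lemma target_target k y j j' : (j < N k)%N ->
  target k (target k y j) j' = target k y j'.
Proof.
move=> jN; rewrite /target [idx k (y + _)](idx_target y jN) /disp.
have Nn0 : (N k)%:R != 0 :> R by rewrite gt_eqF.
by field.
Qed.

Lemma target_id k y : target k y (idx k y) = y.
Proof. by rewrite /target /disp subrr mul0r sub0r addNr addr0. Qed.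

(* The index of [y] at the next level and the index [up k y j] differ only in
   their first digit, the group elements they name by a common left factor. *)
Definition up k y j : nat := (j * q k + idx k.+1 y %% q k)%N.

Lemma up_lt k y j : (j < N k)%N -> (up k y j < N k.+1)%N.
Proof.
move=> jN; rewrite NS; apply: (@leq_trans (j.+1 * q k)).
  by rewrite /up mulSn addnC ltn_add2r ltn_mod.
by rewrite leq_mul2r jN orbT.
Qed.

Let up_div k y j : (up k y j %/ q k = j)%N.
Proof. by rewrite /up divnMDl // divn_small ?addn0 // ltn_mod. Qed.

Let up_mod k y j : (up k y j %% q k = idx k.+1 y %% q k)%N.
Proof. by rewrite /up modnMDl modn_mod. Qed.

Lemma up_u k y j : exists g, u k.+1 (idx k.+1 y) = gmul o g (u k (idx k y)) /\
  u k.+1 (up k y j) = gmul o g (u k j).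
Proof.
by exists (s k (idx k.+1 y %% q k)); rewrite !uS up_div up_mod idx_up.
Qed.

Lemma up_z k y j : ((z k.+1 (up k y j))%:Z - (z k.+1 (idx k.+1 y))%:Z =
  (z k j)%:Z - (z k (idx k y))%:Z)%R.
Proof. by rewrite !zS up_div up_mod idx_up; lia. Qed.

(** The index difference is multiplied by [q k] and so is [N k], while the digit shared by both
    indices cancels from the difference of positions. *)
Lemma target_up k y j : target k.+1 y (up k y j) = target k y j.
Proof.
rewrite /target; congr (_ + _); rewrite /disp.
have zz : (z k.+1 (up k y j))%:R - (z k.+1 (idx k.+1 y))%:R =
    (z k j)%:R - (z k (idx k y))%:R :> R.
  by have := congr1 (fun x : int => x%:~R : R) (up_z k y j); rewrite !rmorphB /= -!pmulrn.
have ii : (up k y j)%:R - (idx k.+1 y)%:R = (j%:R - (idx k y)%:R) * (q k)%:R :> R.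
  rewrite [in X in _ - X](divn_eq (idx k.+1 y) (q k)) idx_up /up !natrD !natrM.
  by ring.
rewrite ii NS natrM.
have q0 : (q k)%:R != 0 :> R by rewrite pnatr_eq0 -lt0n.
have -> : (j%:R - (idx k y)%:R) * (q k)%:R / ((N k)%:R * (q k)%:R) =
    (j%:R - (idx k y)%:R) / (N k)%:R :> R.
  by rewrite -mulf_div divff // mulr1.
by move: zz; lra.
Qed.

(** The element h sends the index of u to that of u times the inverse of h, so that right
    multiplication becomes a left action. *)
Definition match_at (h : T) k y j : Prop :=
  (j < N k)%N /\ u k (idx k y) = gmul o (u k j) h.

Definition zmatch_at (a : int) k y j : Prop :=
  (j < N k)%N /\ ((z k j)%:Z = (z k (idx k y))%:Z + a)%R.

Lemma match_up h k y j m : (k <= m)%N -> match_at h k y j ->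
  exists j', match_at h m y j' /\ target m y j' = target k y j.
Proof.
move=> km mj; rewrite -(subnK km); elim: (m - k)%N => [|l [j' [[j'N uj'] tj']]].
  by exists j.
exists (up (l + k) y j'); rewrite addSn target_up; split => //.
split; first exact: up_lt.
by have [g [-> ->]] := up_u (l + k) y j'; rewrite uj' (opA ol).
Qed.

Lemma zmatch_up a k y j m : (k <= m)%N -> zmatch_at a k y j ->
  exists j', zmatch_at a m y j'.
Proof.
move=> km mj; rewrite -(subnK km); elim: (m - k)%N => [|l [j' [j'N zj']]].
  by exists j.
exists (up (l + k) y j'); rewrite addSn; split; first exact: up_lt.
by have := up_z (l + k) y j'; move: zj'; lia.
Qed.

Definition moves (h : T) y y' : Prop := exists k j, match_at h k y j /\ y' = target k y j.

(** A move persists at all later levels, so any two moves can be compared at a common level. *)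
Lemma moves_at h y y' : moves h y y' -> exists k, forall m, (k <= m)%N ->
  exists j, match_at h m y j /\ y' = target m y j.
Proof.
move=> [k [j [mj ->]]]; exists k => m /match_up/(_ mj)[j' [mj' <-]].
by exists j'.
Qed.

Lemma match_uniq h k y j j' : match_at h k y j -> match_at h k y j' -> j = j'.
Proof.
move=> [jN uj] [j'N]; rewrite uj => /(opIg ol); exact: u_inj.
Qed.

Lemma moves_uniq h y y1 y2 : moves h y y1 -> moves h y y2 -> y1 = y2.
Proof.
move=> /moves_at[k1 h1] /moves_at[k2 h2].
have [j1 [m1 ->]] := h1 _ (leq_maxl k1 k2); have [j2 [m2 ->]] := h2 _ (leq_maxr k1 k2).
by rewrite (match_uniq m1 m2).
Qed.

Lemma moves_one y : moves (gone o) y y.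
Proof.
exists 0%N, (idx 0 y); rewrite target_id; split => //.
by split; [exact: idx_lt|rewrite (opg1 ol)].
Qed.

Lemma moves_mul a b y y' y'' : moves b y y' -> moves a y' y'' -> moves (gmul o a b) y y''.
Proof.
move=> /moves_at[k1 h1] /moves_at[k2 h2].
have [j1 [[j1N u1] e1]] := h1 _ (leq_maxl k1 k2).
have [j2 [[j2N u2] e2]] := h2 _ (leq_maxr k1 k2).
exists (maxn k1 k2), j2; split; last by rewrite e2 e1 target_target.
split => //; rewrite u1; move: u2; rewrite e1 idx_target // => ->.
by rewrite (opA ol).
Qed.

Lemma moves_shift h y y' (l : int) : moves h y y' -> moves h (y + l%:~R) (y' + l%:~R).
Proof.
move=> [k [j [[jN uj] ->]]]; exists k, j; rewrite target_shift; split => //.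
by split => //; rewrite idx_shift.
Qed.

Lemma moves_rat h y y' : moves h y y' -> exists r : rat, y' = y + ratr r.
Proof.
move=> [k [j [_ ->]]]; set i := idx k y.
exists ((j%:R - i%:R) / (N k)%:R - (z k j)%:R + (z k i)%:R).
rewrite /target /disp -/i.
by rewrite rmorphD rmorphB fmorph_div rmorphB /= !ratr_nat; reflexivity.
Qed.

(** The first half makes every group element act at y; the second is what brings the orbit of y into
    the unit interval. *)
Definition good y : Prop :=
  (forall h, gmem o h -> exists k j, match_at h k y j) /\
  (forall a, exists k j, zmatch_at a k y j).

Lemma good_shift y (l : int) : good y -> good (y + l%:~R).
Proof.
move=> [g1 g2]; split.
  move=> h /g1[k [j [jN uj]]]; exists k, j; split => //; by rewrite idx_shift.
by move=> a; have [k [j [jN zj]]] := g2 a; exists k, j; split; rewrite ?idx_shift.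
Qed.

Lemma good_moves h y y' : gmem o h -> moves h y y' -> good y -> good y'.
Proof.
move=> mh /moves_at[k1 h1] [g1 g2]; split.
  move=> g mg; have [k2 [j2 m2]] := g1 _ (mem_mul ol mg mh).
  have [j1 [[j1N u1] e1]] := h1 _ (leq_maxl k1 k2).
  have [j3 [[j3N u3] _]] := match_up (leq_maxr k1 k2) m2.
  exists (maxn k1 k2), j3; split => //; rewrite e1 idx_target //.
  by apply: (opIg ol (x := h)); rewrite /= -u1 u3 (opA ol).
move=> a; have [j0 [[j0N _] e0]] := h1 _ (leqnn k1).
(* The change of position from y to y'. By conservation it is minus the change of the floor, hence
   the same at every level, and a shift by a from y' is a shift by a + b from y. *)
pose b : int := (z k1 j0)%:Z - (z k1 (idx k1 y))%:Z.
have [k2 [j2 m2]] := g2 (a + b).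
have mb : zmatch_at b k1 y j0 by split => //; rewrite /b addrC subrK.
have [j1 [[j1N u1] e1]] := h1 _ (leq_maxl k1 k2).
have [j3 [j3N z3]] := zmatch_up (leq_maxr k1 k2) m2.
exists (maxn k1 k2), j3; split => //; rewrite e1 idx_target // z3.
have fl := floor_target y j1N; have fl0 := floor_target y j0N.
by move: fl fl0; rewrite -e1 -e0 /b => ->; lia.
Qed.

Lemma good_exists h y : good y -> gmem o h -> exists2 y', moves h y y' & good y'.
Proof.
move=> gy mh; have [k [j mj]] := gy.1 h mh.
have my : moves h y (target k y j) by exists k, j.
by exists (target k y j) => //; exact: good_moves my gy.
Qed.

Lemma floor_eq0 y : Num.floor y = 0 <-> 0 <= y < 1.
Proof.
split=> [f0|y01]; first by have := floor_itv y; rewrite f0.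
by apply: floor_def; rewrite add0r.
Qed.

(** By conservation, landing in the unit interval means landing at an index whose position is that
    of y plus its floor. Such an index is unique by injectivity of [z], and it determines h. *)
Lemma moves_domain y : good y -> exists! h, gmem o h /\
  exists2 y', moves h y y' & 0 <= y' < 1.
Proof.
move=> [_ g2]; have [k [j [jN zj]]] := g2 (Num.floor y).
pose h := gmul o (ginv o (u k j)) (u k (idx k y)).
have mj : match_at h k y j by split => //; rewrite (opKVg ol).
have fj : Num.floor (target k y j) = 0 by rewrite floor_target // zj; lia.
exists h; split.
  split; first by apply: (mem_mul ol); [apply: (mem_inv ol)|]; apply: u_mem => //; exact: idx_lt.
  by exists (target k y j); [exists k, j|apply/floor_eq0].
move=> h' [_ [y' /moves_at[k1 h1] /floor_eq0 y'0]].
have [j1 [m1 e1]] := h1 _ (leq_maxr k k1).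
have [j4 [m4 e4]] := match_up (leq_maxl k k1) mj.
set m := maxn k k1 in m1 m4 e1 e4.
have j14 : j1 = j4.
  apply: (z_inj m1.1 m4.1).
  have f1 := floor_target y m1.1; have f4 := floor_target y m4.1.
  by move: f1 f4; rewrite -e1 e4 y'0 fj; lia.
by have := m1.2; rewrite m4.2 j14 => /(opgI ol).
Qed.

Local Open Scope classical_set_scope.

Lemma measurable_idx k i : measurable ([set y | idx k y = i] : set (measurableTypeR R)).
Proof.
have [iN|iN] := boolP (i < N k)%N; last first.
  rewrite (_ : [set y | _] = set0)//; apply/seteqP; split => // y /= yi.
  by move: iN; rewrite -yi idx_lt.
rewrite (_ : [set y | _] = \bigcup_(l in [set: int])
   `[l%:~R + i%:R / (N k)%:R, l%:~R + i.+1%:R / (N k)%:R[%classic).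
  apply: countable_bigcupT_measurable; first exact: countableP.
  by move=> l; exact: measurable_itv.
have N0 := N_gt0R k.
apply/seteqP; split => y /=.
  move=> yi; exists (Num.floor y) => //=; rewrite in_itv /=.
  have := idx_itv k y; rewrite yi -ler_pdivrMr // -ltr_pdivlMr //.
  by have := fracK y; set a := _ / _; set b := _ / _; lra.
move=> [l _ /=]; rewrite in_itv /= => /andP[h1 h2].
have fy : frac y = y - l%:~R.
  apply: (@frac_floor _ _ l); last by rewrite subrK.
  apply/andP; split.
    by rewrite subr_ge0; apply: le_trans h1; rewrite lerDl divr_ge0.
  rewrite ltrBlDl; apply: lt_le_trans h2 _; rewrite lerD2l ler_pdivrMr // mul1r.
  by rewrite ler_nat.
apply: idxP; rewrite fy -ler_pdivrMr // lerBrDl h1 /=.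
by rewrite -ltr_pdivlMr // ltrBlDl.
Qed.

Lemma measurable_idx_ex (Q : nat -> nat -> Prop) :
  measurable ([set y | exists k, Q k (idx k y)] : set (measurableTypeR R)).
Proof.
rewrite (_ : [set y | _] = \bigcup_k \bigcup_i [set y | Q k i /\ idx k y = i]).
  apply: bigcup_measurable => k _; apply: bigcup_measurable => i _.
  have [Qi|nQ] := pselect (Q k i).
    rewrite (_ : [set y | _] = [set y | idx k y = i]); first exact: measurable_idx.
    by apply/seteqP; split => y /= [].
  by rewrite (_ : [set y | _] = set0)//; apply/seteqP; split => y // [].
apply/seteqP; split => y /=; first by move=> [k Qk]; exists k => //; exists (idx k y).
by move=> [k _ [i _ [Qi yi]]]; exists k; rewrite yi.
Qed.

Variable e : nat -> T.
Hypothesis e_mem : forall n, gmem o (e n).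
Hypothesis e_surj : forall h, gmem o h -> exists n, e n = h.

Let okG h : set (measurableTypeR R) := [set y | exists k, exists j, match_at h k y j].
Let okZ a : set (measurableTypeR R) := [set y | exists k, exists j, zmatch_at a k y j].

Let mokG h : measurable (okG h).
Proof.
exact: (measurable_idx_ex
  (fun k i => exists j, (j < N k)%N /\ u k i = gmul o (u k j) h)).
Qed.

Let mokZ a : measurable (okZ a).
Proof.
exact: (measurable_idx_ex
  (fun k i => exists j, (j < N k)%N /\ ((z k j)%:Z = (z k i)%:Z + a)%R)).
Qed.

Definition goods : set (measurableTypeR R) := [set y | good y].

Let goodsE : goods = ~` (\bigcup_n ~` okG (e n) `|` \bigcup_(a in [set: int]) ~` okZ a).
Proof.
apply/seteqP; split => y /=.
  move=> [g1 g2] [[n _]|[a _]]; first by move=> h; exact/h/g1.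
  by move=> h; exact/h/g2.
move=> h; split.
  move=> g /e_surj[n <-]; apply: contrapT => ng; apply: h; left; exists n => //.
by move=> a; apply: contrapT => ng; apply: h; right; exists a.
Qed.

Lemma measurable_goods : measurable goods.
Proof.
rewrite goodsE; apply: measurableC; apply: measurableU.
  by apply: bigcup_measurable => n _; exact: measurableC.
apply: countable_bigcupT_measurable; first exact: countableP.
by move=> a; exact: measurableC.
Qed.

(** Each index contributes an interval of length 1 / [N k]. *)
Lemma cylinder_le k (P : nat -> Prop) :
  (lebesgue_measure ([set y | (0 <= y < 1)%R /\ P (idx k y)] : set (measurableTypeR R)) <=
   ((\sum_(i < N k) `[< P i >])%N%:R / (N k)%:R)%:E)%E.
Proof.
have mI : measurable (`[0, 1[%classic : set (measurableTypeR R)).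
  exact: measurable_itv.
pose A n : set (measurableTypeR R) :=
  [set y | (0 <= y < 1)%R /\ ((idx k y < n)%N /\ P (idx k y))].
have mA n : measurable (A n).
  rewrite (_ : A n = `[0, 1[ `&` \bigcup_i [set y | ((i < n)%N /\ P i) /\ idx k y = i]).
    apply: measurableI => //; apply: bigcup_measurable => i _.
    have [Qi|nQ] := pselect ((i < n)%N /\ P i).
      rewrite (_ : [set y | _] = [set y | idx k y = i]); first exact: measurable_idx.
      by apply/seteqP; split => y /= [].
    by rewrite (_ : [set y | _] = set0)//; apply/seteqP; split => y // [].
  apply/seteqP; split => y /=; rewrite in_itv /=.
    by move=> [y01 h]; split => //; exists (idx k y).
  by move=> [y01 [i _ [h yi]]]; split => //; rewrite yi.
have N0 := N_gt0R k.
have AE n : (lebesgue_measure (A n) <= ((\sum_(i < n) `[< P i >])%N%:R / (N k)%:R)%:E)%E.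
  elim: n => [|n IH].
    rewrite (_ : A 0%N = set0) ?measure0 ?lee_fin ?big_ord0 ?mul0r //.
    by apply/seteqP; split => y // [_ []].
  pose I : set (measurableTypeR R) :=
    if `[< P n >] then `[n%:R / (N k)%:R, n.+1%:R / (N k)%:R[%classic else set0.
  have mI' : measurable I by rewrite /I; case: ifP => // _; exact: measurable_itv.
  apply: (@le_trans _ _ (lebesgue_measure (A n `|` I))).
    apply: le_measure; rewrite ?inE //; first exact: measurableU.
    move=> y [y01 []]; rewrite ltnS leq_eqVlt => /orP[/eqP yn Py|yn Py]; last by left.
    right; rewrite /I -yn asboolT //= in_itv /=.
    have := idx_itv k y; rewrite (_ : frac y = y).
      by move=> /andP[h1 h2]; rewrite ler_pdivrMr // h1 ltr_pdivlMr.
    by apply: (@frac_floor _ _ 0) => //; rewrite addr0.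
  apply: le_trans (measureU2 _ (mA n) mI') _.
  rewrite big_ord_recr /= natrD mulrDl EFinD leeD // /I.
  case: ifP => _; last by rewrite measure0 lee_fin mul0r.
  rewrite lebesgue_measure_itv /= lte_fin ltr_pM2r ?invr_gt0 // ltr_nat ltnSn.
  by rewrite -EFinB lee_fin -mulrBl -natrB // subSnn.
apply: le_trans (AE (N k)); apply: le_measure; rewrite ?inE //.
  rewrite (_ : [set y | _] = A (N k)) //; apply/seteqP; split => y /=.
    by move=> [y01 Py]; split => //; rewrite idx_lt.
  by move=> [y01 [_ Py]].
by move=> y [y01 Py]; split => //; split => //; exact: idx_lt.
Qed.

Hypothesis bad_u : forall g, gmem o g -> exists c : nat, forall k,
  (2 ^ k * \sum_(i < N k)
     `[< ~ exists2 j, (j < N k)%N & u k j = gmul o (u k i) g >] <= c * N k)%N.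
Hypothesis bad_z : forall k (a : int), (\sum_(i < N k)
  `[< ~ exists2 j, (j < N k)%N & ((z k j)%:Z = (z k i)%:Z + a)%R >] <= `|a|)%N.
Hypothesis N_ge : forall k, (2 ^ k <= N k)%N.

Definition unmatched h k : set (measurableTypeR R) :=
  [set y | (0 <= y < 1)%R /\ ~ exists j, match_at h k y j].

(** An index has no partner under h exactly when right multiplication by the inverse of h leaves the
    Følner set. *)
Lemma unmatched_le h : gmem o h -> exists c : R, forall k,
  (lebesgue_measure (unmatched h k) <= (c / 2 ^+ k)%:E)%E.
Proof.
move=> mh; have [c hc] := bad_u (mem_inv ol mh); exists c%:R => k.
apply: le_trans (cylinder_le k
  (fun i => ~ exists j, (j < N k)%N /\ u k i = gmul o (u k j) h)) _.
rewrite lee_fin ler_pdivlMr ?exprn_gt0 // mulrAC ler_pdivrMr // -natrX -!natrM ler_nat.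
apply: leq_trans (hc k); rewrite mulnC leq_mul2l; apply/orP; right.
apply: leq_sum => i _; rewrite [X in (nat_of_bool X <= _)%N]
  (asbool_equiv_eq (Q := ~ exists2 j, (j < N k)%N & u k j = gmul o (u k i) (ginv o h))) //.
split=> nj.
  by move=> [j jN uj]; apply: nj; exists j; rewrite uj (opgKV ol).
by move=> [j [jN uj]]; apply: nj; exists j => //; rewrite uj (opgK ol).
Qed.

Let null_of_le (A : set (measurableTypeR R)) (B : nat -> set (measurableTypeR R)) (c : R) :
  measurable A -> (forall k, measurable (B k)) -> (forall k, A `<=` B k) ->
  (forall k, (lebesgue_measure (B k) <= (c / 2 ^+ k)%:E)%E) ->
  lebesgue_measure A = 0%E.
Proof.
move=> mA mB AB hB; apply/eqP; rewrite eq_le measure_ge0 andbT.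
apply/lee_addgt0Pr => eps eps0; rewrite add0e.
pose k := (Num.truncn (`|c| / eps)).+1.
apply: (@le_trans _ _ (c / 2 ^+ k)%:E).
  by apply: le_trans (hB k); apply: le_measure; rewrite ?inE.
rewrite lee_fin ler_pdivrMr ?exprn_gt0 // mulrC; apply: le_trans (ler_norm _) _.
rewrite -ler_pdivrMr //; apply: le_trans (ltW (truncnS_gt _)) _.
by rewrite -natrX ler_nat ltnW // ltn_expl.
Qed.

Lemma measurable_unmatched h k : measurable (unmatched h k).
Proof.
rewrite (_ : unmatched h k = `[0, 1[ `&` ~` \bigcup_i
    [set y | (exists j, (j < N k)%N /\ u k i = gmul o (u k j) h) /\ idx k y = i]).
  apply: measurableI; first exact: measurable_itv.
  apply: measurableC; apply: bigcup_measurable => i _.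
  have [Qi|nQ] := pselect (exists j, (j < N k)%N /\ u k i = gmul o (u k j) h).
    rewrite (_ : [set y | _] = [set y | idx k y = i]); first exact: measurable_idx.
    by apply/seteqP; split => y /= [].
  by rewrite (_ : [set y | _] = set0)//; apply/seteqP; split => y // [].
apply/seteqP; split => y /=; rewrite in_itv /=.
  by move=> [y01 nj]; split => // -[i _ [[j mj] yi]]; apply: nj; exists j; rewrite /match_at yi.
by move=> [y01 h1]; split => // -[j mj]; apply: h1; exists (idx k y) => //; split => //; exists j.
Qed.

Let unitI : set (measurableTypeR R) := `[0%R, 1%R[.
Let munit : measurable unitI. Proof. exact: measurable_itv. Qed.

Let nullG h : gmem o h -> lebesgue_measure (unitI `\` okG h) = 0%E.
Proof.
move=> mh; have [c hc] := unmatched_le mh.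
apply: (null_of_le (B := unmatched h) (c := c)) hc.
- by apply: measurableD.
- by move=> k; exact: measurable_unmatched.
- move=> k y [+ ny]; rewrite /unitI /= in_itv /= => y01; split => // -[j mj].
  by apply: ny; exists k, j.
Qed.

(** At level k a shift by a fails at no more than |a| of at least 2 ^ k indices. *)
Let nullZ a : lebesgue_measure (unitI `\` okZ a) = 0%E.
Proof.
pose B k : set (measurableTypeR R) := [set y | (0 <= y < 1)%R /\
  ~ exists2 j, (j < N k)%N & ((z k j)%:Z = (z k (idx k y))%:Z + a)%R].
have mB k : measurable (B k).
  pose P i := exists2 j, (j < N k)%N & ((z k j)%:Z = (z k i)%:Z + a)%R.
  rewrite (_ : B k = unitI `&` ~` [set y | P (idx k y)]).
    apply: measurableI => //; apply: measurableC.
    rewrite (_ : [set y | _] = [set y | exists l, l = k /\ P (idx l y)]).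
      exact: (measurable_idx_ex (fun l i => l = k /\ P i)).
    apply/seteqP; split => y /=; first by exists k.
    by move=> [l [-> ]].
  by apply/seteqP; split => y; rewrite /unitI /= in_itv.
apply: (null_of_le (B := B) (c := `|a|%N%:R)) => //.
- exact: measurableD.
- move=> k y [+ ny]; rewrite /unitI /= in_itv /= => y01; split => // -[j jN zj].
  by apply: ny; exists k, j.
- move=> k; apply: le_trans (cylinder_le k
    (fun i => ~ exists2 j, (j < N k)%N & ((z k j)%:Z = (z k i)%:Z + a)%R)) _.
  rewrite lee_fin; apply: ler_pM; rewrite ?invr_ge0 ?exprn_ge0 // ?ler_nat //.
  by rewrite lef_pV2 ?posrE ?exprn_gt0 // -natrX ler_nat.
Qed.

Lemma goods_unit : lebesgue_measure (goods `&` unitI) = 1%E.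
Proof.
have m1 : lebesgue_measure unitI = 1%E.
  by rewrite /unitI lebesgue_measure_itv /= lte_fin ltr01 -EFinB subr0.
have null : (@lebesgue_measure R).-negligible (unitI `\` goods).
  have neg A : measurable A -> lebesgue_measure A = 0%E -> (@lebesgue_measure R).-negligible A.
    by move=> mA A0; exists A; split.
  apply: (@negligibleS _ _ _ _ (\bigcup_n (unitI `\` okG (e n)) `|`
     (\bigcup_n (unitI `\` okZ (Posz n)) `|` \bigcup_n (unitI `\` okZ (Negz n))))).
    move=> y [y01]; rewrite goodsE /= => /contrapT [[n _ h]|[[n|n] _ h]].
    - by left; exists n.
    - by right; left; exists n.
    - by right; right; exists n.
  have mD (E : set (measurableTypeR R)) : measurable E -> measurable (unitI `\` E).
    exact: measurableD.
  apply: negligibleU; last apply: negligibleU; apply: negligible_bigcup => n;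
    apply: neg; first [exact: nullZ | exact: (nullG (e_mem n)) | exact: (mD _ (mokG _)) | exact: (mD _ (mokZ _))].
have mg := measurable_goods.
apply/eqP; rewrite eq_le; apply/andP; split.
  rewrite -m1; apply: le_measure; rewrite ?inE //; exact: measurableI.
have le2 : (lebesgue_measure unitI <=
    lebesgue_measure (goods `&` unitI) + lebesgue_measure (unitI `\` goods))%E.
  rewrite [X in lebesgue_measure X](_ : unitI = (goods `&` unitI) `|` (unitI `\` goods)).
    by apply: measureU2; [exact: measurableI|exact: measurableD].
  by rewrite [goods `&` _]setIC setUIDK.
move: le2; rewrite m1 [X in (_ + X)%E](measure_negligible _ null) ?adde0 //.
exact: measurableD.
Qed.

Lemma measurable_moves h (r : rat) :
  measurable ([set y | moves h y (y + ratr r)] : set (measurableTypeR R)).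
Proof.
rewrite (_ : [set y | _] = [set y | exists k, exists2 j, match_at h k y j &
    ratr r = disp k (idx k y) j]).
  exact: (measurable_idx_ex (fun k i => exists2 j,
    (j < N k)%N /\ u k i = gmul o (u k j) h & ratr r = disp k i j)).
apply/seteqP; split => y /=.
  by move=> [k [j [mj /addrI rj]]]; exists k, j.
by move=> [k [j mj rj]]; exists k, j; split => //; rewrite rj.
Qed.

(** Starting from floor 0, the new floor is a difference of two positions below [N k]. *)
Lemma floor_moves_lt h k y y' : 0 <= y < 1 -> (exists j, match_at h k y j) ->
  moves h y y' -> (`|Num.floor y'| < N k)%N.
Proof.
move=> /floor_eq0 y0 [j mj] my.
have -> : y' = target k y j by apply: (moves_uniq my); exists k, j.
rewrite floor_target ?mj.1 // y0.
by have := z_lt mj.1; have := z_lt (idx_lt k y); lia.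
Qed.

Lemma odometer_coupling (phi : R -> R) :
  (forall t, 0 <= t -> 0 <= phi t) ->
  (forall s t, 0 <= s -> s <= t -> phi s <= phi t) ->
  (forall c : R, (\sum_(0 <= k <oo) (`|c| / 2 ^+ k * phi (N k.+1)%:R)%:E < +oo)%E) ->
  coupling_to_Z o phi.
Proof.
move=> phi_ge0 phi_nd phi_sum.
apply (@moves_coupling R T o ol moves goods unmatched N) => //.
- exact: measurable_goods.
- exact: goods_unit.
- exact: good_shift.
- by move=> h y gy mh; exact: good_exists.
- exact: moves_uniq.
- exact: moves_one.
- exact: moves_mul.
- exact: moves_shift.
- exact: moves_rat.
- exact: moves_domain.
- exact: measurable_moves.
- exact: measurable_unmatched.
- move=> h k y y' y01 nE my; apply: floor_moves_lt my => //.
  by apply: contrapT => nj; apply: nE.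
- by move=> h y mh [g _]; have [k [j mj]] := g h mh; exists k => -[_]; apply; exists j.
- exact: unmatched_le.
Qed.

End Odometer.

(** * The theorem *)

Local Open Scope classical_set_scope.
Local Open Scope ring_scope.

(** As soon as the boundary of [U k] under h is not all of [U k], some u and u h both lie in it. *)
Lemma tower_split (T : Type) (o : gops T) (U S : nat -> {fset {classic T}}) :
  group_laws o -> tower o U S -> forall h, gmem o h ->
  exists k i j, [/\ (i < #|` U k|)%N, (j < #|` U k|)%N &
    h = gmul o (ginv o (enumU o U S k i)) (enumU o U S k j)].
Proof.
move=> ol tw h mh; have [c hc] := tower_bdry tw mh.
(* Since c < 2 ^ c, the boundary at level c is proper. *)
pose k := c; have := hc k; rewrite -(enumU_bdry tw) => hk.
have [[i [j [iN jN uj]]]|nij] := pselect (exists i j, [/\ (i < #|` U k|)%N,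
    (j < #|` U k|)%N & enumU o U S k j = gmul o (enumU o U S k i) h]).
  by exists k, i, j; split => //; rewrite uj (opKg ol).
exfalso; move: hk; rewrite (eq_bigr (fun=> 1%N)); last first.
  by move=> i _; rewrite asboolT // => -[j jN uj]; apply: nij; exists i, j.
rewrite sum_nat_const card_ord muln1 leq_mul2r; apply/negP; rewrite negb_or.
by rewrite -lt0n (card_tower_gt0 tw) -ltnNge ltn_expl.
Qed.

Lemma tower_countable (T : Type) (o : gops T) (U S : nat -> {fset {classic T}}) :
  group_laws o -> tower o U S -> countable (gmem o).
Proof.
move=> ol tw.
pose f (t : nat * nat * nat) := gmul o (ginv o (enumU o U S t.1.1 t.1.2)) (enumU o U S t.1.1 t.2).
apply: (sub_countable (B := f @` setT)); last first.
  by apply: card_le_trans (card_image_le _ _) _; exact: countableP.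
apply: subset_card_le => h /(tower_split ol tw)[k [i [j [_ _ ->]]]].
by exists (k, i, j).
Qed.

Lemma countable_enum (T : Type) (A : set T) (x0 : T) : A x0 -> countable A ->
  exists e : nat -> T, (forall n, A (e n)) /\ forall x, A x -> exists n, e n = x.
Proof.
move=> Ax0 /countable_injP[f finj].
have ch i : exists x, A x /\ ((exists2 y, A y & f y = i) -> f x = i).
  have [[y Ay fy]|n] := pselect (exists2 y, A y & f y = i); first by exists y.
  by exists x0.
have [e eP] := choice ch; exists e; split=> [n|x Ax]; first by case: (eP n).
exists (f x); have [Ae fe] := eP (f x).
by apply: finj; rewrite ?inE //; apply: fe; exists x.
Qed.

Lemma geometric_nneseries (R : realType) (a rho : R) : 0 <= a -> 0 <= rho < 1 ->
  (\sum_(0 <= k <oo) (a * rho ^+ k)%:E < +oo)%E.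
Proof.
move=> a0 /andP[r0 r1].
apply: (@le_lt_trans _ _ (a / (1 - rho))%:E); last exact: ltry.
apply: lime_le.
  by apply: is_cvg_nneseries => k _ _; rewrite lee_fin mulr_ge0 // exprn_ge0.
apply: nearW => m; rewrite sumEFin lee_fin -mulr_sumr ler_wpM2l //.
have r1' : 0 < 1 - rho by rewrite subr_gt0.
rewrite -(ler_pM2l r1') divff ?gt_eqF //.
suff -> : (1 - rho) * \sum_(0 <= i < m) rho ^+ i = 1 - rho ^+ m.
  by rewrite gerBl exprn_ge0.
elim: m => [|m IH]; first by rewrite big_nil mulr0 expr0 subrr.
by rewrite big_nat_recr //= mulrDr IH exprS; ring.
Qed.

Lemma tower_coupling (R : realType) (F : finGroupType) (n : nat) (p : R) (phi : R -> R) :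
  0 < p -> p < 1 ->
  (forall t, 0 <= t -> 0 <= phi t) ->
  (forall s t, 0 <= s -> s <= t -> phi s <= phi t) ->
  (exists t0 : R, forall t, t0 <= t -> phi t = powR (iter n (@ln R) t) p) ->
  coupling_to_Z (Hops F n) phi.
Proof.
move=> p0 p1 phi_ge0 phi_nd [t0 ht0].
have [U [S [tw gr]]] := Htower R F n.
have ol := Hops_laws F n.
set o := Hops F n in tw ol *.
have [e [e_mem e_surj]] := countable_enum (mem_one ol) (tower_countable ol tw).
pose N k := #|` U k|; pose q k := #|` S k|.
pose s k r : Hc F n := nth (gone o : {classic (Hc F n)}) (S k) r.
pose u : nat -> nat -> Hc F n := enumU o U S.
pose z := zpos U S.
have N_gt0 k : (0 < N k)%N by exact: card_tower_gt0 tw k.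
have NS k : N k.+1 = (N k * q k)%N by exact: (card_towerS tw k).
have uS k i : u k.+1 i = gmul o (s k (i %% q k)%N) (u k (i %/ q k)%N) by [].
have zS k i : z k.+1 i = (z k (i %/ q k) + N k * (i %% q k))%N by [].
have u_mem k i : (i < N k)%N -> gmem o (u k i).
  by move=> ik; apply: (tower_mem tw (k := k)); exact: enumU_in.
have u_inj k i j : (i < N k)%N -> (j < N k)%N -> u k i = u k j -> i = j.
  exact: enumU_inj.
have z_lt k i : (i < N k)%N -> (z k i < N k)%N by exact: (zpos_lt tw).
have z_inj k i j : (i < N k)%N -> (j < N k)%N -> z k i = z k j -> i = j.
  exact: (zpos_inj tw).
have bad_u g : gmem o g -> exists c : nat, forall k,
  (2 ^ k * \sum_(i < N k)
     `[< ~ exists2 j, (j < N k)%N & u k j = gmul o (u k i) g >] <= c * N k)%N.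
  move=> /(tower_bdry tw)[c hc]; exists c => k.
  by apply: leq_trans (hc k); rewrite -(enumU_bdry tw).
have bad_z k (a : int) : (\sum_(i < N k)
  `[< ~ exists2 j, (j < N k)%N & ((z k j)%:Z = (z k i)%:Z + a)%R >] <= `|a|)%N.
  exact: (zpos_bad tw).
have N_ge k : (2 ^ k <= N k)%N by exact: tower_size tw k.
have [c1 c1_ge0 hc1] := gr 1 ler01.
(* At least [t0], so that phi is given by its formula at the iterated exponential, and at least 1,
   hence nonnegative. *)
pose C := Num.max c1 (Num.max t0 1).
have C1 : 1 <= C by rewrite !le_max lexx !orbT.
have C0 : 0 <= C by apply: le_trans C1.
have phiN k : phi (N k)%:R <= powR C p * powR 2 p ^+ k.
  have k1 : 1 <= (2 ^ k)%N%:R :> R by rewrite ler1n expn_gt0.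
  have Ck : C <= C * (2 ^ k)%N%:R by rewrite ler_peMr.
  apply: (@le_trans _ _ (phi (iter n expR (C * (2 ^ k)%N%:R)))).
    apply: phi_nd => //; have := hc1 k; rewrite mul1r => /le_trans; apply.
    by apply: iter_expR_le; rewrite ler_wpM2r // le_max lexx.
  rewrite ht0; last first.
    apply: le_trans (le_iter_expR _ _); apply: le_trans Ck.
    by rewrite /C !le_max lexx orbT.
  rewrite iter_expRK powRM // ler_wpM2l ?powR_ge0 // natrX.
  by rewrite -[2 ^+ k]powR_mulrn // -powRrM mulrC powRrM powR_mulrn ?powR_ge0.
apply: (odometer_coupling ol N_gt0 NS uS zS u_mem u_inj z_lt z_inj e_mem e_surj bad_u bad_z N_ge phi_ge0 phi_nd).
(* The ratio 2 ^ p / 2 is below 1 exactly because p < 1; the shift from k to k + 1 in the series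
   accounts for the extra factor 2 ^ p in [a]. *)
move=> c; pose a := `|c| * (powR C p * powR 2 p); pose rho := powR 2 p / 2.
have rho0 : 0 <= rho by rewrite divr_ge0 // powR_ge0.
have a0 : 0 <= a by rewrite !mulr_ge0 ?powR_ge0.
have rho1 : rho < 1.
  rewrite /rho ltr_pdivrMr // mul1r /powR pnatr_eq0 /=.
  rewrite -[ltRHS](@lnK R) ?posrE // ltr_expR -[ltRHS]mul1r ltr_pM2r //.
  by rewrite ln_gt0 // ltr1n.
apply: (@le_lt_trans _ _ (\sum_(0 <= k <oo) (a * rho ^+ k)%:E)%E); last first.
  by apply: geometric_nneseries => //; rewrite rho0.
apply: lee_nneseries => [k _|k _].
  by rewrite lee_fin mulr_ge0 ?divr_ge0 ?phi_ge0 // exprn_ge0.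
rewrite lee_fin /a /rho expr_div_n.
have -> : `|c| * (powR C p * powR 2 p) * (powR 2 p ^+ k / 2 ^+ k) =
    `|c| / 2 ^+ k * (powR C p * powR 2 p ^+ k.+1) by rewrite exprS; ring.
by rewrite ler_wpM2l ?divr_ge0 ?exprn_ge0.
Qed.

Theorem theorem4p11 (F : finGroupType) (n : nat) (R : realType) (p : R)
    (phi : R -> R) :
  (1 < #|F|)%N -> (1 <= n)%N -> 0 < p ->
  (forall t, 0 <= t -> 0 <= phi t) ->
  (forall s t, 0 <= s -> s <= t -> phi s <= phi t) ->
  (exists T : R, forall t, T <= t -> phi t = powR (iter n (@ln R) t) p) ->
  (phi_L0_coupling_Hn_to_Z F n phi <-> p < 1).
Proof.
move=> F1 n1 p0 phi_ge0 phi_nd phiE; split; last first.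
  by move=> p1; exact: tower_coupling p0 p1 phi_ge0 phi_nd phiE.
move=> [d [Om [mu [act [actZ [XG [XZ]]]]]]].
move=> [_ [actA [actZA [_ [_ [mp [mpZ [comm [fG [fZ [XGfin [XZfin [XZ0 phic]]]]]]]]]]]]].
rewrite ltNge; apply/negP => p1.
have [a a1] : exists a : F, a != 1%g.
  apply: contrapT => na; move: F1; rewrite ltnNge => /negP; apply.
  rewrite -(cards1 (1%g : F)) subset_leq_card //; apply/fintype.subsetP => x _.
  by rewrite inE; apply/eqP; apply: contrapT => /eqP x1; apply: na; exists x.
have ol := Hops_laws F n.
have [U [S [tw _]]] := Htower R F n.
(* The nonexistence argument is stated for n + 1, where [towS_ge] has an exponential to absorb M ^
   2. *)
case: n n1 phiE act actA mp comm fG phic ol U S tw => // n _ phiE act actA mp comm fG phic ol U S tw.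
apply: (no_coupling ol actA mp (tower_countable ol tw) actZA mpZ comm fG fZ
  XGfin XZfin XZ0 p1 phi_ge0 phi_nd phiE phic (S := Hgens a n.+1)).
  exact: Hgens_mem.
by move=> M M0; exact: isoper_H.
Qed.
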